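(* Let $A$ be a C$^*$-algebra with self-adjoint part $A_{sa}$. Then every triple derivation from $A$ into a complex Banach triple $A$-module is continuous. Likewise, every triple derivation from $A_{sa}$ into a real Banach triple $A_{sa}$-module is continuous.
   Context: A complex (resp. real) Jordan triple is a complex (resp. real) vector space $E$ with a triple product $\{\cdot,\cdot,\cdot\}:E^3\to E$, bilinear and symmetric in the outer variables and conjugate linear (resp. linear) in the middle one, with $L(a,b)L(x,y)-L(x,y)L(a,b)=L(L(a,b)x,y)-L(x,L(b,a)y)$, where $L(x,y)z=\{x,y,z\}$. It is a Jordan Banach triple if it is a Banach space with continuous triple product. A C$^*$-algebra $A$ is regarded as a complex Jordan Banach triple with $\{a,b,c\}=\frac12(ab^*c+cb^*a)$, and $A_{sa}$ as a real Jordan Banach triple with $\{a,b,c\}=\frac12(abc+cba)$. A triple $E$-module over a complex (resp. real) Jordan triple $E$ is a complex (resp. real) vector space $X$ with mappings $\{\cdot,\cdot,\cdot\}_1:X\times E\times E\to X$, $\{\cdot,\cdot,\cdot\}_2:E\times X\times E\to X$, $\{\cdot,\cdot,\cdot\}_3:E\times E\times X\to X$ such that: (JTM1) $\{x,a,b\}_1$ is linear in $a,x$ and conjugate linear in $b$ (resp. trilinear), $\{a,b,x\}_3$ is linear in $b,x$ and conjugate linear in $a$ (resp. trilinear), $\{a,x,b\}_2$ is conjugate linear in $a,b,x$ (resp. trilinear); (JTM2) $\{x,b,a\}_1=\{a,b,x\}_3$ and $\{a,x,b\}_2=\{b,x,a\}_2$; (JTM3) writing $\{\cdot,\cdot,\cdot\}$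 for any of the products, $\{a,b,\{c,d,e\}\}=\{\{a,b,c\},d,e\}-\{c,\{b,a,d\},e\}+\{c,d,\{a,b,e\}\}$ whenever one of $a,b,c,d,e$ is in $X$ and the rest are in $E$. If $E$ is a Jordan Banach triple, $X$ is a Banach space and the three products are jointly continuous, $X$ is a Banach triple $E$-module. A triple derivation from a complex (resp. real) Jordan triple $E$ to a triple $E$-module $X$ is a conjugate linear (resp. linear) map $\delta:E\to X$ (not assumed continuous) with $\delta\{a,b,c\}=\{\delta(a),b,c\}+\{a,\delta(b),c\}+\{a,b,\delta(c)\}$ for all $a,b,c\in E$. *)

(* Defs.v *)
From HB Require Import structures.
From mathcomp Require Import all_boot all_order all_algebra.
From mathcomp.real_closed Require Import complex.
From mathcomp Require Import boolp classical_sets reals topology normedtype.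

Set Implicit Arguments.
Unset Strict Implicit.
Unset Printing Implicit Defensive.

Import Order.TTheory GRing.Theory Num.Theory.
Import numFieldNormedType.Exports.

Local Open Scope classical_set_scope.
Local Open Scope ring_scope.

(* s is the identity (linear maps) or Num.conj on R[i] (conjugate linear
   maps). *)
Definition semilinear (K : numFieldType) (s : K -> K) (U V : lmodType K)
    (f : U -> V) : Prop :=
  linear_for (s \; *:%R) f.

Definition continuous3 (S T U V : topologicalType) (f : S -> T -> U -> V) :=
  continuous (fun p : S * T * U => f p.1.1 p.1.2 p.2).

(* Complex Jordan triples are obtained with K = R[i] and s = Num.conj, real
   ones with K = R and s = id; the same convention is used for modules and
   derivations. The last field is
   L(a,b) L(x,y) - L(x,y) L(a,b) = L(L(a,b)x, y) - L(x, L(b,a)y). *)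
Record is_jordan_triple (K : numFieldType) (s : K -> K) (E : lmodType K)
    (tp : E -> E -> E -> E) : Prop := IsJordanTriple {
  jt_linear_l : forall b c, linear (fun a => tp a b c);
  jt_semilinear_m : forall a c, semilinear s (fun b => tp a b c);
  jt_linear_r : forall a b, linear (fun c => tp a b c);
  jt_sym : forall a b c, tp a b c = tp c b a;
  jt_identity : forall a b x y z,
    tp a b (tp x y z) - tp x y (tp a b z) =
    tp (tp a b x) y z - tp x (tp b a y) z
}.

Record is_jordan_banach_triple (K : numFieldType) (s : K -> K)
    (E : completeNormedModType K) (tp : E -> E -> E -> E) : Prop :=
    IsJordanBanachTriple {
  jbt_triple : is_jordan_triple s tp;
  jbt_continuous : continuous3 tp
}.

(* The fields jtm3_* are the five instances of
     {a,b,{c,d,e}} = {{a,b,c},d,e} - {c,{b,a,d},e} + {c,d,{a,b,e}},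
   named after the variable that ranges over X. *)
Record is_triple_module (K : numFieldType) (s : K -> K) (E : lmodType K)
    (tp : E -> E -> E -> E) (X : lmodType K)
    (m1 : X -> E -> E -> X) (m2 : E -> X -> E -> X) (m3 : E -> E -> X -> X)
    : Prop := IsTripleModule {
  jtm1_1x : forall a b, linear (fun x => m1 x a b);
  jtm1_1a : forall x b, linear (fun a => m1 x a b);
  jtm1_1b : forall x a, semilinear s (fun b => m1 x a b);
  jtm1_2a : forall x b, semilinear s (fun a => m2 a x b);
  jtm1_2x : forall a b, semilinear s (fun x => m2 a x b);
  jtm1_2b : forall a x, semilinear s (fun b => m2 a x b);
  jtm1_3a : forall b x, semilinear s (fun a => m3 a b x);
  jtm1_3b : forall a x, linear (fun b => m3 a b x);
  jtm1_3x : forall a b, linear (fun x => m3 a b x);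
  jtm2_13 : forall x a b, m1 x b a = m3 a b x;
  jtm2_2 : forall a x b, m2 a x b = m2 b x a;
  jtm3_a : forall (a : X) (b c d e : E),
    m1 a b (tp c d e) =
    m1 (m1 a b c) d e - m2 c (m2 b a d) e + m3 c d (m1 a b e);
  jtm3_b : forall (a : E) (b : X) (c d e : E),
    m2 a b (tp c d e) =
    m1 (m2 a b c) d e - m2 c (m1 b a d) e + m3 c d (m2 a b e);
  jtm3_c : forall (a b : E) (c : X) (d e : E),
    m3 a b (m1 c d e) =
    m1 (m3 a b c) d e - m1 c (tp b a d) e + m1 c d (tp a b e);
  jtm3_d : forall (a b c : E) (d : X) (e : E),
    m3 a b (m2 c d e) =
    m2 (tp a b c) d e - m2 c (m3 b a d) e + m2 c d (tp a b e);
  jtm3_e : forall (a b c d : E) (e : X),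
    m3 a b (m3 c d e) =
    m3 (tp a b c) d e - m3 c (tp b a d) e + m3 c d (m3 a b e)
}.

Record is_banach_triple_module (K : numFieldType) (s : K -> K)
    (E : completeNormedModType K) (tp : E -> E -> E -> E)
    (X : completeNormedModType K)
    (m1 : X -> E -> E -> X) (m2 : E -> X -> E -> X) (m3 : E -> E -> X -> X)
    : Prop := IsBanachTripleModule {
  btm_jbt : is_jordan_banach_triple s tp;
  btm_module : is_triple_module s tp m1 m2 m3;
  btm_continuous1 : continuous3 m1;
  btm_continuous2 : continuous3 m2;
  btm_continuous3 : continuous3 m3
}.

Record is_triple_derivation (K : numFieldType) (s : K -> K) (E : lmodType K)
    (tp : E -> E -> E -> E) (X : lmodType K)
    (m1 : X -> E -> E -> X) (m2 : E -> X -> E -> X) (m3 : E -> E -> X -> X)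
    (delta : E -> X) : Prop := IsTripleDerivation {
  td_semilinear : semilinear s delta;
  td_leibniz : forall a b c,
    delta (tp a b c) =
    m1 (delta a) b c + m2 a (delta b) c + m3 a b (delta c)
}.

(* C*-algebras need not be unital, so they are not based on the ring
   structures of the library, which all have a unit. The norm takes its values
   in the nonnegative reals of R[i]. *)
HB.mixin Record isCStarAlgebra (R : realType) A
    of CompleteNormedModule R[i] A := {
  cmul : A -> A -> A;
  cstar : A -> A;
  cmulA : forall a b c, cmul a (cmul b c) = cmul (cmul a b) c;
  cmul_linear_l : forall b, linear (fun a => cmul a b);
  cmul_linear_r : forall a, linear (cmul a);
  cmul_norm : forall a b, `|cmul a b| <= `|a| * `|b|;
  cstarK : forall a, cstar (cstar a) = a;
  cstar_semilinear : semilinear Num.conj cstar;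
  cstarM : forall a b, cstar (cmul a b) = cmul (cstar b) (cstar a);
  cstar_norm : forall a, `|cmul (cstar a) a| = `|a| ^+ 2
}.

#[short(type="cstarAlgType")]
HB.structure Definition CStarAlgebra (R : realType) :=
  {A of isCStarAlgebra R A & CompleteNormedModule R[i] A}.

Lemma continuous_map3 (S T : topologicalType) (h : S -> T) : continuous h ->
  continuous (fun p : S * S * S => ((h p.1.1, h p.1.2), h p.2)).
Proof.
move=> hc -[[a b] c].
have c1 : fst @ ((a, b), c) --> (a, b) by exact: cvg_fst.
have c2 : snd @ ((a, b), c) --> c by exact: cvg_snd.
have ca : h p.1.1 @[p --> ((a, b), c)] --> h a.
  by apply: (cvg_comp _ _ (cvg_comp _ _ c1 cvg_fst)); exact: hc.
have cb : h p.1.2 @[p --> ((a, b), c)] --> h b.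
  by apply: (cvg_comp _ _ (cvg_comp _ _ c1 cvg_snd)); exact: hc.
have cc : h p.2 @[p --> ((a, b), c)] --> h c.
  by apply: (cvg_comp _ _ c2); exact: hc.
have cab : (h p.1.1, h p.1.2) @[p --> ((a, b), c)] --> (h a, h b).
  exact: (cvg_pair ca cb).
exact: (cvg_pair cab cc).
Qed.

Section CStarTheory.
Context {R : realType} {A : cstarAlgType R}.
Implicit Types (a b c d : A) (k : R[i]).

Local Notation "a ** b" := (cmul a b) (at level 40, left associativity).
Local Notation "a ^#" := (cstar a) (at level 2, format "a ^#").

Lemma cmulDl a b c : (a + b) ** c = a ** c + b ** c.
Proof. by have := cmul_linear_l c 1 a b; rewrite !scale1r. Qed.

Lemma cmulDr a b c : a ** (b + c) = a ** b + a ** c.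
Proof. by have := cmul_linear_r a 1 b c; rewrite !scale1r. Qed.

Lemma cmul0l a : 0 ** a = 0.
Proof. by apply: (addIr (0 ** a)); rewrite -cmulDl !add0r. Qed.

Lemma cmul0r a : a ** 0 = 0.
Proof. by apply: (addIr (a ** 0)); rewrite -cmulDr !add0r. Qed.

Lemma cmulZl k a b : (k *: a) ** b = k *: (a ** b).
Proof.
by have := cmul_linear_l b k a 0; rewrite addr0 cmul0l addr0.
Qed.

Lemma cmulZr k a b : a ** (k *: b) = k *: (a ** b).
Proof.
by have := cmul_linear_r a k b 0; rewrite addr0 cmul0r addr0.
Qed.

Lemma cmulNl a b : (- a) ** b = - (a ** b).
Proof. by rewrite -scaleN1r cmulZl scaleN1r. Qed.

Lemma cmulNr a b : a ** (- b) = - (a ** b).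
Proof. by rewrite -scaleN1r cmulZr scaleN1r. Qed.

Lemma cstarD a b : (a + b)^# = a^# + b^#.
Proof.
have := @cstar_semilinear R A 1 a b; rewrite /= rmorph1 !scale1r; exact.
Qed.

Lemma cstar0 : (0 : A)^# = 0.
Proof. by apply: (addIr ((0 : A)^#)); rewrite -cstarD !add0r. Qed.

Lemma cstarZ k a : (k *: a)^# = k^* *: a^#.
Proof.
by have := @cstar_semilinear R A k a 0; rewrite /= addr0 cstar0 addr0; exact.
Qed.

Lemma cstarN a : (- a)^# = - a^#.
Proof. by rewrite -scaleN1r cstarZ rmorphN1 scaleN1r. Qed.

Lemma norm_cstar a : `|a^#| = `|a|.
Proof.
have le_norm b : `|b| <= `|b^#|.
  have [->|b0] := eqVneq b 0; first by rewrite cstar0.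
  have nb0 : 0 < `|b| by rewrite normr_gt0.
  rewrite -(ler_pM2r nb0) -expr2 -cstar_norm; exact: cmul_norm.
by apply/eqP; rewrite eq_le le_norm -{2}(cstarK a) le_norm.
Qed.

Lemma cstar_continuous : continuous (@cstar R A).
Proof.
move=> a; apply/cvgrPdist_lt => e e0.
near=> b; rewrite -cstarN -cstarD norm_cstar; near: b.
exact: cvgr_dist_lt.
Unshelve. all: by end_near. Qed.

Lemma cmul_continuous : continuous (fun p : A * A => p.1 ** p.2).
Proof.
move=> [a b]; apply/cvgrPdist_le => /= e e0.
pose M := `|a| + `|b| + 1 + e.
have M0 : 0 < M by rewrite ltr_wpDl ?addr_ge0.
have d0 : 0 < e / M by rewrite divr_gt0.
have d1 : e / M <= 1 by rewrite ler_pdivrMr// mul1r lerDr !addr_ge0.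
have n1 : \forall p \near (a, b), `|a - p.1| < e / M.
  have /cvgr_dist_lt : fst @ (a, b) --> a by exact: cvg_fst.
  exact.
have n2 : \forall p \near (a, b), `|b - p.2| < e / M.
  have /cvgr_dist_lt : snd @ (a, b) --> b by exact: cvg_snd.
  exact.
near=> p.
have h1 : `|a - p.1| <= e / M by apply: ltW; near: p.
have h2 : `|b - p.2| <= e / M by apply: ltW; near: p.
have -> : a ** b - p.1 ** p.2 = (a - p.1) ** b + p.1 ** (b - p.2).
  by rewrite cmulDl cmulNl cmulDr cmulNr addrA subrK.
rewrite (le_trans (ler_normD _ _))//.
have hp : `|p.1| <= `|a| + 1.
  have -> : p.1 = a - (a - p.1) by rewrite opprB addrC subrK.
  by rewrite (le_trans (ler_normB _ _))// lerD2l (le_trans h1).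
have eE : e / M * (`|b| + (`|a| + 1) + e) = e.
  by rewrite addrA (addrC `|b|) -/M divfK ?gt_eqF.
rewrite -[leRHS]eE mulrDr; apply: ler_wpDr.
  by rewrite mulr_ge0// ltW.
rewrite mulrDr; apply: lerD.
  by rewrite (le_trans (cmul_norm _ _))// ler_wpM2r.
by rewrite (le_trans (cmul_norm _ _))// mulrC ler_pM.
Unshelve. all: by end_near. Qed.

Definition cstar_triple a b c : A :=
  2^-1 *: (a ** b^# ** c + c ** b^# ** a).

Local Lemma conj_half : (2^-1 : R[i])^* = 2^-1.
Proof. by rewrite fmorphV rmorph_nat. Qed.

Lemma cstar_triple_jordan : is_jordan_triple Num.conj cstar_triple.
Proof.
have sym a b c : cstar_triple a b c = cstar_triple c b a.
  by rewrite /cstar_triple addrC.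
have linl b c : linear (fun a => cstar_triple a b c).
  move=> k x y; rewrite /cstar_triple !cmulDl !cmulZl !cmulDr !cmulZr.
  by rewrite [in LHS]addrACA -scalerDr (scalerDr 2^-1) !scalerA (mulrC k).
split => //.
- move=> a c k x y; rewrite /cstar_triple /= cstarD cstarZ.
  rewrite !(cmulDl, cmulZl, cmulDr, cmulZr).
  by rewrite [in LHS]addrACA -scalerDr (scalerDr 2^-1) !scalerA (mulrC k^*).
- by move=> a b k x y; rewrite !(sym a); exact: linl.
move=> a b x y z; apply/eqP; rewrite subr_eq addrAC eq_sym subr_eq; apply/eqP.
rewrite /cstar_triple !(cstarZ, cmulZl, cmulZr, conj_half) -!scalerDr.
congr (_ *: (_ *: _)).
rewrite !(cstarD, cstarM, cstarK, cmulDl, cmulDr, cmulA).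
by rewrite !addrA [LHS](ACl (1*7*6*4*5*2*3*8)).
Qed.

Lemma cstar_triple_jordan_banach :
  is_jordan_banach_triple Num.conj cstar_triple.
Proof.
split; first exact: cstar_triple_jordan.
have c3 : continuous3 (fun a b c : A => a ** b^# ** c).
  move=> -[[a b] c] /=.
  have c1 : fst @ ((a, b), c) --> (a, b) by exact: cvg_fst.
  apply: (@continuous2_cvg _ _ _ _ _ _ (fun p => p.1.1 ** p.1.2^#) snd
    (fun a b => a ** b)).
  - exact: (@cmul_continuous (a ** b^#, c)).
  - apply: (@continuous2_cvg _ _ _ _ _ _ (fun p => p.1.1) (fun p => p.1.2^#)
      (fun a b => a ** b)).
    + exact: (@cmul_continuous (a, b^#)).
    + by apply: cvg_comp c1 _; exact: cvg_fst.
    + apply: (@continuous_cvg _ _ _ _ _ (fun p => p.1.2) (@cstar R A)).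
        exact: cstar_continuous.
      by apply: cvg_comp c1 _; exact: cvg_snd.
  - exact: cvg_snd.
move=> -[[a b] c]; apply: cvgZr; apply: cvgD; first exact: c3.
have c1 : fst @ ((a, b), c) --> (a, b) by exact: cvg_fst.
have swap : ((p.2, p.1.2), p.1.1) @[p --> ((a, b), c)] --> ((c, b), a).
  have c12 : (p.2, p.1.2) @[p --> ((a, b), c)] --> (c, b).
    by exact: (cvg_pair cvg_snd (cvg_comp _ _ c1 cvg_snd)).
  exact: (cvg_pair c12 (cvg_comp _ _ c1 cvg_fst)).
exact: (cvg_comp _ _ swap (c3 ((c, b), a))).
Qed.

End CStarTheory.

Section SelfAdjoint.
Context {R : realType} {A : cstarAlgType R}.

Definition sa_pred : {pred A} := [pred a | cstar a == a].

Lemma sa_pred_zmod_closed : zmod_closed sa_pred.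
Proof.
split; first by rewrite inE cstar0.
by move=> a b /eqP ha /eqP hb; rewrite inE cstarD cstarN ha hb.
Qed.

HB.instance Definition _ := GRing.isZmodClosed.Build A sa_pred
  sa_pred_zmod_closed.

Record selfAdjoint := SelfAdjoint {
  sa_val :> A;
  sa_valP : sa_val \in sa_pred
}.

HB.instance Definition _ := [isSub for sa_val].
HB.instance Definition _ := [Choice of selfAdjoint by <:].
HB.instance Definition _ := [SubChoice_isSubZmodule of selfAdjoint by <:].

Implicit Types (a b c : selfAdjoint) (r : R).

Lemma sa_cstar a : cstar (sa_val a) = sa_val a.
Proof. exact/eqP/sa_valP. Qed.

Lemma sa_scale_subproof r a :
  r%:C%C *: sa_val a \in sa_pred.
Proof. by rewrite inE cstarZ sa_cstar; rewrite [_^*]conjc_real. Qed.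

Definition sa_scale r a : selfAdjoint := SelfAdjoint (sa_scale_subproof r a).

Fact sa_scaleA r t a : sa_scale r (sa_scale t a) = sa_scale (r * t) a.
Proof. by apply: val_inj; rewrite /= scalerA rmorphM. Qed.

Fact sa_scale1 : left_id 1 sa_scale.
Proof. by move=> a; apply: val_inj; rewrite /= rmorph1 scale1r. Qed.

Fact sa_scaleDr : right_distributive sa_scale +%R.
Proof. by move=> r a b; apply: val_inj; rewrite /= scalerDr. Qed.

Fact sa_scaleDl a : {morph sa_scale^~ a : r t / r + t}.
Proof. by move=> r t; apply: val_inj; rewrite /= rmorphD scalerDl. Qed.

HB.instance Definition _ := GRing.Zmodule_isLmodule.Build R selfAdjoint
  sa_scaleA sa_scale1 sa_scaleDr sa_scaleDl.

(* The norm of A takes real values in R[i]; it is transported to R here. *)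
Definition sa_norm a : R := complex.Re `|sa_val a|.

Lemma sa_normE a : (sa_norm a)%:C%C = `|sa_val a|.
Proof. by rewrite /sa_norm RRe_real// normr_real. Qed.

Fact sa_normD a b : sa_norm (a + b) <= sa_norm a + sa_norm b.
Proof. by rewrite -lecR rmorphD /= !sa_normE ler_normD. Qed.

Fact sa_normZ r a : sa_norm (r *: a) = `|r| * sa_norm a.
Proof.
apply: (@complexI R); rewrite rmorphM /= !sa_normE /= normrZ.
by rewrite normc_def /= expr0n addr0 sqrtr_sqr.
Qed.

Fact sa_norm0_eq0 a : sa_norm a = 0 -> a = 0.
Proof.
move=> a0; apply/val_inj/eqP; rewrite /= -normr_eq0 -sa_normE a0.
by rewrite rmorph0.
Qed.

HB.instance Definition _ := Lmodule_isNormed.Build R selfAdjoint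
  sa_normD sa_normZ sa_norm0_eq0.

Lemma norm_saE a : (`|a|)%:C%C = `|sa_val a|.
Proof. exact: sa_normE. Qed.

Lemma ball_saE a r b : 0 < r -> ball a r b = ball (sa_val a) r%:C%C (sa_val b).
Proof.
by move=> r0; rewrite -!ball_normE /ball_ /= -ltcR norm_saE.
Qed.

Lemma sa_complete (F : set_system selfAdjoint) :
  ProperFilter F -> cauchy F -> cvg F.
Proof.
move=> FF /cauchyP Fc.
have Gc : cauchy (sa_val @ F).
  apply/cauchyP => e e0.
  have eE : (complex.Re e)%:C%C = e by rewrite RRe_real// gtr0_real.
  have r0 : 0 < complex.Re e by rewrite -ltcR eE.
  have [a Fa] := Fc _ r0; exists (sa_val a).
  suff : F [set b | ball (sa_val a) e (sa_val b)] by [].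
  by apply: filterS Fa => b; rewrite ball_saE// eE.
have : cvg (sa_val @ F) by exact: (cauchy_cvg _ Gc).
move=> /cvg_ex[l Fl].
have ls : l \in sa_pred.
  rewrite inE; apply/eqP; apply: (@norm_cvg_unique _ A (sa_val @ F)) => //.
  have sE : @cstar R A \o sa_val = sa_val.
    by apply/funext => a; exact: sa_cstar.
  by have := continuous_cvg _ (@cstar_continuous R A l) Fl; rewrite sE; exact.
apply/cvg_ex; exists (SelfAdjoint ls).
apply/fcvg_ballP => e e0.
have e0' : 0 < e%:C%C :> R[i] by rewrite ltcR.
have : F [set b | ball l e%:C%C (sa_val b)].
  by move: Fl => /cvg_ballP; exact.
by apply: filterS => b; rewrite ball_saE.
Qed.

HB.instance Definition _ := Uniform_isComplete.Build selfAdjoint sa_complete.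

(* The two summands need not be self-adjoint, but their sum is. *)
Lemma sa_triple_subproof a b c :
  cmul (cmul (sa_val a) (sa_val b)) (sa_val c) +
  cmul (cmul (sa_val c) (sa_val b)) (sa_val a) \in sa_pred.
Proof. by rewrite inE cstarD !cstarM !sa_cstar !cmulA addrC. Qed.

Definition sa_triple a b c : selfAdjoint :=
  2^-1 *: SelfAdjoint (sa_triple_subproof a b c).

Lemma sa_tripleE a b c :
  sa_val (sa_triple a b c) = cstar_triple (sa_val a) (sa_val b) (sa_val c).
Proof. by rewrite /sa_triple /= /cstar_triple sa_cstar fmorphV rmorph_nat. Qed.

End SelfAdjoint.
Arguments selfAdjoint {R} A.

Section SelfAdjointTriple.
Context {R : realType} {A : cstarAlgType R}.
Implicit Types (a b c : selfAdjoint A) (r : R).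

Lemma sa_val_continuous : continuous (@sa_val R A).
Proof.
move=> a; have FF : Filter (nbhs a) by exact: nbhs_filter.
apply/cvg_ballP => e e0.
have eE : (complex.Re e)%:C%C = e by rewrite RRe_real// gtr0_real.
have r0 : 0 < complex.Re e by rewrite -ltcR eE.
have : nbhs a (ball a (complex.Re e)) by exact: nbhsx_ballx.
by apply: filterS => b; rewrite ball_saE// eE.
Qed.

Lemma sa_val_inj : injective (@sa_val R A).
Proof. exact: val_inj. Qed.

Lemma sa_valD a b : sa_val (a + b) = sa_val a + sa_val b.
Proof. by []. Qed.

Lemma sa_valN a : sa_val (- a) = - sa_val a.
Proof. by []. Qed.

Lemma sa_valZ r a : sa_val (r *: a) = r%:C%C *: sa_val a.
Proof. by []. Qed.

Lemma sa_triple_jordan : is_jordan_triple id (@sa_triple R A).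
Proof.
have [linl semm linr sym jid] := @cstar_triple_jordan R A.
have sa_valE := (sa_valD, sa_valN, sa_valZ, @sa_tripleE R A).
split.
- by move=> b c r x y; apply: sa_val_inj; rewrite !sa_valE linl.
- move=> a c r x y; apply: sa_val_inj; rewrite !sa_valE semm /=.
  by rewrite [_^*]conjc_real.
- by move=> a b r x y; apply: sa_val_inj; rewrite !sa_valE linr.
- by move=> a b c; apply: sa_val_inj; rewrite !sa_valE sym.
- by move=> a b x y z; apply: sa_val_inj; rewrite !sa_valE jid.
Qed.

Lemma sa_triple_jordan_banach : is_jordan_banach_triple id (@sa_triple R A).
Proof.
split; first exact: sa_triple_jordan.
have cA := jbt_continuous (@cstar_triple_jordan_banach R A).
move=> -[[a b] c]; apply/cvg_ballP => e e0.
have e0' : 0 < e%:C%C :> R[i] by rewrite ltcR.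
have h3 := continuous_map3 (@sa_val_continuous).
have := cvg_comp _ _ (h3 ((a, b), c)) (cA ((sa_val a, sa_val b), sa_val c)).
have F3 : Filter (nbhs ((a, b), c)) by exact: nbhs_filter.
move=> /cvg_ballP/(_ _ e0'); apply: (@filterS _ _ F3) => -[[x y] z].
by rewrite ball_saE// !sa_tripleE; exact.
Qed.

End SelfAdjointTriple.

(* Main.v *)
(* Let B be the unitization of A, J its self-adjoint elements lying in A, and
   delta the restriction of the derivation to A_sa. Leibniz' rule shows that
   delta {a, z, c} - {a, delta z, c} is bounded in z. Let I be the set of the a in
   J such that delta {a, ., c} is bounded for every c in J. The Jordan identity
   makes I a Jordan ideal, the uniform boundedness principle makes it closed,
   and (i[a,b])^2 being a Jordan polynomial makes it the self-adjoint part of a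
   closed two-sided ideal K of A. A gliding hump argument, applied successively
   to {a_n, ., a_n}, to {a_n, ., sum_(k > n) a_k / 4^k} and to {a_n, ., c}, shows
   that no infinite sequence of orthogonal self-adjoint elements stays outside
   K, so K has finite codimension: otherwise such a sequence is built by
   functional calculus. By Cohen's factorization a null sequence in I has the
   form h c_n h with h in I and c_n bounded, hence delta is bounded on I, and
   therefore on A_sa. In the complex case delta is determined by its
   restriction to A_sa. *)

(* Only the real structure of the self-adjoint part is used, so the real and the complex case share
   one argument; complex scalars survive as products with the central element [uI]. The unit is
   needed for terms such as [1 - q * q * z], although the derivation lives on A_sa. No spectral
   theory is developed: inverses come from the Neumann series, square roots from an iteration, and
   positivity is replaced by sums of two commuting squares. Three humps are needed because for an
   arbitrary c the tail of {a_n, ., c} does not vanish: c need not be orthogonal to the later a_k.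
   The weighted sum of the second hump is orthogonal to a_n, and its product with a later a_k is
   a_k^2 / 4^k; so the tail of the third hump can be rewritten as a value of the operator bounded by
   the second. The weights 32^-k of the humps absorb the factor 16^k lost in this rewriting. Finite
   codimension suffices because modulo K each corner p_i B p_j has complex dimension at most one,
   with coefficients controlled by the distance of p_i to K. *)
Require Import Defs.
From HB Require Import structures.
From mathcomp Require Import all_boot all_order all_algebra.
From mathcomp Require Import ring lra.
From mathcomp.real_closed Require Import complex.
From mathcomp Require Import boolp classical_sets reals topology normedtype.
From mathcomp Require Import sequences.
Import Order.TTheory GRing.Theory Num.Theory.
Import numFieldNormedType.Exports.
Set Implicit Arguments.
Unset Strict Implicit.
Unset Printing Implicit Defensive.
Local Open Scope classical_set_scope.
Local Open Scope ring_scope.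

(** * Deciding identities in noncommutative rings *)

Inductive ncexpr :=
| NCvar of nat | NC0 | NC1 | NCadd of ncexpr & ncexpr | NCopp of ncexpr
| NCmul of ncexpr & ncexpr | NCexp of ncexpr & nat | NCmuln of ncexpr & nat.

(* A polynomial is a list of signed words in the variables. *)
Definition ncpoly := seq (bool * seq nat).

Definition ncneg (p : ncpoly) : ncpoly := [seq (~~ m.1, m.2) | m <- p].
Definition ncprod (p q : ncpoly) : ncpoly :=
  [seq (m.1 (+) m'.1, m.2 ++ m'.2) | m <- p, m' <- q].
Fixpoint ncnorm (e : ncexpr) : ncpoly :=
  match e with
  | NCvar i => [:: (false, [:: i])]
  | NC0 => [::]
  | NC1 => [:: (false, [::])]
  | NCadd a b => ncnorm a ++ ncnorm b
  | NCopp a => ncneg (ncnorm a)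
  | NCmul a b => ncprod (ncnorm a) (ncnorm b)
  | NCexp a n => iter n (ncprod (ncnorm a)) [:: (false, [::])]
  | NCmuln a n => iter n (cat (ncnorm a)) [::]
  end.

(** A word cancels against its opposite when that is present, so an identity of free rings leaves
    the empty list. *)
Definition ncinsert (m : bool * seq nat) (p : ncpoly) : ncpoly :=
  if (~~ m.1, m.2) \in p then rem (~~ m.1, m.2) p else m :: p.
Definition ncequal (a b : ncexpr) : bool :=
  nilp (foldr ncinsert [::] (ncnorm (NCadd a (NCopp b)))).

Section NCRing.
Variables (S : pzRingType) (env : seq S).

Fixpoint nceval (e : ncexpr) : S :=
  match e with
  | NCvar i => nth 0 env i
  | NC0 => 0
  | NC1 => 1
  | NCadd a b => nceval a + nceval b
  | NCopp a => - nceval a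
  | NCmul a b => nceval a * nceval b
  | NCexp a n => nceval a ^+ n
  | NCmuln a n => nceval a *+ n
  end.

Definition ncmon (m : bool * seq nat) : S :=
  (-1) ^+ m.1 * \prod_(i <- m.2) nth 0 env i.
Definition ncsum (p : ncpoly) : S := \sum_(m <- p) ncmon m.

Lemma ncmonN m : ncmon (~~ m.1, m.2) = - ncmon m.
Proof. by rewrite /ncmon /=; case: m.1; rewrite ?mulN1r ?mul1r ?opprK. Qed.

Lemma ncsum_prod p q : ncsum (ncprod p q) = ncsum p * ncsum q.
Proof.
rewrite /ncsum big_allpairs_dep mulr_suml; apply: eq_bigr => -[a u] _.
rewrite mulr_sumr; apply: eq_bigr => -[b v] _.
rewrite /ncmon /= big_cat /= signr_addb -!mulrA; congr (_ * _).
by rewrite !mulrA; congr (_ * _); case: b; rewrite ?mulN1r ?mulrN1 ?mul1r ?mulr1.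
Qed.

Lemma ncnormP e : ncsum (ncnorm e) = nceval e.
Proof.
elim: e => //= [i|||a IHa b IHb|a IHa|a IHa b IHb|a IHa n|a IHa n].
- by rewrite /ncsum /ncmon !big_seq1 mul1r.
- by rewrite /ncsum big_nil.
- by rewrite /ncsum /ncmon big_seq1 mul1r big_nil.
- by rewrite /ncsum big_cat -IHa -IHb.
- rewrite -IHa /ncsum big_map (big_morph _ (@opprD _) (oppr0 _)).
  by apply: eq_bigr => m _; rewrite ncmonN.
- by rewrite ncsum_prod IHa IHb.
- elim: n => [|n IH]; first by rewrite /ncsum /ncmon big_seq1 mul1r big_nil.
  by rewrite iterS ncsum_prod IH IHa exprS.
- elim: n => [|n IH]; first by rewrite /ncsum big_nil.
  by rewrite iterS mulrS -IH -IHa /ncsum big_cat.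
Qed.

Lemma ncinsertP m p : ncsum (ncinsert m p) = ncmon m + ncsum p.
Proof.
rewrite /ncinsert; case: ifP => h; last by rewrite /ncsum big_cons.
rewrite /ncsum [in RHS](perm_big _ (perm_to_rem h)) big_cons ncmonN addrA.
by rewrite subrr add0r.
Qed.

Lemma ncequalP a b : ncequal a b -> nceval a = nceval b.
Proof.
move=> /nilP h; apply/eqP; rewrite -subr_eq0; apply/eqP.
have {h} : ncsum (foldr ncinsert [::] (ncnorm (NCadd a (NCopp b)))) = 0.
  by rewrite h /ncsum big_nil.
have -> q : ncsum (foldr ncinsert [::] q) = ncsum q.
  elim: q => // m q IH.
  by rewrite [foldr _ _ _]/= ncinsertP IH /ncsum big_cons.
by rewrite ncnormP.
Qed.

End NCRing.

Ltac nc_find x l :=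
  match l with
  | x :: _ => constr:(0%N)
  | _ :: ?l' => let n := nc_find x l' in constr:(n.+1)
  end.
Ltac nc_atoms env e :=
  match e with
  | 0 => env
  | 1 => env
  | ?a + ?b => let env := nc_atoms env a in nc_atoms env b
  | - ?a => nc_atoms env a
  | ?a * ?b => let env := nc_atoms env a in nc_atoms env b
  | ?a ^+ ?n => nc_atoms env a
  | ?a *+ ?n => nc_atoms env a
  | _ => match env with
         | _ => let n := nc_find e env in env
         | _ => constr:(e :: env)
         end
  end.
Ltac nc_reify env e :=
  match e with
  | 0 => constr:(NC0)
  | 1 => constr:(NC1)
  | ?a + ?b => let a := nc_reify env a in let b := nc_reify env b in
               constr:(NCadd a b)
  | - ?a => let a := nc_reify env a in constr:(NCopp a)
  | ?a * ?b => let a := nc_reify env a in let b := nc_reify env b in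
               constr:(NCmul a b)
  | ?a ^+ ?n => let a := nc_reify env a in constr:(NCexp a n)
  | ?a *+ ?n => let a := nc_reify env a in constr:(NCmuln a n)
  | _ => let n := nc_find e env in constr:(NCvar n)
  end.
(** Scalings [r *: x] are atoms here, which is why the proofs below first move scalars out of
    products and often name the scaled terms. *)
Ltac nc_ring :=
  match goal with
  | |- ?x = ?y :> ?T =>
    let env := nc_atoms (@nil T) x in
    let env := nc_atoms env y in
    let a := nc_reify env x in
    let b := nc_reify env y in
    exact: (@ncequalP _ env a b (erefl true))
  end.

(** * The unitization *)

Section RealNorm.
Context {R : realType}.

Definition rnorm (V : normedZmodType R[i]) (x : V) : R := complex.Re `|x|.

Variable V : normedZmodType R[i].
Implicit Types x y : V.

Lemma rnormE x : (rnorm x)%:C%C = `|x|.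
Proof. by rewrite /rnorm RRe_real// normr_real. Qed.

Lemma rnorm_ge0 x : 0 <= rnorm x.
Proof. by rewrite -lecR rnormE rmorph0. Qed.

Lemma rnormD x y : rnorm (x + y) <= rnorm x + rnorm y.
Proof. by rewrite -lecR rmorphD /= !rnormE ler_normD. Qed.

Lemma rnormN x : rnorm (- x) = rnorm x.
Proof. by rewrite /rnorm normrN. Qed.

Lemma rnorm0 : rnorm (0 : V) = 0.
Proof. by rewrite /rnorm normr0. Qed.

Lemma rnorm0_eq0 x : rnorm x = 0 -> x = 0.
Proof. by move=> x0; apply/eqP; rewrite -normr_eq0 -rnormE x0. Qed.

End RealNorm.

Section RealNormC.
Context {R : realType}.

Lemma rnormZ (V : normedModType R[i]) (k : R[i]) (x : V) :
  rnorm (k *: x) = rnorm k * rnorm x.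
Proof. by apply: (@complexI R); rewrite rmorphM /= !rnormE normrZ. Qed.

Lemma rnormM (k l : R[i]) : rnorm (k * l) = rnorm k * rnorm l.
Proof. by apply: (@complexI R); rewrite rmorphM /= !rnormE normrM. Qed.

Lemma rnorm_real (r : R) : rnorm r%:C%C = `|r|.
Proof.
apply: (@complexI R); rewrite rnormE.
by rewrite normc_def /= expr0n addr0 sqrtr_sqr.
Qed.

Lemma rnorm_conj (k : R[i]) : rnorm k^* = rnorm k.
Proof. by apply: (@complexI R); rewrite !rnormE norm_conjC. Qed.

Lemma rnormi : rnorm ('i%C : R[i]) = 1.
Proof. by rewrite /rnorm normc_def /= expr0n add0r expr1n sqrtr1. Qed.

End RealNormC.

(* Adjoining a unit to A. The unitization is only used as a real algebra, so it
   carries a real norm: the maximum of the modulus of the scalar part and of the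
   norm of the left multiplication operator on A. With this maximum the norm is
   a complete C*-norm whether or not A already has a unit. *)
Section Unitization.
Context {R : realType} {A : cstarAlgType R}.

Local Notation "a ** b" := (cmul a b) (at level 40, left associativity).

Record unitization := Unitization { uscal : R[i]; uelt : A }.

Lemma unitization_eqP (x y : unitization) :
  uscal x = uscal y -> uelt x = uelt y -> x = y.
Proof. by case: x y => [k a] [l b] /= -> ->. Qed.

Definition prod_of_unitization x := (uscal x, uelt x).
Definition unitization_of_prod (p : R[i] * A) := Unitization p.1 p.2.
Lemma prod_of_unitizationK : cancel prod_of_unitization unitization_of_prod.
Proof. by case. Qed.

HB.instance Definition _ := Choice.copy unitization
  (can_type prod_of_unitizationK).

Implicit Types x y z : unitization.

Let uadd x y := Unitization (uscal x + uscal y) (uelt x + uelt y).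
Let uopp x := Unitization (- uscal x) (- uelt x).
Let uzero := Unitization 0 0.

Fact uaddA : associative uadd.
Proof. by move=> x y z; apply: unitization_eqP; rewrite /= addrA. Qed.
Fact uaddC : commutative uadd.
Proof. by move=> x y; apply: unitization_eqP; rewrite /= addrC. Qed.
Fact uadd0 : left_id uzero uadd.
Proof. by move=> x; apply: unitization_eqP; rewrite /= add0r. Qed.
Fact uaddN : left_inverse uzero uopp uadd.
Proof. by move=> x; apply: unitization_eqP; rewrite /= addNr. Qed.

HB.instance Definition _ := GRing.isZmodule.Build unitization
  uaddA uaddC uadd0 uaddN.

Let umul x y := Unitization (uscal x * uscal y)
  (uscal x *: uelt y + uscal y *: uelt x + uelt x ** uelt y).
Let u1 := Unitization 1 0.

Fact umulA : associative umul.
Proof.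
move=> x y z; apply: unitization_eqP; rewrite /= ?mulrA//.
rewrite !(scalerDr, cmulDr, cmulDl, cmulZl, cmulZr, cmulA) !scalerA.
rewrite (mulrC (uscal z) (uscal x)) (mulrC (uscal z) (uscal y)).
by rewrite !addrA [LHS](ACl (1*2*4*6*3*5*7)).
Qed.
Fact umul1l : left_id u1 umul.
Proof.
move=> x; apply: unitization_eqP; rewrite /= ?mul1r//.
by rewrite scale1r scaler0 cmul0l !addr0.
Qed.
Fact umul1r : right_id u1 umul.
Proof.
move=> x; apply: unitization_eqP; rewrite /= ?mulr1//.
by rewrite scale1r scaler0 cmul0r addr0 add0r.
Qed.
Fact umulDl : left_distributive umul uadd.
Proof.
move=> x y z; apply: unitization_eqP; rewrite /= ?mulrDl//.
rewrite scalerDl scalerDr cmulDl !addrA.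
by rewrite [LHS](ACl (1*3*5*2*4*6)).
Qed.
Fact umulDr : right_distributive umul uadd.
Proof.
move=> x y z; apply: unitization_eqP; rewrite /= ?mulrDr//.
rewrite scalerDl scalerDr cmulDr !addrA.
by rewrite [LHS](ACl (1*3*5*2*4*6)).
Qed.
Fact u1_neq0 : u1 != 0.
Proof. by apply/eqP => /(congr1 uscal)/eqP; rewrite oner_eq0. Qed.

HB.instance Definition _ := GRing.Zmodule_isNzRing.Build unitization
  umulA umul1l umul1r umulDl umulDr u1_neq0.

Let uscale (r : R) x := Unitization (r%:C%C * uscal x) (r%:C%C *: uelt x).

Fact uscaleA r t x : uscale r (uscale t x) = uscale (r * t) x.
Proof.
by apply: unitization_eqP; rewrite /= rmorphM ?mulrA// scalerA.
Qed.
Fact uscale1 : left_id 1 uscale.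
Proof.
by move=> x; apply: unitization_eqP; rewrite /= rmorph1 ?mul1r// scale1r.
Qed.
Fact uscaleDr : right_distributive uscale +%R.
Proof.
by move=> r x y; apply: unitization_eqP; rewrite /= ?mulrDr// scalerDr.
Qed.
Fact uscaleDl x : {morph uscale^~ x : r t / r + t}.
Proof.
by move=> r t; apply: unitization_eqP; rewrite /= rmorphD ?mulrDl// scalerDl.
Qed.
HB.instance Definition _ := GRing.Zmodule_isLmodule.Build R unitization
  uscaleA uscale1 uscaleDr uscaleDl.

Fact uscaleAl r x y : r *: (x * y) = r *: x * y.
Proof.
apply: unitization_eqP; rewrite /= ?mulrA//.
by rewrite !scalerDr cmulZl !scalerA (mulrC (r%:C%C) (uscal y)).
Qed.
HB.instance Definition _ := GRing.Lmodule_isLalgebra.Build R unitization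
  uscaleAl.
Fact uscaleAr r x y : r *: (x * y) = x * (r *: y).
Proof.
apply: unitization_eqP => /=; first by rewrite mulrCA.
by rewrite !scalerDr cmulZr !scalerA (mulrC (r%:C%C) (uscal x)).
Qed.
HB.instance Definition _ := GRing.Lalgebra_isAlgebra.Build R unitization
  uscaleAr.

Definition uact x (c : A) : A := uscal x *: c + uelt x ** c.

Definition ubound x (M : R) := [/\ 0 <= M, rnorm (uscal x) <= M &
  forall c, rnorm (uact x c) <= M * rnorm c].

Definition unorm x : R := inf [set M | ubound x M].

Lemma uactM x y c : uact (x * y) c = uact x (uact y c).
Proof.
rewrite /uact /= !(cmulDl, cmulDr, scalerDr, cmulZl, cmulZr, scalerA, cmulA).
by rewrite !addrA.
Qed.

Lemma uactD x y c : uact (x + y) c = uact x c + uact y c.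
Proof. by rewrite /uact /= scalerDl cmulDl addrACA. Qed.

Lemma uactZ r x c : uact (r *: x) c = r%:C%C *: uact x c.
Proof. by rewrite /uact /= scalerDr cmulZl scalerA. Qed.

Lemma rnorm_cmul (a b : A) : rnorm (a ** b) <= rnorm a * rnorm b.
Proof. by rewrite -lecR rmorphM /= !rnormE cmul_norm. Qed.

Lemma rnorm_cstar_sq (a : A) : rnorm (cstar a ** a) = rnorm a ^+ 2.
Proof. by apply: (@complexI R); rewrite rmorphXn /= !rnormE cstar_norm. Qed.

Lemma ubound_ex x : ubound x (rnorm (uscal x) + rnorm (uelt x)).
Proof.
split=> [||c]; rewrite ?addr_ge0 ?rnorm_ge0 ?lerDl ?rnorm_ge0//.
rewrite (le_trans (rnormD _ _))// mulrDl lerD ?rnormZ//.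
exact: rnorm_cmul.
Qed.

Lemma ubound_has_inf x : has_inf [set M | ubound x M].
Proof.
split; first by exists (rnorm (uscal x) + rnorm (uelt x)); exact: ubound_ex.
by exists 0 => M [].
Qed.

Lemma unorm_le x M : ubound x M -> unorm x <= M.
Proof. by move=> xM; apply: ge_inf => //; exists 0 => M' []. Qed.

Lemma uboundP x : ubound x (unorm x).
Proof.
have lb (s : R) : (forall M, ubound x M -> s <= M) -> s <= unorm x.
  move=> h; apply: lb_le_inf; last by move=> M /h.
  by have [] := ubound_has_inf x.
split; first by apply: lb => M [].
  by apply: lb => M [].
move=> c; have [c0|] := eqVneq (rnorm c) 0.
  by rewrite (rnorm0_eq0 c0) /uact scaler0 cmul0r addr0 rnorm0 mulr0.
rewrite neq_lt ltNge rnorm_ge0 /= => c0.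
rewrite -ler_pdivrMr//; apply: lb => M [_ _ h].
by rewrite ler_pdivrMr.
Qed.

Lemma unorm_ge0 x : 0 <= unorm x. Proof. by have [] := uboundP x. Qed.

Lemma unorm_scal x : rnorm (uscal x) <= unorm x.
Proof. by have [] := uboundP x. Qed.

Lemma unorm_act x c : rnorm (uact x c) <= unorm x * rnorm c.
Proof. by have [] := uboundP x. Qed.

Fact unormD x y : unorm (x + y) <= unorm x + unorm y.
Proof.
apply: unorm_le; split=> [||c]; first by rewrite addr_ge0 ?unorm_ge0.
  by rewrite (le_trans (rnormD _ _))// lerD ?unorm_scal.
rewrite uactD mulrDl (le_trans (rnormD _ _))//.
by rewrite lerD ?unorm_act.
Qed.

Lemma unormM x y : unorm (x * y) <= unorm x * unorm y.
Proof.
apply: unorm_le; split=> [||c]; first by rewrite mulr_ge0 ?unorm_ge0.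
  by rewrite rnormM ler_pM ?unorm_scal// rnorm_ge0.
rewrite uactM (le_trans (unorm_act _ _))// -mulrA.
by rewrite ler_wpM2l ?unorm_ge0// unorm_act.
Qed.

Let unormZ_le r x : unorm (r *: x) <= `|r| * unorm x.
Proof.
apply: unorm_le; split=> [||c]; first by rewrite mulr_ge0 ?unorm_ge0.
  by rewrite rnormM rnorm_real ler_wpM2l// unorm_scal.
by rewrite uactZ rnormZ rnorm_real -mulrA ler_wpM2l// unorm_act.
Qed.

Fact unormZ r x : unorm (r *: x) = `|r| * unorm x.
Proof.
apply/eqP; rewrite eq_le unormZ_le/=.
have [->|r0] := eqVneq r 0; first by rewrite normr0 mul0r unorm_ge0.
rewrite -ler_pdivlMl ?normr_gt0// -normfV.
by have := unormZ_le r^-1 (r *: x); rewrite scalerA mulVf// scale1r.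
Qed.

(** With [a = uelt x], the C*-identity gives |a|^2 as the norm of [a ** cstar a], which is the
    action of [x] on [cstar a] minus its scalar part. This makes the norm definite and lets Cauchy
    filters be projected to [A]. *)
Lemma rnorm_uelt x : rnorm (uelt x) <= 2 * unorm x.
Proof.
set a := uelt x; have [a0|] := eqVneq (rnorm a) 0.
  by rewrite a0 mulr_ge0// unorm_ge0.
rewrite neq_lt ltNge rnorm_ge0 /= => a0.
have as_ : rnorm (cstar a) = rnorm a.
  by apply: (@complexI R); rewrite !rnormE norm_cstar.
rewrite -(ler_pM2r a0).
have -> : rnorm a * rnorm a = rnorm (a ** cstar a).
  by rewrite -expr2 -as_ -rnorm_cstar_sq cstarK.
have -> : a ** cstar a = uact x (cstar a) + - (uscal x *: cstar a).
  by rewrite /uact addrAC subrr add0r.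
rewrite (le_trans (rnormD _ _))// rnormN rnormZ mulr_natl mulr2n mulrDl -as_.
by rewrite lerD ?unorm_act// ler_wpM2r ?rnorm_ge0 ?unorm_scal.
Qed.

Fact unorm0_eq0 x : unorm x = 0 -> x = 0.
Proof.
move=> x0; apply: unitization_eqP; apply: rnorm0_eq0; apply: le_anti.
  by rewrite rnorm_ge0 -[X in _ <= X]x0 unorm_scal.
rewrite rnorm_ge0 andbT (le_trans (rnorm_uelt x))// x0 mulr0//.
Qed.

HB.instance Definition _ := Lmodule_isNormed.Build R unitization
  unormD unormZ unorm0_eq0.

End Unitization.
Arguments unitization {R} A.

Section UnitizationStar.
Context {R : realType} {A : cstarAlgType R}.
Implicit Types (x y z : unitization A) (r : R).

Lemma norm_umul x y : `|x * y| <= `|x| * `|y|.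
Proof. exact: unormM. Qed.

Definition ustar x := Unitization (uscal x)^* (cstar (uelt x)).

Lemma ustarK : involutive ustar.
Proof. by move=> x; apply: unitization_eqP => /=; rewrite ?conjCK ?cstarK. Qed.

Lemma ustarD x y : ustar (x + y) = ustar x + ustar y.
Proof. by apply: unitization_eqP => /=; rewrite ?rmorphD ?cstarD. Qed.

Lemma ustarM x y : ustar (x * y) = ustar y * ustar x.
Proof.
apply: unitization_eqP => /=; first by rewrite rmorphM mulrC.
by rewrite !cstarD !cstarZ cstarM; congr (_ + _); exact: addrC.
Qed.

Lemma ustarZ r x : ustar (r *: x) = r *: ustar x.
Proof.
apply: unitization_eqP => /=.
  by rewrite rmorphM; congr (_ * _); exact: conjc_real.
by rewrite cstarZ; congr (_ *: _); exact: conjc_real.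
Qed.

Lemma ustarN x : ustar (- x) = - ustar x.
Proof. by rewrite -scaleN1r ustarZ scaleN1r. Qed.

Lemma ustarB x y : ustar (x - y) = ustar x - ustar y.
Proof. by rewrite ustarD ustarN. Qed.

Lemma ustar1 : ustar 1 = 1.
Proof. by apply: unitization_eqP => /=; rewrite ?rmorph1 ?cstar0. Qed.

Lemma ustar0 : ustar 0 = 0.
Proof. by apply: unitization_eqP => /=; rewrite ?rmorph0 ?cstar0. Qed.

(** The C*-identity of [A], applied to [uact y d], bounds |y d|^2 by |d| |y^* y d|, which gives one
    inequality. That inequality forces |y| <= |y^*|, and submultiplicativity then gives the
    other. *)
Lemma norm_ustar_sq x : `|ustar x * x| = `|x| ^+ 2.
Proof.
have le_sq y : `|y| ^+ 2 <= `|ustar y * y|.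
  set c := `|_ * y|; have c0 : 0 <= c by exact: normr_ge0.
  rewrite -[c]sqr_sqrtr// ler_pXn2r ?nnegrE ?sqrtr_ge0//.
  apply: unorm_le; split=> [||d]; first exact: sqrtr_ge0.
    rewrite -(@ler_pXn2r _ 2) ?nnegrE ?sqrtr_ge0 ?rnorm_ge0// sqr_sqrtr//.
    rewrite expr2 -{1}rnorm_conj -rnormM.
    by have := unorm_scal (ustar y * y).
  rewrite -(@ler_pXn2r _ 2) ?nnegrE ?mulr_ge0 ?sqrtr_ge0 ?rnorm_ge0//.
  rewrite exprMn sqr_sqrtr// -rnorm_cstar_sq.
  have -> : cmul (cstar (uact y d)) (uact y d)
      = cmul (cstar d) (uact (ustar y * y) d).
    have sE : cstar (uact y d) = (uscal y)^* *: cstar d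
        + cmul (cstar d) (cstar (uelt y)) by rewrite cstarD cstarZ cstarM.
    have aE w : uact (ustar y) w
        = (uscal y)^* *: w + cmul (cstar (uelt y)) w by [].
    rewrite uactM sE aE; move: (uact y d) => w.
    by rewrite cmulDl cmulZl cmulDr cmulZr cmulA.
  rewrite (le_trans (rnorm_cmul _ _))//.
  have -> : rnorm (cstar d) = rnorm d.
    by apply: (@complexI R); rewrite !rnormE norm_cstar.
  by rewrite expr2 mulrA [leRHS]mulrC ler_wpM2l ?rnorm_ge0// unorm_act.
have le_star y : `|y| <= `|ustar y|.
  have [->|] := eqVneq `|y| 0; first by [].
  rewrite normr_eq0 -normr_gt0 => y0; rewrite -(ler_pM2r y0) -expr2.
  by rewrite (le_trans (le_sq y))// norm_umul.
apply/eqP; rewrite eq_le le_sq andbT (le_trans (norm_umul _ _))// expr2.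
by rewrite ler_wpM2r// -{2}[x]ustarK le_star.
Qed.

Lemma norm_ustar x : `|ustar x| = `|x|.
Proof.
have le_star y : `|y| <= `|ustar y|.
  have [->|] := eqVneq `|y| 0; first by [].
  rewrite normr_eq0 -normr_gt0 => y0; rewrite -(ler_pM2r y0) -expr2.
  by rewrite -norm_ustar_sq norm_umul.
by apply/eqP; rewrite eq_le le_star andbT -{2}[x]ustarK le_star.
Qed.

Lemma norm_unit1 : `|1 : unitization A| = 1.
Proof.
have := norm_ustar_sq 1; rewrite ustar1 mulr1 => h.
apply: (@mulfI _ `|1 : unitization A|); first by rewrite normr_eq0 oner_eq0.
by rewrite mulr1 -expr2 -h.
Qed.

(** The unitization is only a real algebra, so complex scalars act through products with this
    central element. *)
Definition uI : unitization A := Unitization 'i%C 0.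

Lemma uI_sq : uI * uI = -1.
Proof.
apply: unitization_eqP => /=; last by rewrite !scaler0 cmul0l !addr0 oppr0.
by rewrite -expr2 sqr_i.
Qed.

Lemma uIC x : uI * x = x * uI.
Proof.
apply: unitization_eqP => /=; first exact: mulrC.
by rewrite cmul0l cmul0r !scaler0 !addr0 add0r.
Qed.

Lemma ustarI : ustar uI = - uI.
Proof.
apply: unitization_eqP => /=; last by rewrite cstar0 oppr0.
by apply/eqP; rewrite eq_complex /= oppr0 !eqxx.
Qed.

Lemma norm_uIM x : `|uI * x| = `|x|.
Proof.
have h : `|uI * x| ^+ 2 = `|x| ^+ 2.
  rewrite -!norm_ustar_sq ustarM ustarI mulrA -(mulrA _ _ uI) mulNr uI_sq.
  by rewrite opprK mulr1.
by apply/eqP; rewrite -(@eqrXn2 _ 2)//; apply/eqP.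
Qed.

Lemma norm_Re_le (z : R[i]) : `|complex.Re z| <= rnorm z.
Proof. by rewrite -lecR rnormE normc_ge_Re. Qed.

Lemma norm_Im_le (z : R[i]) : `|complex.Im z| <= rnorm z.
Proof.
have -> : complex.Im z = complex.Re (- ('i%C * z)).
  by case: z => a b /=; rewrite mul0r mul1r sub0r opprK.
by rewrite (le_trans (norm_Re_le _))// rnormN rnormM rnormi mul1r.
Qed.

Lemma rnorm_le_ReIm (z : R[i]) :
  rnorm z <= `|complex.Re z| + `|complex.Im z|.
Proof.
case: z => a b /=.
have -> : (a +i* b)%C = a%:C%C + 'i%C * b%:C%C.
  by apply/eqP; rewrite eq_complex /=; apply/andP; split; apply/eqP; ring.
by rewrite (le_trans (rnormD _ _))// rnormM rnormi mul1r !rnorm_real.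
Qed.

Lemma lipschitz_cvg (g : unitization A -> R) (F : set_system (unitization A)) :
  (forall x y, `|g x - g y| <= `|x - y|) -> ProperFilter F -> cauchy F ->
  exists l : R, g @ F --> l.
Proof.
move=> gl FF /cauchyP Fc; apply/cvg_ex; apply: cauchy_cvg; apply/cauchyP => e e0.
have [x Fx] := Fc _ e0; exists (g x).
suff : F [set y | ball (g x) e (g y)] by [].
apply: filterS Fx => y; rewrite -!ball_normE /ball_ /=.
exact: le_lt_trans.
Qed.

Lemma uelt_cvg (F : set_system (unitization A)) : ProperFilter F ->
  cauchy F -> exists l : A, uelt @ F --> l.
Proof.
move=> FF /cauchyP Fc; apply/cvg_ex; apply: cauchy_cvg; apply/cauchyP => e e0.
have eE : (complex.Re e)%:C%C = e by rewrite RRe_real// gtr0_real.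
have r0 : 0 < complex.Re e / 2 by rewrite divr_gt0// -ltcR eE.
have [x Fx] := Fc _ r0; exists (uelt x).
suff : F [set y | ball (uelt x) e (uelt y)] by [].
apply: filterS Fx => y; rewrite -!ball_normE /ball_ /= => xy.
rewrite -rnormE -eE ltcR; apply: le_lt_trans (rnorm_uelt (x - y)) _.
by rewrite mulrC -ltr_pdivlMr.
Qed.

Lemma unitization_complete (F : set_system (unitization A)) :
  ProperFilter F -> cauchy F -> cvg F.
Proof.
move=> FF Fc; have [a Fa] := uelt_cvg FF Fc.
have [k Fk] : exists k : R, (fun x => complex.Re (uscal x)) @ F --> k.
  apply: lipschitz_cvg Fc => x y; rewrite (le_trans _ (unorm_scal _))//.
  by rewrite (le_trans _ (norm_Re_le _))//= raddfB.
have [l Fl] : exists l : R, (fun x => complex.Im (uscal x)) @ F --> l.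
  apply: lipschitz_cvg Fc => x y; rewrite (le_trans _ (unorm_scal _))//.
  by rewrite (le_trans _ (norm_Im_le _))//= raddfB.
apply/cvg_ex; exists (Unitization (k +i* l)%C a); apply/fcvg_ballP => e e0.
have e3 : 0 < e / 3 by rewrite divr_gt0.
have e3' : 0 < (e / 3)%:C%C :> R[i] by rewrite ltcR.
have h1 : F [set y | ball k (e / 3) (complex.Re (uscal y))].
  by move: Fk => /cvg_ballP; exact.
have h2 : F [set y | ball l (e / 3) (complex.Im (uscal y))].
  by move: Fl => /cvg_ballP; exact.
have h3 : F [set y | ball a (e / 3)%:C%C (uelt y)].
  by move: Fa => /cvg_ballP; exact.
apply: filterS3 h1 h2 h3 => y.
rewrite -!ball_normE /ball_ /= -!rnormE !ltcR => h1 h2 h3.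
set d := _ - _; have : `|d| <= rnorm (uscal d) + rnorm (uelt d).
  by apply: unorm_le; exact: ubound_ex.
have := rnorm_le_ReIm (uscal d).
rewrite /= !raddfB /=; move: h1 h2 h3.
set c1 := `|_|; set c2 := `|_|; set c3 := rnorm _; set c4 := rnorm _.
by lra.
Qed.

HB.instance Definition _ := Uniform_isComplete.Build (unitization A)
  unitization_complete.

End UnitizationStar.

(** * Limits of dominated sequences *)

Section Limits.
Context {R : realType}.

(** Distances telescope, and the remainder bound survives in the limit. Most uses take [L = 0] and
    for [eta] the negative of a geometric sequence. *)
Lemma cvg_majorant (V : completeNormedModType R) (u : nat -> V)
    (eta : nat -> R) (L : R) :
  (forall n, `|u n.+1 - u n| <= eta n.+1 - eta n) -> (forall n, eta n <= L) ->
  exists l : V, u @ \oo --> l /\ forall n, `|l - u n| <= L - eta n.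
Proof.
move=> hu hL.
have hd n k : `|u (n + k)%N - u n| <= eta (n + k)%N - eta n.
  elim: k => [|k IH]; first by rewrite addn0 !subrr normr0.
  rewrite addnS -(subrK (u (n + k)%N) (u _.+1)) -addrA.
  by rewrite (le_trans (ler_normD _ _))// (le_trans (lerD (hu _) IH))// subrKA.
have eta_nd : nondecreasing_seq eta.
  by apply/nondecreasing_seqP => n; rewrite -subr_ge0 (le_trans _ (hu n)).
have eta_cvg : cvgn eta.
  by apply: nondecreasing_is_cvgn => //; exists L => _ [n _ <-].
have eta_le n : eta n <= limn eta by exact: nondecreasing_cvgn_le.
have ucvg : cvgn u.
  apply: cauchy_cvg; apply/cauchyP => e e0.
  have [N _ hN] : \forall n \near \oo, `|limn eta - eta n| < e.
    by move/cvgrPdist_lt: eta_cvg; exact.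
  exists (u N); exists N => // n /= Nn; rewrite -ball_normE /ball_ /=.
  rewrite distrC -(subnKC Nn); apply: le_lt_trans (hd _ _) _.
  rewrite subnKC//; apply: le_lt_trans (hN N (leqnn N)).
  by rewrite ger0_norm ?subr_ge0// lerB.
have [l ul] : exists l : V, u @ \oo --> l by exists (limn u).
exists l; split => // n.
have cn : (fun k => `|u k - u n|) @ \oo --> `|l - u n|.
  by apply: cvg_norm; apply: cvgB => //; exact: cvg_cst.
apply: (cvgr_to_le cn); near=> k.
have nk : (n <= k)%N by near: k; exists n.
by rewrite -(subnKC nk) (le_trans (hd _ _))// lerB.
Unshelve. all: by end_near. Qed.

Context {A : cstarAlgType R}.
Implicit Types (u v : nat -> unitization A) (x y : unitization A).

Lemma cvg_umul u v x y : u @ \oo --> x -> v @ \oo --> y ->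
  (fun n => u n * v n) @ \oo --> x * y.
Proof.
move=> ux vy; apply/cvgrPdist_le => e e0.
pose M := `|x| + `|y| + 1 + e.
have M0 : 0 < M by rewrite ltr_wpDl ?addr_ge0.
have d0 : 0 < e / M by rewrite divr_gt0.
have d1 : e / M <= 1 by rewrite ler_pdivrMr// mul1r lerDr !addr_ge0.
near=> n.
have h1 : `|x - u n| <= e / M by near: n; exact: cvgr_dist_le.
have h2 : `|y - v n| <= e / M by near: n; exact: cvgr_dist_le.
have -> : x * y - u n * v n = (x - u n) * y + u n * (y - v n).
  by rewrite mulrBl mulrBr addrA subrK.
have hu : `|u n| <= `|x| + 1.
  have -> : u n = x - (x - u n) by rewrite opprB addrC subrK.
  by rewrite (le_trans (ler_normB _ _))// lerD2l (le_trans h1).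
rewrite (le_trans (ler_normD _ _))//.
rewrite (le_trans (lerD (norm_umul _ _) (norm_umul _ _)))//.
have := ler_wpM2r (normr_ge0 y) h1.
have := ler_pM (normr_ge0 _) (normr_ge0 _) hu h2.
have : e / M * M = e by rewrite divfK ?gt_eqF.
have := normr_ge0 x; have := normr_ge0 y; rewrite /M => ? ? ? ? ?; nra.
Unshelve. all: by end_near. Qed.

Lemma cvg_ustar u x : u @ \oo --> x -> (fun n => ustar (u n)) @ \oo --> ustar x.
Proof.
move=> ux; apply/cvgrPdist_le => e e0; near=> n.
rewrite -ustarB norm_ustar; near: n; exact: cvgr_dist_le.
Unshelve. all: by end_near. Qed.

End Limits.

(** * Functional calculus *)

Section Calculus.
Context {R : realType} {A : cstarAlgType R}.
Local Notation B := (unitization A).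
Implicit Types (x y z g h w X : B) (r : R).

Definition usa x := ustar x = x.

Lemma usaD x y : usa x -> usa y -> usa (x + y).
Proof. by rewrite /usa ustarD => -> ->. Qed.

Lemma usaN x : usa x -> usa (- x).
Proof. by rewrite /usa ustarN => ->. Qed.

Lemma usaB x y : usa x -> usa y -> usa (x - y).
Proof. by move=> hx hy; apply: usaD => //; exact: usaN. Qed.

Lemma usaZ r x : usa x -> usa (r *: x).
Proof. by rewrite /usa ustarZ => ->. Qed.

Lemma usa1 : usa 1. Proof. exact: ustar1. Qed.

Lemma usa0 : usa 0. Proof. exact: ustar0. Qed.

Lemma usaM x y : usa x -> usa y -> x * y = y * x -> usa (x * y).
Proof. by rewrite /usa ustarM => -> -> ->. Qed.

Lemma usa_sq x : usa x -> usa (x * x).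
Proof. by move=> hx; exact: usaM. Qed.

Lemma usa_conj x y : usa x -> usa (y * x * ustar y).
Proof. by rewrite /usa !ustarM ustarK mulrA => ->. Qed.

Lemma usa_starM x : usa (ustar x * x).
Proof. by rewrite /usa ustarM ustarK. Qed.

Lemma usa_re x : usa (x + ustar x).
Proof. by rewrite /usa ustarD ustarK addrC. Qed.

Lemma usa_im x : usa (uI * (x - ustar x)).
Proof.
by rewrite /usa ustarM ustarI ustarB ustarK mulrN -uIC -mulrN opprB.
Qed.

Lemma norm_usa_sq x : usa x -> `|x * x| = `|x| ^+ 2.
Proof. by move=> hx; rewrite -norm_ustar_sq hx. Qed.

(** The square of |x y| is the norm of y^* x^* x y. *)
Lemma ustarM0 x y : ustar x * x * y = 0 -> x * y = 0.
Proof.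
move=> h; apply/normr0_eq0/eqP; rewrite -sqrf_eq0 -norm_ustar_sq ustarM.
by rewrite -mulrA (mulrA (ustar x)) h mulr0 normr0.
Qed.

Lemma cvg_seq_unique (u : nat -> B) x y :
  u @ \oo --> x -> u @ \oo --> y -> x = y.
Proof. exact: norm_cvg_unique. Qed.

Lemma cvg_usa (u : nat -> B) x :
  u @ \oo --> x -> (forall n, usa (u n)) -> usa x.
Proof.
move=> ux hu; apply: (@cvg_seq_unique u) => //.
have -> : u = (fun n => ustar (u n)) by apply/funext => n; rewrite hu.
exact: cvg_ustar.
Qed.

Lemma cvg_comm (u : nat -> B) x y :
  u @ \oo --> x -> (forall n, y * u n = u n * y) -> y * x = x * y.
Proof.
move=> ux hu; apply: (@cvg_seq_unique (fun n => y * u n)).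
  by apply: cvg_umul => //; exact: cvg_cst.
have -> : (fun n => y * u n) = (fun n => u n * y) by apply/funext.
by apply: cvg_umul => //; exact: cvg_cst.
Qed.

Lemma cvg_norm_le (u : nat -> B) x r :
  u @ \oo --> x -> (forall n, `|u n| <= r) -> `|x| <= r.
Proof.
move=> ux hu; have cn : (fun n => `|u n|) @ \oo --> `|x| by exact: cvg_norm.
by apply: (cvgr_to_le cn); near=> n; exact: hu.
Unshelve. all: by end_near. Qed.

(** The iterates of [1 + w * y] are the partial sums of the Neumann series; [eta] collects those of
    the scalar geometric series. *)
Lemma neumann w r : `|w| <= r -> r < 1 ->
  exists g, [/\ (1 - w) * g = 1, g * (1 - w) = 1 & `|g| <= (1 - r)^-1].
Proof.
move=> wr r1; have r0 : 0 <= r by exact: le_trans wr.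
have d0 : 0 < 1 - r by rewrite subr_gt0.
pose u n := iter n (fun y => 1 + w * y) 0.
have uS n : u n.+1 = 1 + w * u n by [].
have uC n : w * u n = u n * w.
  elim: n => [|n IH]; first by rewrite mulr0 mul0r.
  by rewrite uS mulrDr mulrDl mulr1 mul1r {1}IH mulrA.
have uB n : `|u n.+1 - u n| <= r ^+ n.
  elim: n => [|n IH]; first by rewrite subr0 uS mulr0 addr0 norm_unit1 expr0.
  have -> : u n.+2 - u n.+1 = w * (u n.+1 - u n).
    by rewrite mulrBr [u n.+2]uS [X in _ - X]uS; nc_ring.
  by rewrite (le_trans (norm_umul _ _))// exprS ler_pM.
pose eta n := (1 - r ^+ n) / (1 - r).
have etaS n : eta n.+1 - eta n = r ^+ n.
  by rewrite /eta exprS; field; rewrite gt_eqF.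
have [g [ug gB]] : exists g : B, u @ \oo --> g /\
    forall n, `|g - u n| <= (1 - r)^-1 - eta n.
  apply: cvg_majorant => n; first by rewrite etaS.
  by rewrite /eta -[leRHS]mul1r ler_pM2r ?invr_gt0// gerBl exprn_ge0.
have uSg : (fun n => u n.+1) @ \oo --> g by rewrite (cvg_shiftS u).
have e1 : g = 1 + w * g.
  apply: (cvg_seq_unique uSg).
  by apply: cvgD; [exact: cvg_cst|apply: cvg_umul => //; exact: cvg_cst].
have e2 : w * g = g * w by exact: cvg_comm ug uC.
exists g; split.
- by rewrite mulrBl mul1r {1}e1 addrK.
- by rewrite mulrBr mulr1 {1}e1 e2 addrK.
- by have := gB 0; rewrite subr0 /eta expr0 subrr mul0r subr0.
Qed.

(* The iteration for [1 - sqrt (1 - X)]. Since its coefficients as a power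
   series in [X] are nonnegative, its scalar version at [X = 1] dominates it
   on the unit ball. *)
Definition sqrt_iter X n : B := iter n (fun y => 2^-1 *: (X + y * y)) 0.
Definition sqrt_maj n : R := iter n (fun t => 2^-1 * (1 + t * t)) 0.

Lemma sqrt_majP n : 0 <= sqrt_maj n /\ sqrt_maj n <= 1.
Proof.
elim: n => [|n [h0 h1]]; first by rewrite lexx ler01.
by rewrite /sqrt_maj iterS -/(sqrt_maj n); split; nra.
Qed.

(** One step raises t by (1 - t)^2 / 2. Staying below 1 - e would gain at least e^2 / 2 each time
    and eventually exceed 1. *)
Lemma sqrt_maj_cvg (e : R) : 0 < e -> exists n, 1 - sqrt_maj n <= e.
Proof.
move=> e0; apply: contrapT => /forallNP h.
have hn n : e < 1 - sqrt_maj n by rewrite ltNge; apply/negP; exact: h.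
have step n : e ^+ 2 / 2 * n%:R <= sqrt_maj n.
  elim: n => [|n IH]; first by rewrite mulr0 (sqrt_majP 0).1.
  rewrite /sqrt_maj iterS -/(sqrt_maj n) -[n.+1%:R]natr1.
  have /ltW et := hn n; have := ler_pM (ltW e0) (ltW e0) et et.
  by move: IH; rewrite expr2; set t := sqrt_maj n => ? ?; lra.
have d0 : 0 < e ^+ 2 / 2 by rewrite divr_gt0// exprn_gt0.
pose N := (Num.truncn (2 / (e ^+ 2))).+1; have h2 := step N.
have h1 : 2 / e ^+ 2 < N%:R by rewrite truncnS_gt.
move: h1; rewrite ltr_pdivrMr ?exprn_gt0// => h1.
have := (sqrt_majP N).2 => h3; lra.
Qed.

(** Consecutive iterates commute, so the difference of their squares factors; the scalar majorant
    factors in the same way. *)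
Lemma sqrt_iter_bound X n : `|X| <= 1 ->
  `|sqrt_iter X n| <= sqrt_maj n /\
  `|sqrt_iter X n.+1 - sqrt_iter X n| <= sqrt_maj n.+1 - sqrt_maj n.
Proof.
move=> X1.
have nZ (x : B) (s : R) : 0 <= s -> `|x| <= s -> `|2^-1 *: x| <= 2^-1 * s.
  by move=> s0 xs; rewrite normrZ gtr0_norm ?invr_gt0// ler_wpM2l ?invr_ge0.
have YS k : sqrt_iter X k.+1 = 2^-1 *: (X + sqrt_iter X k * sqrt_iter X k).
  by [].
have tS k : sqrt_maj k.+1 = 2^-1 * (1 + sqrt_maj k * sqrt_maj k) by [].
have b k : `|sqrt_iter X k| <= sqrt_maj k.
  elim: k => [|k IH]; first by rewrite normr0.
  have [t0 t1] := sqrt_majP k.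
  rewrite YS tS; apply: nZ; first nra.
  rewrite (le_trans (ler_normD _ _))// lerD// (le_trans (norm_umul _ _))//.
  exact: ler_pM.
split=> //; elim: n => [|n IH].
  rewrite YS tS [sqrt_iter X 0]/(0 : B) [sqrt_maj 0]/(0 : R) !mulr0 !addr0 !subr0.
  exact: nZ.
rewrite YS tS {2}YS {2}tS -scalerBr -mulrBr.
set y := sqrt_iter X n.+1 in IH *; set y' := sqrt_iter X n in IH *.
set t := sqrt_maj n.+1 in IH *; set t' := sqrt_maj n in IH *.
have yC : y * y' = y' * y.
  rewrite /y YS -scalerAl -scalerAr mulrDl mulrDr mulrA; congr (_ *: (_ + _)).
  rewrite /y'; elim: (n) => [|k IHk]; first by rewrite mulr0 mul0r.
  rewrite YS -scalerAl -scalerAr mulrDl mulrDr; congr (_ *: (_ + _)).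
  by rewrite mulrA IHk -mulrA IHk mulrA.
have -> : X + y * y - (X + y' * y') = (y - y') * (y + y').
  by rewrite mulrDr !mulrBl yC; nc_ring.
have := (b n.+1); have := b n; rewrite -/y -/y' -/t -/t' => h' h.
have t0 := (sqrt_majP n).1; have t1 := (sqrt_majP n.+1).1.
have tt : 0 <= t - t' by exact: le_trans IH.
have -> : 1 + t * t - (1 + t' * t') = (t - t') * (t + t') by ring.
apply: nZ; first by rewrite mulr_ge0// addr_ge0.
rewrite (le_trans (norm_umul _ _))// ler_pM//.
by rewrite (le_trans (ler_normD _ _))// lerD.
Qed.

(** The limit y satisfies 2 y = 1 - g + y^2, that is (1 - y)^2 = g; convergence is guaranteed for |1
    - g| <= 1. *)
Definition usqrt g : B := 1 - lim (sqrt_iter (1 - g) @ \oo).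

Lemma usqrt_lim g : `|1 - g| <= 1 -> exists y, [/\ usqrt g = 1 - y,
  sqrt_iter (1 - g) @ \oo --> y &
  forall n, `|y - sqrt_iter (1 - g) n| <= 1 - sqrt_maj n].
Proof.
move=> g1.
have [y [hy yB]] : exists y : B, sqrt_iter (1 - g) @ \oo --> y /\
    forall n, `|y - sqrt_iter (1 - g) n| <= 1 - sqrt_maj n.
  apply: cvg_majorant => n; first exact: (sqrt_iter_bound n g1).2.
  exact: (sqrt_majP n).2.
exists y; split=> //; congr (_ - _); exact: (cvg_lim (@norm_hausdorff _ _) hy).
Qed.

Lemma usqrtP g : `|1 - g| <= 1 ->
  usqrt g * usqrt g = g /\ `|1 - usqrt g| <= 1.
Proof.
move=> g1; have [y [-> hy yB]] := usqrt_lim g1.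
have -> : 1 - (1 - y) = y by nc_ring.
split; last first.
  by have := yB 0; rewrite subr0 [sqrt_maj 0]/(0 : R) subr0.
have e1 : y = 2^-1 *: (1 - g + y * y).
  apply: (@cvg_seq_unique (fun n => sqrt_iter (1 - g) n.+1)).
    by rewrite (cvg_shiftS (sqrt_iter (1 - g))).
  apply: cvgZl_tmp; apply: cvgD; first exact: cvg_cst.
  exact: cvg_umul.
have e2 : y + y = 1 - g + y * y.
  by rewrite -mulr2n -scaler_nat {1}e1 scalerA divff ?pnatr_eq0// scale1r.
have -> : (1 - y) * (1 - y) = 1 + y * y - (y + y) by nc_ring.
by rewrite e2; nc_ring.
Qed.

Lemma usqrt_comm g y : `|1 - g| <= 1 -> y * g = g * y ->
  y * usqrt g = usqrt g * y.
Proof.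
move=> g1 yg; have [l [-> hl _]] := usqrt_lim g1.
rewrite mulrBr mulrBl mulr1 mul1r (cvg_comm hl)// => n.
elim: n => [|n IH]; first by rewrite mulr0 mul0r.
rewrite [sqrt_iter _ _]iterS -/(sqrt_iter _ _); set u := sqrt_iter _ _ in IH *.
rewrite -scalerAl -scalerAr; congr (_ *: _).
by rewrite mulrDr mulrDl mulrBr mulrBl mulr1 mul1r yg mulrA IH -!mulrA IH.
Qed.

Lemma usqrt_usa g : `|1 - g| <= 1 -> usa g -> usa (usqrt g).
Proof.
move=> g1 gs; have [l [-> hl _]] := usqrt_lim g1.
apply: usaB; first exact: usa1.
apply: (cvg_usa hl); elim=> [|n IH]; first exact: usa0.
rewrite [sqrt_iter _ _]iterS -/(sqrt_iter _ _).
by apply/usaZ/usaD; [apply: usaB => //; exact: usa1|exact: usa_sq].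
Qed.

(** The remainder after [N] iterations is at most [1 - sqrt_maj N], whatever the element, so the
    square root is a uniform limit of polynomials. *)
Lemma usqrt_cvg (u : nat -> B) g : (forall n, `|1 - u n| <= 1) ->
  u @ \oo --> g -> (fun n => usqrt (u n)) @ \oo --> usqrt g.
Proof.
move=> u1 ug.
have ug1 : (fun n => 1 - u n) @ \oo --> 1 - g.
  by apply: cvgB => //; exact: cvg_cst.
have g1 : `|1 - g| <= 1 by exact: cvg_norm_le ug1 u1.
have hk k : (fun n => sqrt_iter (1 - u n) k) @ \oo --> sqrt_iter (1 - g) k.
  elim: k => [|k IH]; first exact: cvg_cst.
  by apply: cvgZl_tmp; apply: cvgD => //; exact: cvg_umul.
apply/cvgrPdist_le => e e0.
have [N hN] := sqrt_maj_cvg (e := e / 3) ltac:(by rewrite divr_gt0).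
near=> n.
have [y [-> _ yB]] := usqrt_lim g1; have [z [-> _ zB]] := usqrt_lim (u1 n).
have h : `|sqrt_iter (1 - g) N - sqrt_iter (1 - u n) N| <= e / 3.
  by near: n; move/cvgrPdist_le: (hk N); apply; rewrite divr_gt0.
have := le_trans (yB N) hN; have := le_trans (zB N) hN.
move: (sqrt_iter _ N) (sqrt_iter _ N) h => s t h hz hy.
have -> : 1 - y - (1 - z) = (z - s) + - (t - s) + - (y - t) by nc_ring.
rewrite (le_trans (ler_normD _ _))// normrN.
rewrite (le_trans (lerD (ler_normD _ _) (lexx _)))// normrN.
move: h hz hy; set c1 := `|_|; set c2 := `|_|; set c3 := `|_|; lra.
Unshelve. all: by end_near. Qed.

End Calculus.

(** * Absolute values and approximate units *)

Section AbsoluteValue.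
Context {R : realType} {A : cstarAlgType R}.
Local Notation B := (unitization A).
Implicit Types (x y z g h k m q : B) (r : R).

Lemma uscaleM r (s : R) x y : (r *: x) * (s *: y) = (r * s) *: (x * y).
Proof. by rewrite -scalerAl -scalerAr scalerA. Qed.

Lemma uI_starM k m : usa k -> usa m -> k * m = m * k ->
  ustar (k + uI * m) * (k + uI * m) = k * k + m * m.
Proof.
move=> hk hm km; rewrite ustarD ustarM ustarI hk hm.
have -> : (k + m * - uI) * (k + uI * m)
    = k * k + k * uI * m - m * uI * k - m * (uI * uI) * m by nc_ring.
by rewrite uI_sq -uIC -(uIC m) -!mulrA km; nc_ring.
Qed.

(* With [S = sqrt (1 - h^2)] the element [h + i S] is unitary, and [S] is its
   imaginary part. *)
Lemma norm_1Bsq h : usa h -> `|h| <= 1 -> `|1 - h * h| <= 1.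
Proof.
move=> hs h1; set g := 1 - h * h.
have g1 : `|1 - g| <= 1.
  by rewrite opprB addrC subrK (le_trans (norm_umul _ _))// mulr_ile1.
have [SS _] := usqrtP g1; set S := usqrt g in SS.
have hS : h * S = S * h.
  by apply: usqrt_comm g1 _; rewrite /g mulrBr mulrBl mulr1 mul1r mulrA.
have Ss : usa S.
  by apply: usqrt_usa g1 _; apply: usaB; [exact: usa1|exact: usa_sq].
pose u := h + uI * S.
have u1 : `|u| = 1.
  apply/eqP; rewrite -(@eqrXn2 _ 2)// -norm_ustar_sq uI_starM// SS /g.
  by rewrite addrC subrK norm_unit1 expr1n.
have S2 : uI * (2%:R *: S) = u - ustar u.
  rewrite /u ustarD ustarM ustarI hs Ss mulrN -uIC scaler_nat mulr2n.
  by rewrite mulrDr; nc_ring.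
have S1 : `|S| <= 1.
  rewrite -(@ler_pM2l _ 2)// mulr1.
  have -> : 2 * `|S| = `|u - ustar u|.
    by rewrite -S2 norm_uIM normrZ ger0_norm.
  by rewrite (le_trans (ler_normB _ _))// norm_ustar u1.
by rewrite -SS (le_trans (norm_umul _ _))// mulr_ile1.
Qed.

(** For x = k + i m and for x = k - i m the product x^* x is k^2 + m^2, so both lie in [L], and [k]
    is their mean. This stands in for the order argument 0 <= k^2 <= k^2 + m^2; [L] is left general
    because it serves both for closed ideals and for the spaces of the x with x c = 0. *)
Lemma sumsq_mem (L : B -> Prop) k m : (forall x y, L x -> L y -> L (x + y)) ->
  (forall r x, L x -> L (r *: x)) -> (forall x, L (ustar x * x) -> L x) ->
  usa k -> usa m -> k * m = m * k -> L (k * k + m * m) -> L k.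
Proof.
move=> LD LZ Lsq hk hm km Lkm.
have L1 : L (k + uI * m) by apply: Lsq; rewrite uI_starM.
have L2 : L (k + uI * - m).
  by apply: Lsq; rewrite uI_starM ?mulrN ?mulNr ?opprK ?km//; exact: usaN.
have -> : k = 2^-1 *: (k + uI * m + (k + uI * - m)).
  rewrite mulrN addrACA subrr addr0 -[k + k]mulr2n -[k *+ 2]scaler_nat.
  by rewrite scalerA mulVf ?pnatr_eq0// scale1r.
exact/LZ/LD.
Qed.

Definition uabs h := usqrt (h * h).

Lemma uabs_comm h y : usa h -> `|h| <= 1 -> y * h = h * y ->
  y * uabs h = uabs h * y.
Proof.
move=> hs h1 yh; apply: usqrt_comm; first exact: norm_1Bsq.
by rewrite mulrA yh -!mulrA yh.
Qed.

Lemma uabs_sq h : usa h -> `|h| <= 1 -> uabs h * uabs h = h * h.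
Proof. by move=> hs h1; have [] := usqrtP (norm_1Bsq hs h1). Qed.

Lemma uabs_usa h : usa h -> `|h| <= 1 -> usa (uabs h).
Proof.
by move=> hs h1; apply: usqrt_usa; [exact: norm_1Bsq|exact: usa_sq].
Qed.

(** Positivity of the absolute value enters through this root, which commutes with whatever commutes
    with [h]. *)
Lemma uabs_root h : usa h -> `|h| <= 1 -> exists m,
  [/\ usa m, m * m = uabs h & forall y, y * h = h * y -> y * m = m * y].
Proof.
move=> hs h1; have [_ a1] := usqrtP (norm_1Bsq hs h1).
exists (usqrt (uabs h)); split; first by apply: usqrt_usa a1 _; exact: uabs_usa.
  by have [] := usqrtP a1.
by move=> y yh; apply: usqrt_comm a1 _; exact: uabs_comm.
Qed.

Lemma uabsN h : uabs (- h) = uabs h.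
Proof. by rewrite /uabs mulrNN. Qed.

Lemma uabs_cvg (u : nat -> B) h :
  (forall n, usa (u n)) -> (forall n, `|u n| <= 1) ->
  u @ \oo --> h -> (fun n => uabs (u n)) @ \oo --> uabs h.
Proof.
move=> us u1 uh; apply: usqrt_cvg; last exact: cvg_umul.
by move=> n; exact: norm_1Bsq.
Qed.

Lemma abs_ex h : usa h -> exists w m, [/\ usa m, m * m = w, w * w = h * h &
  forall y, y * h = h * y -> y * m = m * y].
Proof.
move=> hs; pose s : R := 1 + `|h|.
have s0 : 0 < s by rewrite ltr_pwDl.
have h1 : `|s^-1 *: h| <= 1.
  rewrite normrZ gtr0_norm ?invr_gt0// mulrC ler_pdivrMr// mul1r lerDr//.
have [m [ms mm mC]] := uabs_root (usaZ s^-1 hs) h1.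
exists (s *: uabs (s^-1 *: h)), (Num.sqrt s *: m); split.
- exact: usaZ.
- by rewrite uscaleM -expr2 sqr_sqrtr ?ltW// mm.
- rewrite uscaleM uabs_sq//; last exact: usaZ.
  rewrite uscaleM !scalerA -[RHS]scale1r; congr (_ *: _).
  by field; rewrite gt_eqF.
- move=> y yh; rewrite -scalerAl -scalerAr mC//.
  by rewrite -scalerAl -scalerAr yh.
Qed.

(* [z] is [(eps + q^2)^-1] for a small [eps]. *)
Lemma approx_unit q (e : R) : usa q -> 0 < e -> exists z, [/\ usa z,
  forall y, y * q = q * y -> y * z = z * y,
  `|1 - q * q * z| <= 1 & `|(1 - q * q * z) * q| <= e].
Proof.
move=> qs e0; pose M := 1 + `|q|.
have M0 : 0 < M by rewrite ltr_pwDl.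
pose eps := e ^+ 2 / 2; have eps0 : 0 < eps by rewrite divr_gt0// exprn_gt0.
pose c := eps + M ^+ 2.
have c0 : 0 < c by rewrite addr_gt0// exprn_gt0.
have q1 : `|M^-1 *: q| <= 1.
  by rewrite normrZ gtr0_norm ?invr_gt0// mulrC ler_pdivrMr// mul1r lerDr.
(* [1 - W] is [c^-1] times eps + q^2, and [norm_1Bsq] bounds [W] by M^2 / c < 1, so the Neumann
   series inverts it. *)
pose W := (c^-1 * M ^+ 2) *: (1 - (M^-1 *: q) * (M^-1 *: q)).
have W1 : `|W| <= c^-1 * M ^+ 2.
  rewrite normrZ gtr0_norm ?mulr_gt0 ?invr_gt0 ?exprn_gt0//.
  rewrite -[leRHS]mulr1; apply: ler_wpM2l.
    by rewrite mulr_ge0 ?invr_ge0 ?sqr_ge0// ltW.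
  by apply: norm_1Bsq => //; exact: usaZ.
have r1 : c^-1 * M ^+ 2 < 1.
  by rewrite mulrC ltr_pdivrMr// mul1r ltrDr.
have [t [t1 t2 tn]] := neumann W1 r1.
have WE : 1 - W = c^-1 *: (eps *: 1 + q * q).
  have -> : W = (c^-1 * M ^+ 2) *: 1 - c^-1 *: (q * q).
    rewrite /W scalerBr uscaleM !scalerA; congr (_ - _ *: _).
    by field; rewrite !gt_eqF.
  have ce : c^-1 * eps = 1 - c^-1 * M ^+ 2 by rewrite /c; field; rewrite gt_eqF.
  by rewrite scalerDr scalerA ce scalerBl scale1r opprB addrA addrAC.
pose z := c^-1 *: t.
have z1 : (eps *: 1 + q * q) * z = 1 by rewrite /z -scalerAr scalerAl -WE.
have z2 : z * (eps *: 1 + q * q) = 1 by rewrite /z -scalerAl scalerAr -WE.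
have gs : usa (eps *: 1 + q * q).
  by apply: usaD; [apply: usaZ; exact: usa1|exact: usa_sq].
have zC y : y * q = q * y -> y * z = z * y.
  move=> yq; have yg : y * (eps *: 1 + q * q) = (eps *: 1 + q * q) * y.
    rewrite mulrDr mulrDl -scalerAr -scalerAl mulr1 mul1r mulrA yq.
    by rewrite -!mulrA yq.
  by rewrite -[y * z]mul1r -{1}z2 -!mulrA (mulrA _ y) -yg -mulrA z1 mulr1.
have vE : 1 - q * q * z = eps *: z.
  by rewrite -z1 mulrDl addrK -scalerAl mul1r.
have zn : `|eps *: z| <= 1.
  have d0 : 0 < eps / c by rewrite divr_gt0.
  have dE : 1 - c^-1 * M ^+ 2 = eps / c by rewrite /c; field; rewrite gt_eqF.
  rewrite /z scalerA normrZ gtr0_norm// mulrC -ler_pdivlMr// div1r.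
  by rewrite -dE.
exists z; split=> //; rewrite ?vE//.
  rewrite /usa -[ustar z]mulr1 -z1 mulrA.
  have -> : ustar z * (eps *: 1 + q * q) = 1 by rewrite -gs -ustarM z1 ustar1.
  by rewrite mul1r.
have qz : q * z = z * q by exact: zC.
have xs : usa (eps *: z * q).
  rewrite -scalerAl; apply: usaZ; apply: usaM => //.
  rewrite /usa -[ustar z]mulr1 -z1 mulrA.
  have -> : ustar z * (eps *: 1 + q * q) = 1 by rewrite -gs -ustarM z1 ustar1.
  by rewrite mul1r.
rewrite -(@ler_pXn2r _ 2) ?nnegrE ?(ltW e0)// -norm_usa_sq//.
(* Writing v for [eps *: z], one has 1 - v = q^2 z, so (v q)^2 = eps v (1 - v) has norm at most 2
   eps; hence [eps] is e^2 / 2. *)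
have -> : eps *: z * q * (eps *: z * q) = eps *: ((eps *: z) * (1 - eps *: z)).
  have -> : 1 - eps *: z = q * q * z by rewrite -vE; nc_ring.
  rewrite (scalerAr eps) (scalerAr eps (q * q)).
  have sq : q * (eps *: z) = eps *: z * q.
    by rewrite -(scalerAr eps) -(scalerAl eps) qz.
  by rewrite -!mulrA sq.
have e2 : eps * 2 = e ^+ 2 by rewrite /eps divfK ?pnatr_eq0.
rewrite normrZ gtr0_norm// -e2; apply: ler_wpM2l; first exact: ltW.
rewrite (le_trans (norm_umul _ _))// -[2]mul1r ler_pM//.
by rewrite (le_trans (ler_normB _ _))// norm_unit1 lerD.
Qed.

End AbsoluteValue.

Section Harmonic.
Context {R : realType}.

Lemma cvg_harm (V : normedModType R) (u : nat -> V) (x : V) :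
  (forall n, `|x - u n| <= n.+1%:R^-1) ->
  u @ \oo --> x.
Proof.
move=> h; apply/cvgrPdist_le => e e0.
have hn : \forall n \near \oo, `|0 - @harmonic R n| <= e.
  by have /cvgrPdist_le/(_ e e0) : @harmonic R @ \oo --> (0 : R)
    by exact: cvg_harmonic.
near=> n; apply: (le_trans (h n)).
have : `|0 - @harmonic R n| <= e by near: n.
by rewrite sub0r normrN ger0_norm// /harmonic invr_ge0.
Unshelve. all: by end_near. Qed.

End Harmonic.

(** * Closed ideals without infinite orthogonal sequences outside *)

Section ClosedIdeal.
Context {R : realType} {A : cstarAlgType R}.
Local Notation B := (unitization A).
Implicit Types (x y z g h k m p q b c : B) (r t : R).

Record uideal (K : B -> Prop) : Prop := UIdeal {
  uideal0 : K 0;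
  uidealD : forall x y, K x -> K y -> K (x + y);
  uidealMl : forall y x, K x -> K (y * x);
  uidealMr : forall x y, K x -> K (x * y);
  uideal_star : forall x, K x -> K (ustar x);
  uideal_closed : forall (u : nat -> B) x,
    u @ \oo --> x -> (forall n, K (u n)) -> K x
}.

Variable K : B -> Prop.
Hypothesis hK : uideal K.

Lemma uidealZ r x : K x -> K (r *: x).
Proof. by move=> Kx; rewrite -[x]mul1r scalerAl; exact: uidealMl. Qed.

Lemma uidealN x : K x -> K (- x).
Proof. by move=> Kx; rewrite -scaleN1r; exact: uidealZ. Qed.

Lemma uidealB x y : K x -> K y -> K (x - y).
Proof. by move=> Kx Ky; apply: uidealD => //; exact: uidealN. Qed.

Lemma uidealZr r x : r != 0 -> K (r *: x) -> K x.
Proof. by move=> r0 /(uidealZ r^-1); rewrite scalerA mulVf// scale1r. Qed.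

Lemma uideal_approx x :
  (forall e : R, 0 < e -> exists2 y, K y & `|x - y| <= e) -> K x.
Proof.
move=> h; have {h} /choice[u hu] n : exists y, K y /\ `|x - y| <= n.+1%:R^-1.
  by have [|y] := h n.+1%:R^-1; [rewrite invr_gt0|exists y].
apply: (@uideal_closed _ hK u) => [|n]; last by have [] := hu n.
by apply: cvg_harm => n; have [] := hu n.
Qed.

Lemma uideal_dist x : ~ K x ->
  exists2 d : R, 0 < d & forall y, K y -> d <= `|x - y|.
Proof.
move=> nK; apply: contrapT => h; apply: nK; apply: uideal_approx => e e0.
apply: contrapT => h'; apply: h; exists e => // y Ky.
by apply/ltW; rewrite ltNge; apply/negP => ?; apply: h'; exists y.
Qed.

(** For q = x^* x in [K] the products x v with v = q^2 z lie in [K], and |x - x v|^2 is the norm of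
    (1 - v) q (1 - v), which [approx_unit] makes small. *)
Lemma uideal_starM x : K (ustar x * x) -> K x.
Proof.
move=> Kx; apply: uideal_approx => e e0.
have [||z [zs zC z1 zq]] := @approx_unit _ _ (ustar x * x) (e ^+ 2).
- exact: usa_starM.
- exact: exprn_gt0.
set q := ustar x * x in zq zs zC z1 Kx.
have qs : usa q by exact: usa_starM.
set v := q * q * z in z1 zq.
have vs : usa (1 - v).
  apply: usaB; first exact: usa1.
  apply: usaM => //; first exact: usa_sq.
  by apply: zC; rewrite mulrA.
exists (x * v); first by apply/(uidealMl hK)/(uidealMr hK)/(uidealMr hK).
rewrite -(@ler_pXn2r _ 2) ?nnegrE ?(ltW e0)// -norm_ustar_sq.
have -> : x - x * v = x * (1 - v) by rewrite mulrBr mulr1.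
rewrite ustarM vs -mulrA (mulrA (ustar x)) -/q mulrA.
by rewrite (le_trans (norm_umul _ _))// -[leRHS]mulr1 ler_pM.
Qed.

Lemma uideal_sumsq k m : usa k -> usa m -> k * m = m * k ->
  K (k * k + m * m) -> K k.
Proof.
apply: sumsq_mem; first exact: uidealD hK.
  by move=> r x; exact: uidealZ.
exact: uideal_starM.
Qed.

Lemma uideal_sq k : usa k -> K (k * k) -> K k.
Proof. by move=> ks; rewrite -{1}ks; exact: uideal_starM. Qed.

(** Right annihilators stand in for supports. Every x in the closed left ideal generated by b is
    dominated by b, and the relation is checked by plain computation. *)
Definition dominated x b := forall c, b * c = 0 -> x * c = 0.

Lemma dominated_trans x y z :
  dominated x y -> dominated y z -> dominated x z.
Proof. by move=> xy yz c /yz/xy. Qed.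

(* By [atom_scalar] the hereditary subalgebra generated by an atom is
   one-dimensional modulo [K]. *)
Definition atom b := [/\ usa b, ~ K b & forall x y, usa x -> usa y ->
  dominated x b -> dominated y b -> x * y = 0 -> K x \/ K y].

(* Along the path from [b^2] to [- b^2] through [h], the sets where the positive
   resp. the negative part lies in [K] are closed and cover the path, and the
   endpoints separate them; at a common point the path lies in [K]. *)
Lemma atom_scalar b h : atom b -> usa h -> dominated h b ->
  exists t, K (h - t *: (b * b)).
Proof.
move=> [bs nKb bat] hs hb.
(* Scaling by the inverse of [D] keeps the whole path [phi] in the unit ball, where the iteration
   behind [uabs] converges. *)
pose D : R := 1 + (`|h| + `|b| ^+ 2).
have D0 : 0 < D by rewrite ltr_pwDl// addr_ge0 ?sqr_ge0.
pose s : R := D^-1; have s0 : 0 < s by rewrite invr_gt0.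
pose h1 := s *: h; pose k := Num.sqrt s *: b; pose q := k * k.
have qE : q = s *: (b * b) by rewrite /q uscaleM -expr2 sqr_sqrtr ?ltW.
have ks : usa k by exact: usaZ.
have qs : usa q by exact: usa_sq.
have h1s : usa h1 by exact: usaZ.
have nKk : ~ K k.
  by move=> /uidealZr; rewrite gt_eqF ?sqrtr_gt0// => /(_ isT).
have hq1 : `|h1| + `|q| <= 1.
  rewrite /h1 qE !normrZ gtr0_norm// norm_usa_sq// -mulrDr mulrC.
  by rewrite ler_pdivrMr// mul1r lerDr.
have h1n : `|h1| <= 1 by apply: le_trans hq1; rewrite lerDl.
have qn : `|q| <= 1 by apply: le_trans hq1; rewrite lerDr.
pose phi t := (1 - `|t|) *: h1 - t *: q.
have phis t : usa (phi t) by apply: usaB; exact: usaZ.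
have phin t : `|t| <= 1 -> `|phi t| <= 1.
  move=> t1; have t1' : 0 <= 1 - `|t| by rewrite subr_ge0.
  rewrite (le_trans (ler_normB _ _))// (normrZ _ h1) (normrZ _ q).
  rewrite (ger0_norm t1'); have := ler_wpM2l t1' h1n.
  by have := ler_wpM2l (normr_ge0 t) qn => ? ?; lra.
have phib t : dominated (phi t) b.
  move=> c bc; rewrite mulrBl -!scalerAl qE -scalerAl -mulrA bc.
  by rewrite (hb c bc) mulr0 !scaler0 subr0.
have absb t : `|t| <= 1 -> dominated (uabs (phi t)) b.
  move=> t1 c bc; apply: ustarM0; rewrite uabs_usa ?phin//.
  by rewrite uabs_sq ?phin// -mulrA (phib t c bc) mulr0.
pose P t := K (uabs (phi t) + phi t); pose N t := K (uabs (phi t) - phi t).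
have PN t : `|t| <= 1 -> P t \/ N t.
  move=> t1; have as_ := uabs_usa (phis t) (phin t t1).
  apply: bat; first exact: usaD.
  - exact: usaB.
  - by move=> c bc; rewrite mulrDl (absb t t1 c bc) (phib t c bc) addr0.
  - by move=> c bc; rewrite mulrBl (absb t t1 c bc) (phib t c bc) subr0.
  have := uabs_sq (phis t) (phin t t1).
  have := @uabs_comm _ _ (phi t) (phi t) (phis t) (phin t t1) erefl.
  set w := uabs _; set f := phi t => fw ww.
  have -> : (w + f) * (w - f) = w * w - f * f + (f * w - w * f) by nc_ring.
  by rewrite ww fw !subrr addr0.
have phi_cvg (u : nat -> R) t : u @ \oo --> t ->
    (fun n => phi (u n)) @ \oo --> phi t.
  move=> ut; apply: cvgB; apply: cvgZr_tmp => //.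
  by apply: cvgB; [exact: cvg_cst|exact: cvg_norm].
have abs_cvg (u : nat -> R) t : (forall n, `|u n| <= 1) -> u @ \oo --> t ->
    (fun n => uabs (phi (u n))) @ \oo --> uabs (phi t).
  by move=> u1 ut; apply: uabs_cvg => [n|n|]; [|exact: phin|exact: phi_cvg].
have P_closed (u : nat -> R) t : (forall n, `|u n| <= 1) -> u @ \oo --> t ->
    (forall n, P (u n)) -> P t.
  move=> u1 ut; apply: (@uideal_closed _ hK) => //.
  by apply: cvgD; [exact: abs_cvg|exact: phi_cvg].
have N_closed (u : nat -> R) t : (forall n, `|u n| <= 1) -> u @ \oo --> t ->
    (forall n, N (u n)) -> N t.
  move=> u1 ut; apply: (@uideal_closed _ hK) => //.
  by apply: cvgB; [exact: abs_cvg|exact: phi_cvg].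
(* With m^2 = |q| and q = k^2, membership would put the sum k^2 + m^2, and hence [k], in [K]. *)
have nKq : ~ K (uabs q + q).
  have [m [ms mq mC]] := uabs_root qs qn.
  rewrite -mq addrC /q => Kq; apply: nKk; apply: (uideal_sumsq ks ms _ Kq).
  by apply: mC; rewrite /q mulrA.
have phiN1 : phi (-1) = q.
  by rewrite /phi normrN normr1 subrr scale0r sub0r scaleN1r opprK.
have phi1 : phi 1 = - q by rewrite /phi normr1 subrr scale0r sub0r scale1r.
have n1 : `|1 : R| <= 1 by rewrite normr1.
have nN1 : `|-1 : R| <= 1 by rewrite normrN.
have NN1 : N (-1) by have [|//] := PN _ nN1; rewrite /P phiN1.
have P1 : P 1 by have [//|] := PN _ n1; rewrite /N phi1 uabsN opprK.
pose S : set R := [set t | `|t| <= 1 /\ N t].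
have supS : has_sup S.
  split; first by exists (-1).
  by exists 1 => t [t1 _]; exact: le_trans (ler_norm _) t1.
pose tau := sup S.
have S_le t : S t -> t <= tau by move=> St; exact: (sup_upper_bound supS).
have tau_ge : -1 <= tau by exact: S_le.
have tau_le : tau <= 1.
  apply: ge_sup; first by case: supS.
  by move=> t [t1 _]; exact: le_trans (ler_norm _) t1.
have Ntau : N tau.
  have /choice[u hu] n : exists t, S t /\ tau - n.+1%:R^-1 < t.
    by have [|t St tt] := sup_adherent (eps := n.+1%:R^-1) _ supS;
      [rewrite invr_gt0|exists t].
  apply: (N_closed u) => [n||n]; [by case: (hu n) => -[]| |by case: (hu n) => -[]].
  apply: cvg_harm => n; have [Su ut] := hu n.
  by rewrite ger0_norm ?subr_ge0 ?S_le// lerBlDr -lerBlDl ltW.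
have Ptau : P tau.
  have [->//|tau1] := eqVneq tau 1.
  have {}tau1 : tau < 1 by rewrite lt_neqAle tau1.
  (* These points lie beyond the supremum, so [N] fails and [P] holds there. Since 1 - tau <= 2, the
     doubled denominator keeps the offset below [n.+1%:R^-1]. *)
  pose u n := tau + (1 - tau) / (n.+1%:R + n.+1%:R).
  have u_gt n : tau < u n.
    by rewrite ltrDl divr_gt0 ?subr_gt0// addr_gt0.
  have d n : (1 - tau) / (n.+1%:R + n.+1%:R) <= n.+1%:R^-1.
    rewrite ler_pdivrMr ?addr_gt0// mulrDr mulVf ?pnatr_eq0//.
    by move: tau_ge; lra.
  have d' n : (1 - tau) / (n.+1%:R + n.+1%:R) <= 1 - tau.
    have nge1 : 1 <= n.+1%:R :> R by rewrite ler1n.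
    by rewrite ler_pdivrMr ?addr_gt0// ler_peMr ?subr_ge0//; lra.
  have u1 n : `|u n| <= 1.
    rewrite ler_norml; have := d' n; have := u_gt n; rewrite /u => h2 h3.
    by apply/andP; split; lra.
  apply: (P_closed u) => // [|n].
    apply: cvg_harm => n; rewrite distrC ger0_norm; last first.
      by rewrite subr_ge0 ltW.
    by rewrite /u addrC addKr d.
  have [//|Nu] := PN (u n) (u1 n); exfalso.
  by have := S_le (u n) (conj (u1 n) Nu); rewrite leNgt u_gt.
have Kphi : K (phi tau).
  have := uidealB Ptau Ntau; rewrite opprB addrC subrKA -mulr2n -scaler_nat.
  by apply: uidealZr; rewrite pnatr_eq0.
(* At an endpoint [phi tau] is [q] up to sign, and [q] in [K] would put its root [k] in [K]. *)
have tau1 : 1 - `|tau| != 0.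
  apply/eqP => h0; move: Kphi; rewrite /phi h0 scale0r sub0r => /uidealN.
  rewrite opprK => /uidealZr; rewrite -normr_eq0.
  have -> : `|tau| = 1 by lra.
  by rewrite oner_eq0 => /(_ isT) /(uideal_sq ks).
exists (tau / (1 - `|tau|)); apply: (@uidealZr s); first by rewrite gt_eqF.
apply: (@uidealZr (1 - `|tau|)) => //.
have -> : (1 - `|tau|) *: (s *: (h - (tau / (1 - `|tau|)) *: (b * b)))
    = phi tau; last by [].
rewrite /phi qE 2!scalerBr -/h1 !scalerA; congr (_ - _ *: _).
by field.
Qed.

End ClosedIdeal.

(** * Minimal projections modulo a closed ideal *)

Section FiniteCodimension.
Context {R : realType} {A : cstarAlgType R}.
Local Notation B := (unitization A).
Implicit Types (x y z g h k p q b c E : B) (r t : R).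

Variable K : B -> Prop.
Hypothesis hK : uideal K.
Hypothesis noorth : forall a : nat -> B, (forall n, usa (a n)) ->
  (forall i j, i != j -> a i * a j = 0) -> exists n, K (a n).

Lemma uscale_comm r x y : x * y = y * x -> (r *: x) * y = y * (r *: x).
Proof. by move=> xy; rewrite -(scalerAl r) -(scalerAr r) xy. Qed.

Lemma usaM0 x y : usa x -> usa y -> x * y = 0 -> y * x = 0.
Proof. by move=> hx hy xy; rewrite -hx -hy -ustarM xy ustar0. Qed.

(** Without atoms every good y splits into two orthogonal elements outside [K], both dominated by y.
    Setting one aside and splitting the other again, the elements set aside form an infinite
    orthogonal sequence outside [K]. *)
Lemma atom_ex a : usa a -> ~ K a -> exists b, atom K b /\ dominated b a.
Proof.
move=> as_ nKa; apply: contrapT => noatom.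
pose good y := [/\ usa y, ~ K y & dominated y a].
pose split_ y (p : B * B) := [/\ good p.2, usa p.1, ~ K p.1,
  dominated p.1 y & dominated p.2 y /\ p.1 * p.2 = 0].
have /choice[f fP] y : exists p : B * B, good y -> split_ y p.
  have [gy|ngy] := pselect (good y); last by exists (0, 0).
  case: (gy) => ys nKy ya; apply: contrapT => h; apply: noatom.
  exists y; split=> //; split=> // u v us vs uy vy uv.
  apply: contrapT => /not_orP[nu nv]; apply: h; exists (u, v) => _.
  by split=> //; split=> //; exact: dominated_trans ya.
pose y n := iter n (fun y => (f y).2) a.
have gy n : good (y n).
  by elim: n => [|n IH]; [split|have [] := fP _ IH].
have ydom m n : (n <= m)%N -> dominated (y m) (y n).
  move=> nm; rewrite -(subnKC nm); elim: (m - n)%N => [|l IH].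
    by rewrite addn0.
  rewrite addnS; apply: dominated_trans IH.
  by have [_ _ _ _ []] := fP _ (gy (n + l)%N).
pose x n := (f (y n)).1.
have xs n : usa (x n) by have [] := fP _ (gy n).
have xorth i j : (i < j)%N -> x j * x i = 0.
  move=> ij; have [_ _ _ dx _] := fP _ (gy j); apply: dx.
  apply: (ydom _ _ ij); have [[ys _ _] _ _ _ [_ xy]] := fP _ (gy i).
  exact: usaM0.
have [i j|n Kn] := noorth (a := x) xs.
  rewrite neq_ltn => /orP[ij|ij]; last exact: xorth.
  by apply: usaM0 => //; exact: xorth.
by have [] := fP _ (gy n).
Qed.

(** Modulo [K], p is a minimal projection and E its complement. That E kills p and fixes the right
    annihilator of a holds exactly, not just modulo [K], because [noorth] speaks of exact
    orthogonality. *)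
Definition pivot a p E := [/\ [/\ usa p, ~ K p & dominated p a],
  K (p * p - p), E * p = 0 /\ K (E - (1 - p)),
  (forall c, a * c = 0 -> E * c = c) &
  (forall x, usa x -> exists t, K (p * x * p - t *: p))].

(* [q] is an idempotent modulo [K], [p] and [E] are the positive and negative
   parts of [2 q - 1] (up to a factor 2); they lift [q] and [1 - q] to elements
   whose product vanishes exactly. *)
Lemma pivot_ex a : usa a -> ~ K a -> exists p E, pivot a p E.
Proof.
move=> as_ nKa; have [b [bat ba]] := atom_ex as_ nKa.
have [bs nKb _] := bat.
have bbs : usa (b * b) by exact: usa_sq.
have bdom x : dominated (x * b) b by move=> c bc; rewrite -mulrA bc mulr0.
(* Modulo [K] the fourth power of [b] is [tau] times its square, so b^2 / tau is an idempotent
   there. *)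
have [tau htau] : exists t, K (b * b * (b * b) - t *: (b * b)).
  by apply: atom_scalar => //; [exact: usa_sq|rewrite mulrA; exact: bdom].
have nKbb : ~ K (b * b) by move=> /(uideal_sq hK bs).
have tau0 : tau != 0.
  apply/eqP => h; move: htau; rewrite h scale0r subr0.
  by move=> /(uideal_sq hK bbs).
pose q := tau^-1 *: (b * b).
have qs : usa q by exact: usaZ.
have nKq : ~ K q by move=> /(uidealZr hK); rewrite invr_eq0 tau0 => /(_ isT).
have Kqq : K (q * q - q).
  have -> : q * q - q = (tau^-1 * tau^-1) *: (b * b * (b * b) - tau *: (b * b)).
    by rewrite /q uscaleM scalerBr scalerA; congr (_ - _ *: _); field.
  exact: uidealZ.
pose h := 1 - q - q.
have hs : usa h by apply: usaB => //; apply: usaB => //; exact: usa1.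
have [w [m [ms mw ww mC]]] := abs_ex hs.
have ws : usa w by rewrite -mw; exact: usa_sq.
pose d := 2^-1 *: (w - 1).
have ds : usa d by apply: usaZ; apply: usaB => //; exact: usa1.
have wE : w = 1 + d + d.
  rewrite -addrA -mulr2n -scaler_nat scalerA divff ?pnatr_eq0// scale1r.
  by rewrite addrC subrK.
have qh : q * h = h * q by rewrite /h; nc_ring.
have qm : q * m = m * q by exact: mC.
have qw : q * w = w * q by rewrite -mw mulrA qm -!mulrA qm.
have mw' : m * w = w * m by rewrite -mw mulrA.
have dm : d * m = m * d.
  by apply: uscale_comm; rewrite mulrBl mulrBr mw' mul1r mulr1.
have qd : q * d = d * q.
  by apply/esym/uscale_comm; rewrite mulrBl mulrBr qw mul1r mulr1.
have d2m : (d + d) * (m * (d + d)) = (m * (d + d)) * (d + d).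
  have -> : (d + d) * (m * (d + d)) = (d * m * d) *+ 4 by nc_ring.
  by rewrite dm; nc_ring.
(* [(2 d)^2 + (2 d m)^2 = 2 d (w^2 - 1)] *)
have sumE : (d + d) * (d + d) + (m * (d + d)) * (m * (d + d))
    = (d + d) *+ 4 * (q * q - q).
  have -> : (m * (d + d)) * (m * (d + d)) = (m * d * m * d) *+ 4 by nc_ring.
  have -> : m * d * m * d = d * (w * d).
    by rewrite -mw -dm -!mulrA.
  have -> : (d + d) *+ 4 * (q * q - q) = (d + d) * (h * h - 1).
    by rewrite /h; nc_ring.
  by rewrite -ww wE; nc_ring.
have d2s : usa (d + d) by exact: usaD.
have md2s : usa (m * (d + d)).
  by apply: usaM => //; rewrite mulrDl mulrDr dm.
have Kd : K d.
  have : K (d + d).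
    by apply: (uideal_sumsq hK d2s md2s d2m); rewrite sumE; apply: (uidealMl hK).
  by rewrite -mulr2n -scaler_nat => /(uidealZr hK); apply; rewrite pnatr_eq0.
(* The same identity, with the space of the x such that x c = 0 in place of [K]. *)
have dc c : q * c = 0 -> d * c = 0.
  move=> qc; have : (d + d) * c = 0.
    apply: (@sumsq_mem _ _ (fun x => x * c = 0) _ _ _ _ _ d2s md2s d2m).
    - by move=> x y xc yc; rewrite mulrDl xc yc addr0.
    - by move=> r x xc; rewrite -scalerAl xc scaler0.
    - by move=> x; exact: ustarM0.
    - by rewrite sumE -mulrA mulrBl -mulrA qc mulr0 subr0 mulr0.
  rewrite -mulr2n mulrnAl -scaler_nat => /eqP; rewrite scaler_eq0 pnatr_eq0 /=.
  by move/eqP.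
have qc c : b * c = 0 -> q * c = 0.
  by move=> bc; rewrite -scalerAl -mulrA bc mulr0 scaler0.
have pc c : b * c = 0 -> (q + d) * c = 0.
  by move=> /qc h0; rewrite mulrDl h0 dc// addr0.
exists (q + d), (1 - q + d); split.
- split; first exact: usaD.
    by move=> Kp; apply: nKq; have := uidealB hK Kp Kd; rewrite addrK.
  exact: dominated_trans ba.
- have -> : (q + d) * (q + d) - (q + d)
      = (q * q - q) + (q * d + d * q + d * d - d) by nc_ring.
  apply: (uidealD hK) => //; apply: (uidealB hK) => //.
  apply: (uidealD hK); last exact: (uidealMl hK).
  by apply: (uidealD hK); [exact: (uidealMl hK)|exact: (uidealMr hK)].
- split; last first.
    have -> : 1 - q + d - (1 - (q + d)) = d + d by nc_ring.
    exact: (uidealD hK).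
  have : ((1 - q + d) * (q + d)) *+ 4 = 0.
    have -> : ((1 - q + d) * (q + d)) *+ 4 = w * w - h * h + (d * q - q * d) *+ 4.
      by rewrite wE /h; nc_ring.
    by rewrite ww qd !subrr mul0rn addr0.
  by rewrite -scaler_nat => /eqP; rewrite scaler_eq0 pnatr_eq0 /= => /eqP.
- move=> c ac; have bc : b * c = 0 by exact: ba.
  by rewrite mulrDl mulrBl mul1r qc// dc ?qc// subr0 addr0.
- move=> x xs; have ps : usa (q + d) by exact: usaD.
  have [|c bc|t ht] := atom_scalar hK bat (h := (q + d) * x * (q + d)).
  + by have := usa_conj (q + d) xs; rewrite ps.
  + by rewrite -(mulrA _ _ c) (pc c bc) mulr0.
  exists (t * tau).
  have -> : (q + d) * x * (q + d) - (t * tau) *: (q + d)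
      = ((q + d) * x * (q + d) - t *: (b * b)) - (t * tau) *: d.
    have -> : b * b = tau *: q by rewrite /q scalerA divff// scale1r.
    by rewrite scalerA scalerDr opprD addrA.
  by apply: (uidealB hK) => //; exact: uidealZ.
Qed.

(** With G_n the product of the complements E_i found so far, G_n kills all earlier pivots; a new
    pivot dominated by G_n^* G_n is therefore orthogonal to them. By [noorth] some G_n^* G_n lies in
    [K]; then so does G_n, which modulo [K] is 1 minus the sum of the pivots. *)
Lemma pivots_ex : exists (N : nat) (p : nat -> B),
  [/\ forall i, (i < N)%N -> usa (p i) /\ ~ K (p i),
      forall i, (i < N)%N -> K (p i * p i - p i),
      forall i x, (i < N)%N -> usa x -> exists t, K (p i * x * p i - t *: p i) &
      K (1 - \sum_(i < N) p i)].
Proof.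
have /choice[f fP] a : exists pE : B * B,
    usa a -> ~ K a -> pivot a pE.1 pE.2.
  have [[as_ nKa]|na] := pselect (usa a /\ ~ K a); last first.
    by exists (0, 0) => as_ nKa; case: na.
  by have [p [E pE]] := pivot_ex as_ nKa; exists (p, E).
pose G n := iter n (fun g => g * (f (ustar g * g)).2) 1.
pose a n := ustar (G n) * G n; pose p n := (f (a n)).1; pose E n := (f (a n)).2.
have GS n : G n.+1 = G n * E n by [].
have as_ n : usa (a n) by exact: usa_starM.
pose good n := forall i, (i < n)%N -> ~ K (a i).
have pivotP n i : good n -> (i < n)%N -> pivot (a i) (p i) (E i).
  by move=> gn ni; apply: fP => //; exact: gn.
have goodS n : good n.+1 -> good n.
  by move=> gn i ni; apply: gn; exact: ltnW.
have Gp n i : good n -> (i < n)%N -> G n * p i = 0.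
  elim: n => // n IH gn; rewrite ltnS leq_eqVlt => /predU1P[->|ni].
    by have [_ _ [Ep _] _ _] := pivotP _ _ gn (ltnSn n); rewrite GS -mulrA Ep mulr0.
  have h := IH (goodS _ gn) ni.
  have [_ _ _ EC _] := pivotP _ _ gn (ltnSn n).
  by rewrite GS -mulrA EC// /a -mulrA h mulr0.
have pp n i j : good n -> (i < j < n)%N -> p j * p i = 0.
  move=> gn /andP[ij jn]; have [[_ _ dp] _ _ _ _] := pivotP _ _ gn jn.
  apply: dp; rewrite /a -mulrA Gp ?mulr0// => l lj.
  by apply: gn; exact: ltn_trans jn.
have ps n i : good n -> (i < n)%N -> usa (p i) /\ ~ K (p i).
  by move=> gn ni; have [[]] := pivotP _ _ gn ni.
have [N KaN gN] : exists2 N, K (a N) & good N.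
  have [n Kn] : exists n, K (a n).
    apply: contrapT => /forallNP h.
    have gall n : good n by move=> i _; exact: h.
    have psa n : usa (p n) by have [] := ps _ _ (gall n.+1) (ltnSn n).
    have [i j|n] := noorth (a := p) psa.
      rewrite neq_ltn => /orP[ij|ij].
        by apply: usaM0 => //; apply: (pp j.+1) => //; rewrite ij /=.
      by apply: (pp i.+1) => //; rewrite ij /=.
    by have [_] := ps _ _ (gall n.+1) (ltnSn n).
  (* The least such index is needed, so that all earlier [a i] are outside [K] and do have
     pivots. *)
  have exK : exists n, `[< K (a n) >] by exists n; exact/asboolP.
  case: (ex_minnP exK) => N /asboolP KN Nmin.
  exists N => // i iN Ki.
  by have := Nmin i (asboolT Ki); rewrite leqNgt iN.
have KG : K (G N) by apply: (uideal_starM hK).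
have KGn n : (n <= N)%N -> K (G n - (1 - \sum_(i < n) p i)).
  elim: n => [|n IH nN]; first by rewrite big_ord0 subr0 subrr => _; exact: uideal0.
  have [[psn _ _] _ [_ KE] _ _] := pivotP _ _ gN nN.
  have e0 : (\sum_(i < n) p i) * p n = 0.
    rewrite mulr_suml big1// => i _.
    apply: usaM0 => //; last by apply: (pp N) => //; rewrite ltn_ord.
    by have [] := ps N i gN (ltn_trans (ltn_ord i) nN).
  rewrite GS big_ord_recr /=; set e := \sum_(i < n) _ in e0 IH *.
  have -> : G n * E n - (1 - (e + p n))
      = (G n - (1 - e)) * E n + (1 - e) * (E n - (1 - p n)) + e * p n.
    by nc_ring.
  rewrite e0 addr0; apply: (uidealD hK).
    by apply: (uidealMr hK); apply: IH; exact: ltnW.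
  exact: (uidealMl hK).
exists N, p; split.
- by move=> i; exact: ps.
- by move=> i iN; have [] := pivotP _ _ gN iN.
- by move=> i x iN xs; have [_ _ _ _] := pivotP _ _ gN iN; apply.
- by have := uidealB hK KG (KGn N (leqnn N)); rewrite opprB addrC subrK.
Qed.

End FiniteCodimension.

(** * From a bound on the ideal to a bound everywhere *)

Section BoundedExtension.
Context {R : realType} {A : cstarAlgType R}.
Local Notation B := (unitization A).
Implicit Types (x y z p v : B) (r t : R).

Variable K : B -> Prop.
Hypothesis hK : uideal K.

(** For t nonzero, p is congruent to t^-1 p x p modulo [K], so the distance d of p to [K] satisfies
    d |t| <= |p x p|. *)
Lemma corner_coef p : ~ K p ->
  (forall x, usa x -> exists t, K (p * x * p - t *: p)) ->
  exists2 C : R, 0 <= C & forall x, usa x ->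
    exists2 t, K (p * x * p - t *: p) & `|t| <= C * `|x|.
Proof.
move=> nKp hp; have [d d0 hd] := uideal_dist hK nKp.
exists (`|p| * `|p| / d) => [|x xs].
  by rewrite mulr_ge0 ?mulr_ge0// invr_ge0 ltW.
have [t Kt] := hp x xs; exists t => //.
have [->|t0] := eqVneq t 0.
  by rewrite normr0 !mulr_ge0// invr_ge0 ltW.
have := hd _ (uidealZ hK (- t^-1) Kt).
have -> : p - - t^-1 *: (p * x * p - t *: p) = t^-1 *: (p * x * p).
  rewrite scaleNr opprK scalerBr (scalerA _ t) mulVf// scale1r.
  by rewrite addrC subrK.
rewrite normrZ normfV mulrC ler_pdivlMr ?normr_gt0// mulrAC => h.
rewrite ler_pdivlMr// mulrC (le_trans h)//.
rewrite (le_trans (norm_umul _ _))// -mulrA mulrA mulrAC ler_wpM2r//.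
exact: norm_umul.
Qed.

Lemma corner_coefC p : ~ K p ->
  (forall x, usa x -> exists t, K (p * x * p - t *: p)) ->
  exists2 C : R, 0 <= C & forall z, exists s t : R,
    [/\ K (p * z * p - (s *: p - t *: (uI * p))), `|s| <= C * `|z| &
        `|t| <= C * `|z|].
Proof.
move=> nKp hp; have [C C0 hC] := corner_coef nKp hp; exists C => // z.
have [s Ks sn] := hC _ (usa_re z); have [t Kt tn] := hC _ (usa_im z).
exists (2^-1 * s), (2^-1 * t).
have half r (u : B) : `|r| <= C * `|u| -> `|u| <= 2 * `|z| ->
    `|2^-1 * r| <= C * `|z|.
  move=> h1 h2; rewrite normrM gtr0_norm ?invr_gt0//.
  have := ler_wpM2l C0 h2 => h3; lra.
have n2 (u : B) : `|u| = `|z| -> `|z| + `|u| <= 2 * `|z|.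
  by move=> ->; rewrite mulr_natl mulr2n.
split.
- have -> : p * z * p - ((2^-1 * s) *: p - (2^-1 * t) *: (uI * p)) =
    2^-1 *: ((p * (z + ustar z) * p - s *: p)
      - uI * (p * (uI * (z - ustar z)) * p - t *: p)).
    rewrite mulrBr -(scalerAr t) -!(scalerA 2^-1) -!scalerBr.
    have -> : uI * (p * (uI * (z - ustar z)) * p)
        = - (p * (z - ustar z) * p).
      by rewrite !mulrA uIC -(mulrA p uI) uI_sq mulrN1 !mulNr.
    have -> : p * z * p = 2^-1 *: (p * z * p + p * z * p).
      rewrite -[p * z * p + p * z * p]mulr2n -[p * z * p *+ 2]scaler_nat.
      by rewrite scalerA mulVf ?pnatr_eq0// scale1r.
    rewrite -scalerBr; congr (_ *: _); set u1 := s *: p.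
    by set u2 := t *: (uI * p); nc_ring.
  by apply: (uidealZ hK); apply: (uidealB hK) => //; exact: (uidealMl hK).
- apply: (half _ _ sn).
  by rewrite (le_trans (ler_normD _ _))// n2// norm_ustar.
- apply: (half _ _ tn); rewrite norm_uIM.
  by rewrite (le_trans (ler_normB _ _))// n2// norm_ustar.
Qed.

Variables (X : normedModType R) (f : B -> X).
Hypothesis fl : linear f.
Hypothesis fK : exists C, forall x, K x -> `|f x| <= C * `|x|.

Let fD x y : f (x + y) = f x + f y.
Proof. by have := fl 1 x y; rewrite !scale1r. Qed.
Let f0 : f 0 = 0.
Proof. by apply: (addIr (f 0)); rewrite -fD !add0r. Qed.
Let fZ r x : f (r *: x) = r *: f x.
Proof. by have := fl r x 0; rewrite f0 !addr0. Qed.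

(** Modulo [K], g x has a representative of norm O(|x|) on which [f] is also O(|x|). No linear
    choice of the representative is asked for. *)
Definition controlled (g : B -> B) := exists2 C : R, 0 <= C & forall x,
  exists y, [/\ K (g x - y), `|y| <= C * `|x| & `|f y| <= C * `|x|].

Lemma controlled0 : controlled (fun=> 0).
Proof.
exists 0 => // x; exists 0; rewrite f0 subrr !normr0 mul0r.
by split=> //; exact: uideal0.
Qed.

Lemma controlledD g h : controlled g -> controlled h ->
  controlled (fun x => g x + h x).
Proof.
move=> [C C0 hC] [D D0 hD]; exists (C + D) => [|x]; first exact: addr_ge0.
have [y [Ky y1 y2]] := hC x; have [z [Kz z1 z2]] := hD x.
exists (y + z); rewrite fD mulrDl opprD addrACA; split.
- exact: (uidealD hK).
- by rewrite (le_trans (ler_normD _ _))// lerD.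
- by rewrite (le_trans (ler_normD _ _))// lerD.
Qed.

Lemma controlled_sum (I : Type) (s : seq I) (g : I -> B -> B) :
  (forall i, controlled (g i)) -> controlled (fun x => \sum_(i <- s) g i x).
Proof.
move=> hg; elim: s => [|i s IH].
  by have := controlled0; congr controlled; apply/funext => x; rewrite big_nil.
have := controlledD (hg i) IH; congr controlled.
by apply/funext => x; rewrite big_cons.
Qed.

(** Unless the corner p B q lies in [K], it contains some v = p y q outside [K], and v^* v is a
    nonzero multiple th of q modulo [K]. So th p x q is congruent to (p x q v^* ) v, whose first
    factor lies in p B p and is a complex multiple of p. Hence v alone spans the corner modulo
    [K]. *)
Lemma controlled_corner p q : usa p -> usa q -> ~ K p -> ~ K q ->
  K (p * p - p) -> K (q * q - q) ->
  (forall x, usa x -> exists t, K (p * x * p - t *: p)) ->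
  (forall x, usa x -> exists t, K (q * x * q - t *: q)) ->
  controlled (fun x => p * x * q).
Proof.
move=> ps qs nKp nKq Kpp Kqq hp hq.
have [all0|/existsNP[y nKv]] := pselect (forall y, K (p * y * q)).
  have [C C0 hC] := controlled0; exists C => // x; have [y [_ y1 y2]] := hC x.
  by exists 0; rewrite f0 !normr0 subr0 mulr_ge0//; split.
set v := p * y * q in nKv.
have [C C0 hC] := corner_coefC nKp hp.
have vsE : ustar v = q * ustar y * p by rewrite !ustarM ps qs mulrA.
have [th Kth] : exists th, K (ustar v * v - th *: q).
  have [|t Kt] := hq (ustar y * (p * p) * y).
    by have := usa_conj (ustar y) (usa_sq ps); rewrite ustarK.
  exists t; congr (K (_ - _)) : Kt.
  by rewrite vsE /v; nc_ring.
have th0 : th != 0.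
  apply/eqP => h; move: Kth; rewrite h scale0r subr0.
  by move=> /(uideal_starM hK).
pose D := C * (`|q| * `|q| * `|y|) * `|th^-1|.
have D0 : 0 <= D by rewrite !mulr_ge0.
pose M := `|v| + `|uI * v| + `|f v| + `|f (uI * v)|.
exists (D * M) => [|x]; first by rewrite mulr_ge0// !addr_ge0.
pose z := x * q * q * ustar y.
have [s [t [Kz sn tn]]] := hC z.
have zn : `|z| <= `|x| * (`|q| * `|q| * `|y|).
  rewrite /z -!mulrA (le_trans (norm_umul _ _))// ler_wpM2l//.
  rewrite (le_trans (norm_umul _ _))// ler_wpM2l//.
  by rewrite (le_trans (norm_umul _ _))// norm_ustar.
have bnd (r : R) : `|r| <= C * `|z| -> `|th^-1 * r| <= D * `|x|.
  move=> h; rewrite normrM mulrC /D.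
  have -> : C * (`|q| * `|q| * `|y|) * `|th^-1| * `|x|
    = C * (`|x| * (`|q| * `|q| * `|y|)) * `|th^-1| by ring.
  apply: ler_wpM2r => //; apply: (le_trans h); exact: ler_wpM2l.
exists ((th^-1 * s) *: v - (th^-1 * t) *: (uI * v)); split.
- apply: (@uidealZr _ _ _ hK th) => //.
  have -> : th *: (p * x * q - ((th^-1 * s) *: v - (th^-1 * t) *: (uI * v)))
      = (p * z * p - (s *: p - t *: (uI * p))) * v
        + (s *: ((p * p - p) * y * q) - t *: (uI * ((p * p - p) * y * q)))
        - p * x * q * (ustar v * v - th *: q)
        - th *: (p * x * (q * q - q)).
    have e1 : (p * p - p) * y * q = p * v - v by rewrite /v; nc_ring.
    have e2 : uI * (p * v - v) = uI * p * v - uI * v by nc_ring.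
    have e3 : p * x * (q * q - q) = p * x * q * q - p * x * q by nc_ring.
    have e4 : p * z * p * v = p * x * q * (ustar v * v).
      by rewrite vsE /z /v; nc_ring.
    rewrite e1 e2 e3 mulrBl mulrBl -(scalerAl s) -(scalerAl t) e4.
    rewrite mulrBr -(scalerAr th) 5!scalerBr !(scalerA th) !(mulrA th).
    rewrite mulfV// !mul1r.
    set u1 := th *: _; set u2 := s *: v; set u3 := t *: _; set u4 := s *: _.
    by set u5 := t *: _; set u6 := th *: _; nc_ring.
  apply: (uidealB hK); last first.
    by apply: (uidealZ hK); exact: (uidealMl hK).
  apply: (uidealB hK); last exact: (uidealMl hK).
  apply: (uidealD hK); first exact: (uidealMr hK).
  apply: (uidealB hK); apply: (uidealZ hK).
    by apply/(uidealMr hK)/(uidealMr hK).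
  by apply/(uidealMl hK)/(uidealMr hK)/(uidealMr hK).
- rewrite (le_trans (ler_normB _ _))// (normrZ _ v) (normrZ _ (uI * v)).
  have h1 := ler_pM (normr_ge0 _) (normr_ge0 _) (bnd s sn) (lexx `|v|).
  have h2 := ler_pM (normr_ge0 _) (normr_ge0 _) (bnd t tn) (lexx `|uI * v|).
  have Dx : 0 <= D * `|x| by rewrite mulr_ge0.
  have h3 := mulr_ge0 Dx (normr_ge0 (f v)).
  have h4 := mulr_ge0 Dx (normr_ge0 (f (uI * v))).
  by rewrite /M; lra.
- have -> : f ((th^-1 * s) *: v - (th^-1 * t) *: (uI * v))
      = (th^-1 * s) *: f v - (th^-1 * t) *: f (uI * v).
    by rewrite fD fZ -scaleNr fZ scaleNr.
  rewrite (le_trans (ler_normB _ _))// (normrZ _ (f v)).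
  rewrite (normrZ _ (f (uI * v))).
  have h1 := ler_pM (normr_ge0 _) (normr_ge0 _) (bnd s sn) (lexx `|f v|).
  have h2 := ler_pM (normr_ge0 _) (normr_ge0 _) (bnd t tn) (lexx `|f (uI * v)|).
  have Dx : 0 <= D * `|x| by rewrite mulr_ge0.
  have h3 := mulr_ge0 Dx (normr_ge0 v).
  have h4 := mulr_ge0 Dx (normr_ge0 (uI * v)).
  by rewrite /M; lra.
Qed.

(** With e the sum of the pivots, congruent to 1, x is congruent to e x e, a finite sum of
    controlled corners. For the resulting representative y, the hypothesis [fK] handles x - y. *)
Lemma finite_codim_bounded :
  (forall a : nat -> B, (forall n, usa (a n)) ->
    (forall i j, i != j -> a i * a j = 0) -> exists n, K (a n)) ->
  exists C, forall x, `|f x| <= C * `|x|.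
Proof.
move=> noorth; have [N [p [p1 p2 p3 p4]]] := pivots_ex hK noorth.
have [C C0 hC] : controlled (fun x => \sum_(i < N) \sum_(j < N) p i * x * p j).
  apply: controlled_sum => i; apply: controlled_sum => j.
  have [pis nKi] := p1 i (ltn_ord i); have [pjs nKj] := p1 j (ltn_ord j).
  by apply: controlled_corner => //; [exact: p2|exact: p2| |] => x xs;
    exact: p3.
have [D hD] := fK.
exists (C + `|D| * (1 + C)) => x; have [y [Ky y1 y2]] := hC x.
have Kxy : K (x - y).
  rewrite -(subrKA (\sum_(i < N) \sum_(j < N) p i * x * p j)).
  apply: (uidealD hK) => //.
  have -> : \sum_(i < N) \sum_(j < N) p i * x * p j
      = (\sum_(i < N) p i) * x * (\sum_(i < N) p i).
    rewrite -mulrA mulr_suml; apply: eq_bigr => i _.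
    by rewrite mulrA mulr_sumr.
  set e := \sum_(i < N) p i in p4 *.
  have -> : x - e * x * e = (1 - e) * x + e * x * (1 - e) by nc_ring.
  by apply: (uidealD hK); [exact: (uidealMr hK)|exact: (uidealMl hK)].
have -> : f x = f (x - y) + f y by rewrite -fD subrK.
rewrite (le_trans (ler_normD _ _))//.
have h1 := hD _ Kxy; have h2 : D * `|x - y| <= `|D| * `|x - y|.
  by rewrite ler_wpM2r// ler_norm.
have h3 := ler_wpM2l (normr_ge0 D) (ler_normB x y).
have h4 := ler_wpM2l (normr_ge0 D) y1.
by lra.
Qed.

End BoundedExtension.

(** * Factorization of null sequences *)

Section Factorization.
Context {R : realType} {A : cstarAlgType R}.
Local Notation B := (unitization A).
Implicit Types (x z v b E g : B).

Variable K : B -> Prop.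
Hypothesis hK : uideal K.

Lemma norm_mul_ustar x : `|x * ustar x| = `|x| ^+ 2.
Proof. by rewrite -{1}[x]ustarK norm_ustar_sq norm_ustar. Qed.

(** [1 - E] is an approximate unit for finitely many elements of [K]. To treat one more w, E becomes
    E V E, with V a contraction nearly killing E w; since E and V are contractions, the earlier
    bounds persist. *)
Lemma common_unit (w : nat -> B) (e : R) n : 0 < e ->
  (forall i, (i < n)%N -> K (w i)) ->
  exists E, [/\ usa E, K (1 - E), `|E| <= 1 &
    forall i, (i < n)%N -> `|E * w i| <= e].
Proof.
move=> e0; elim: n => [_|n IH Kw].
  by exists 1; rewrite subrr norm_unit1; split=> //; [exact: usa1|exact: uideal0].
have [i ni|E [Es KE E1 Ew]] := IH; first by apply: Kw; exact: ltnW.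
pose u := E * w n; pose q := u * ustar u.
have qs : usa q by have := usa_starM (ustar u); rewrite ustarK.
have [|z [zs zC z1 zq]] := @approx_unit _ _ q (e ^+ 2) qs; first exact: exprn_gt0.
pose V := 1 - q * q * z; rewrite -/V in z1 zq.
have Vs : usa V.
  apply: usaB; first exact: usa1.
  by apply: usaM => //; [exact: usa_sq|apply: zC; rewrite mulrA].
have Vu : `|V * u| <= e.
  rewrite -(@ler_pXn2r _ 2) ?nnegrE ?(ltW e0)// -norm_mul_ustar ustarM Vs.
  rewrite mulrA -(mulrA V) (le_trans (norm_umul _ _))// -[leRHS]mulr1.
  exact: ler_pM.
have n1 y (s : R) : `|y| <= s -> `|E * y| <= s.
  by move=> ys; rewrite (le_trans (norm_umul _ _))// -[leRHS]mul1r ler_pM.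
have n2 y (s : R) : `|y| <= s -> `|V * y| <= s.
  by move=> ys; rewrite (le_trans (norm_umul _ _))// -[leRHS]mul1r ler_pM.
exists (E * V * E); split.
- by have := usa_conj E Vs; rewrite Es.
- have -> : 1 - E * V * E = (1 - E) + E * (1 - E) + E * (q * q * z) * E.
    by rewrite /V; nc_ring.
  have Kq : K q by apply/(uidealMr hK)/(uidealMl hK)/Kw.
  apply: (uidealD hK); last first.
    by apply/(uidealMr hK)/(uidealMl hK)/(uidealMr hK)/(uidealMr hK).
  by apply: (uidealD hK) => //; exact: (uidealMl hK).
- by rewrite -mulrA; apply/n1/n2.
- move=> i; rewrite ltnS leq_eqVlt -!mulrA => /predU1P[->|ni]; first exact: n1.
  by apply/n1/n2; exact: Ew.
Qed.

Lemma usa_inv b g : usa b -> b * g = 1 -> g * b = 1 -> usa g.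
Proof.
move=> bs bg gb; rewrite /usa -[ustar g]mulr1 -bg mulrA.
have -> : ustar g * b = 1 by rewrite -{1}bs -ustarM bg ustar1.
by rewrite mul1r.
Qed.

Let t (k : nat) : R := 2^-1 ^+ k.

Let tS k : t k.+1 = t k / 2. Proof. by rewrite /t exprSr. Qed.
Let t_gt0 k : 0 < t k. Proof. by rewrite exprn_gt0// invr_gt0. Qed.
Let t_le k n : (k <= n)%N -> t n <= t k.
Proof. by move=> kn; apply: ler_wiXn2l => //; lra. Qed.

Let t_le1 k : t k <= 1.
Proof. by rewrite exprn_ile1//; lra. Qed.

(* Cohen's factorization: [h] is the limit of the invertible elements
   [b_k = 2^-k + \sum_(j <= k) 2^-j e_j], where [e_k] is an approximate unit for
   [b_(k-1)^-1 y_n], so that [b_k^-1 y_n b_k^-1] converges as well. *)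
Lemma factorization (y : nat -> B) :
  (forall n, [/\ usa (y n), K (y n) & `|y n| <= t n ^+ 4]) ->
  exists h (c : nat -> B), [/\ usa h, K h,
    forall n, [/\ usa (c n), K (c n) & `|c n| <= 5] &
    forall n, y n = h * c n * h].
Proof.
move=> hy; have ys n : usa (y n) by have [] := hy n.
have Ky n : K (y n) by have [] := hy n.
have yn n : `|y n| <= t n ^+ 4 by have [] := hy n.
pose good k b := [/\ usa b, `|1 - b| <= 1 - t k & K (b - t k *: 1)].
have inv_ex k b : good k b -> exists g,
    [/\ b * g = 1, g * b = 1 & `|g| <= (t k)^-1].
  move=> [_ b1 _]; have [|g] := neumann b1; first by rewrite gtrBl.
  have -> : 1 - (1 - b) = b by nc_ring.
  have -> : 1 - (1 - t k) = t k by ring.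
  by exists g.
(* The bound is stated for every two-sided inverse of [b] because the inverses [g k] are chosen only
   later. Only [n <= k] is asked: a unit serves finitely many elements, and for larger n the decay
   of [y n] suffices. *)
pose next k b b' := exists E, [/\ b' = b - t k.+1 *: E, usa E, `|E| <= 1,
  K (1 - E) & forall g, b * g = 1 -> g * b = 1 ->
    forall n, (n <= k)%N -> `|E * (g * y n)| <= t k ^+ 4].
have /choice[f fP] (kb : nat * B) : exists b', good kb.1 kb.2 ->
    next kb.1 kb.2 b'.
  case: kb => k b /=; have [gb|ngb] := pselect (good k b); last by exists 0.
  have [g [bg gbE _]] := inv_ex _ _ gb.
  have [||E [Es KE E1 Ew]] := @common_unit (fun n => g * y n) (t k ^+ 4) k.+1.
  - exact: exprn_gt0.
  - by move=> i _; exact: (uidealMl hK).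
  exists (b - t k.+1 *: E) => _; exists E; split=> // g' bg' gb' n nk.
  have -> : g' = g by rewrite -[g']mul1r -gbE -mulrA bg' mulr1.
  by apply: Ew; rewrite ltnS.
pose b := fix b k := if k is k'.+1 then f (k', b k') else 1.
have bS k : b k.+1 = f (k, b k) by [].
have gb k : good k (b k).
  elim: k => [|k IH].
    rewrite /good /= /t expr0 subrr normr0 subrr scale1r subrr lexx.
    by split=> //; [exact: usa1|exact: uideal0].
  have [bs b1 Kb] := IH; have [E [bE Es E1 KE _]] := fP (k, b k) IH.
  rewrite bS bE /=; split.
  - by apply: usaB => //; exact: usaZ.
  - have -> : 1 - (b k - t k.+1 *: E) = (1 - b k) + t k.+1 *: E by nc_ring.
    rewrite (le_trans (ler_normD _ _))// normrZ (gtr0_norm (t_gt0 _)).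
    have := ler_wpM2l (ltW (t_gt0 k.+1)) E1.
    by move: b1; rewrite tS => h1 h2; lra.
  - have -> : b k - t k.+1 *: E - t k.+1 *: 1
        = (b k - t k *: 1) + t k.+1 *: (1 - E).
      have -> : t k = t k.+1 + t k.+1 by rewrite tS; lra.
      by rewrite scalerDl scalerBr; set u1 := _ *: E; set u2 := _ *: 1; nc_ring.
    by apply: (uidealD hK) => //; exact: uidealZ.
have /choice[g gP] k : exists g, [/\ b k * g = 1, g * b k = 1 & `|g| <= (t k)^-1].
  exact: inv_ex.
have gs k : usa (g k).
  by have [bg gb' _] := gP k; have [bs _ _] := gb k; exact: usa_inv bg gb'.
(* This difference is g_(k+1) (b_k - b_(k+1)) g_k y_n. Of the four powers of [t k] assumed, one pays
   for [g k], another will pay for the factor [g k.+1] on the right, and the remaining square is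
   summable. *)
have dg k n : `|(g k.+1 - g k) * y n| <= t k ^+ 3.
  have [E [bE Es E1 KE hE]] := fP (k, b k) (gb k); rewrite /= -bS in bE hE.
  have [bg gb' gn] := gP k; have [bg1 gb1 gn1] := gP k.+1.
  have -> : (g k.+1 - g k) * y n = t k.+1 *: (g k.+1 * (E * (g k * y n))).
    have -> : t k.+1 *: (g k.+1 * (E * (g k * y n)))
        = g k.+1 * (t k.+1 *: E) * (g k * y n).
      by rewrite -(scalerAr (t k.+1)) -(scalerAl (t k.+1)) !mulrA.
    have -> : t k.+1 *: E = b k - b k.+1 by rewrite bE; nc_ring.
    have -> : g k.+1 * (b k - b k.+1) * (g k * y n)
      = g k.+1 * (b k * g k) * y n - g k.+1 * b k.+1 * g k * y n by nc_ring.
    by rewrite bg gb1 mulr1 mul1r mulrBl.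
  have hEy : `|E * (g k * y n)| <= t k ^+ 3.
    have [nk|/ltnW kn] := leqP n k.
      apply: (le_trans (hE _ bg gb' _ nk)).
      rewrite exprS -[leRHS]mul1r; apply: ler_wpM2r.
        by rewrite exprn_ge0// ltW.
      exact: t_le1.
    rewrite (le_trans (norm_umul _ _))// -[leRHS]mul1r ler_pM//.
    rewrite (le_trans (norm_umul _ _))//.
    have -> : t k ^+ 3 = (t k)^-1 * t k ^+ 4 by field; rewrite gt_eqF.
    apply: ler_pM => //; apply: (le_trans (yn n)).
    apply: lerXn2r; rewrite ?nnegrE ?(ltW (t_gt0 _))//.
    exact: t_le.
  rewrite normrZ (gtr0_norm (t_gt0 _)).
  have h1 := le_trans (norm_umul (g k.+1) (E * (g k * y n)))
    (ler_pM (normr_ge0 _) (normr_ge0 _) gn1 hEy).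
  have := ler_wpM2l (ltW (t_gt0 k.+1)) h1.
  by rewrite (mulrA _ (t k.+1)^-1) divff ?gt_eqF// mul1r.
have [h [bh hb]] : exists h : B, b @ \oo --> h /\
    forall n, `|h - b n| <= 0 - (- t n).
  apply: cvg_majorant => k; last by rewrite oppr_le0 ltW.
  have [E [bE Es E1 KE hE]] := fP (k, b k) (gb k); rewrite /= -bS in bE.
  rewrite bE addrC addKr normrN normrZ (gtr0_norm (t_gt0 _)).
  have := ler_wpM2l (ltW (t_gt0 k.+1)) E1.
  by rewrite tS => h1; lra.
have hs : usa h by apply: (cvg_usa bh) => k; have [] := gb k.
have Kh : K h.
  apply: (@uideal_closed _ _ _ hK (fun k => b k - t k *: 1)); last first.
    by move=> k; have [] := gb k.
  rewrite -[h]subr0; apply: cvgB => //; rewrite -(scale0r 1).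
  apply: cvgZr_tmp; apply: cvg_expr.
  by rewrite gtr0_norm ?invr_gt0// invf_lt1 ?ltr1n.
have /choice[c cP] n : exists c : B,
    (fun k => g k * y n * g k) @ \oo --> c /\ `|c| <= 5.
  (* The increments are at most 3 t_k^2, which is exactly the increment of - 4 t_k^2, as [t k] is
     halved at each step. *)
  have [c [gc cb]] : exists c : B, (fun k => g k * y n * g k) @ \oo --> c /\
      forall k, `|c - g k * y n * g k| <= 0 - (- (4 * t k ^+ 2)).
    apply: cvg_majorant => k; last by rewrite oppr_le0 mulr_ge0// sqr_ge0.
    have -> : g k.+1 * y n * g k.+1 - g k * y n * g k
      = (g k.+1 - g k) * y n * g k.+1 + g k * (y n * (g k.+1 - g k)) by nc_ring.
    have h1 := dg k n.
    have h2 : `|y n * (g k.+1 - g k)| <= t k ^+ 3.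
      by rewrite -norm_ustar ustarM ustarB !gs ys.
    have [_ _ gn] := gP k; have [_ _ gn1] := gP k.+1.
    rewrite (le_trans (ler_normD _ _))//.
    rewrite (le_trans (lerD (norm_umul _ _) (norm_umul _ _)))//.
    have h3 := ler_pM (normr_ge0 _) (normr_ge0 _) h1 gn1.
    have h4 := ler_pM (normr_ge0 _) (normr_ge0 _) gn h2.
    have e1 : t k ^+ 3 * (t k.+1)^-1 = 2 * t k ^+ 2.
      by rewrite tS; field; rewrite gt_eqF.
    have e2 : (t k)^-1 * t k ^+ 3 = t k ^+ 2 by field; rewrite gt_eqF.
    rewrite e1 in h3; rewrite e2 in h4.
    have e3 : t k.+1 ^+ 2 = t k ^+ 2 / 4 by rewrite tS; field.
    by rewrite e3; lra.
  exists c; split=> //.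
  have [bg0 _ _] := gP 0; have g0 : g 0 = 1 by rewrite -bg0 mul1r.
  (* The limit is within 4 of [y n], itself of norm at most 1; hence the constant 5. *)
  have := cb 0; rewrite g0 mul1r mulr1 /t expr0 expr1n mulr1 => h4.
  have h1 : `|y n| <= 1.
    by rewrite (le_trans (yn n))// exprn_ile1// ltW.
  rewrite -(subrK (y n) c) (le_trans (ler_normD _ _))//.
  by move: h4 h1; rewrite sub0r opprK => h4 h1; lra.
exists h, c; split=> // n; have [gc c5] := cP n.
  split=> //.
    apply: (cvg_usa gc) => k.
    by have := usa_conj (g k) (ys n); rewrite gs.
  apply: (uideal_closed hK gc) => k.
  by apply: (uidealMr hK); exact: (uidealMl hK).
apply: (@cvg_seq_unique _ _ (fun k => b k * (g k * y n * g k) * b k)).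
  have -> : (fun k => b k * (g k * y n * g k) * b k) = (fun=> y n).
    apply/funext => k; have [bg gb' _] := gP k.
    have -> : b k * (g k * y n * g k) * b k = b k * g k * y n * (g k * b k).
      by nc_ring.
    by rewrite bg gb' mul1r mulr1.
  exact: cvg_cst.
by apply: cvg_umul => //; exact: cvg_umul.
Qed.

End Factorization.

(** * The continuity ideal *)

Section SelfAdjointPart.
Context {R : realType} {A : cstarAlgType R}.
Local Notation B := (unitization A).
Implicit Types (a b c x y z : B) (r : R).

(* The elements of [selfAdjoint A], inside the unitization. *)
Definition inJ x := uscal x = 0 /\ usa x.

Lemma uscalM x y : uscal (x * y) = uscal x * uscal y. Proof. by []. Qed.
Lemma uscalD x y : uscal (x + y) = uscal x + uscal y. Proof. by []. Qed.
Lemma uscalZ r x : uscal (r *: x) = r%:C%C * uscal x. Proof. by []. Qed.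
Lemma uscal_star x : uscal (ustar x) = (uscal x)^*. Proof. by []. Qed.

Lemma inJD x y : inJ x -> inJ y -> inJ (x + y).
Proof.
by move=> [x0 xs] [y0 ys]; split; [rewrite uscalD x0 y0 addr0|exact: usaD].
Qed.

Lemma inJZ r x : inJ x -> inJ (r *: x).
Proof. by move=> [x0 xs]; split; [rewrite uscalZ x0 mulr0|exact: usaZ]. Qed.

Lemma inJN x : inJ x -> inJ (- x).
Proof. by rewrite -scaleN1r; exact: inJZ. Qed.

Lemma inJB x y : inJ x -> inJ y -> inJ (x - y).
Proof. by move=> hx hy; apply: inJD => //; exact: inJN. Qed.

Lemma inJ0 : inJ 0. Proof. by split => //; exact: usa0. Qed.

Lemma inJ_closed (u : nat -> B) x :
  u @ \oo --> x -> (forall n, inJ (u n)) -> inJ x.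
Proof.
move=> ux hu; split; last by apply: (cvg_usa ux) => n; have [] := hu n.
apply: rnorm0_eq0; apply/eqP; rewrite eq_le rnorm_ge0 andbT.
apply/ler_addgt0Pl => e e0; rewrite addr0.
move/cvgrPdist_le: ux => /(_ e e0)[N _ hN].
have [u0 _] := hu N; apply: (le_trans _ (hN N (leqnn N))).
by apply: (le_trans _ (unorm_scal _)); rewrite uscalD /= u0 oppr0 addr0.
Qed.

(** On self-adjoint elements this is twice the triple product; dropping the factor 1/2 keeps
    identities free of scalars. *)
Definition tri a b c := a * b * c + c * b * a.

Lemma inJ_tri a b c : inJ a -> inJ b -> inJ c -> inJ (tri a b c).
Proof.
move=> [a0 as_] [b0 bs] [c0 cs]; split.
  by rewrite uscalD !uscalM a0 b0 c0 !mul0r addr0.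
by rewrite /usa ustarD !ustarM as_ bs cs addrC !mulrA.
Qed.

Lemma norm_tri a b c : `|tri a b c| <= 2 * (`|a| * `|b| * `|c|).
Proof.
have h x y z : `|x * y * z| <= `|x| * `|y| * `|z|.
  by rewrite (le_trans (norm_umul _ _))// ler_wpM2r// norm_umul.
rewrite (le_trans (ler_normD _ _))// mulr_natl mulr2n lerD//.
by rewrite [leRHS]mulrC mulrA (le_trans (h _ _ _))// mulrAC.
Qed.

Lemma inJ_comm a b : inJ a -> usa b -> inJ (a * b + b * a).
Proof.
move=> [a0 as_] bs; split.
  by rewrite uscalD !uscalM a0 mul0r mulr0 addr0.
by rewrite /usa ustarD !ustarM as_ bs addrC.
Qed.

Lemma inJ_lie a b : inJ a -> usa b -> inJ (uI * (a * b - b * a)).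
Proof.
move=> [a0 as_] bs; split.
  by rewrite uscalM uscalD !uscalM /= a0 mul0r mulr0 subr0 mulr0.
by have := usa_im (a * b); rewrite ustarM as_ bs.
Qed.

Lemma inJ_conj a b : inJ a -> usa b -> inJ (b * a * b).
Proof.
move=> [a0 as_] bs; split; first by rewrite !uscalM a0 mulr0 mul0r.
by have := usa_conj b as_; rewrite bs.
Qed.

Lemma inJ_sq a : inJ a -> inJ (a * a).
Proof. by move=> [a0 as_]; split; [rewrite uscalM a0 mul0r|exact: usa_sq]. Qed.

Lemma usa_scal b : usa b -> exists r b0, inJ b0 /\ b = r *: 1 + b0.
Proof.
move=> bs; have e : (uscal b)^* = uscal b by rewrite -uscal_star bs.
exists (complex.Re (uscal b)), (Unitization 0 (uelt b)); split.
  split=> //; apply: unitization_eqP => /=; first by rewrite rmorph0.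
  by rewrite -[in RHS]bs.
apply: unitization_eqP => /=; last by rewrite scaler0 add0r.
rewrite addr0 mulr1; case: (uscal b) e => u v /=.
move=> /eqP; rewrite eq_complex /= => /andP[_ /eqP h].
by apply/eqP; rewrite eq_complex /= eqxx /=; apply/eqP; lra.
Qed.

(** A real-linear projection onto the self-adjoint part of [A]. It extends the derivation to the
    Banach space [B], where the uniform boundedness principle applies. *)
Definition projJ x : B :=
  2^-1 *: (Unitization 0 (uelt x) + ustar (Unitization 0 (uelt x))).

Lemma inJ_proj x : inJ (projJ x).
Proof.
apply: inJZ; split; last exact: usa_re.
by rewrite uscalD uscal_star /= rmorph0 addr0.
Qed.

Lemma norm_proj x : `|projJ x| <= 2 * `|x|.
Proof.
have h : `|Unitization 0 (uelt x) : B| <= 2 * `|x|.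
  apply: (le_trans _ (rnorm_uelt x)).
  have := unorm_le (ubound_ex (Unitization 0 (uelt x))).
  by rewrite /= rnorm0 add0r.
rewrite normrZ gtr0_norm ?invr_gt0// ler_pdivrMl//.
rewrite (le_trans (ler_normD _ _))// norm_ustar.
by move: h; set u := `|_ : B|; lra.
Qed.

Lemma projJ_id x : inJ x -> projJ x = x.
Proof.
move=> [x0 xs]; have e : Unitization 0 (uelt x) = x.
  by apply: unitization_eqP.
by rewrite /projJ e xs -[x + x]mulr2n -[x *+ 2]scaler_nat scalerA mulVf
  ?pnatr_eq0// scale1r.
Qed.

End SelfAdjointPart.

Section ContinuityIdeal.
Context {R : realType} {A : cstarAlgType R}.
Local Notation B := (unitization A).
Implicit Types (a b c x y z : B) (r : R).

Variables (X : normedModType R) (f : B -> X) (P Q : B -> B -> X -> X) (M : R).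

(* [P a c] and [Q b c] play the roles of [x |-> {a, x, c}] and
   [x |-> {b, c, x}] on the module; [f] is the derivation, extended to the
   unitization through [projJ]. *)
Record deriv_like : Prop := DerivLike {
  dl_M : 0 <= M;
  dl_linear : linear f;
  dl_proj : forall x, f x = f (projJ x);
  dl_P : forall a c, inJ a -> inJ c ->
    exists k : R, forall z, inJ z -> `|f (tri a z c) - P a c (f z)| <= k * `|z|;
  dl_Q : forall b c, inJ b -> inJ c ->
    exists k : R, forall z, inJ z -> `|f (tri b c z) - Q b c (f z)| <= k * `|z|;
  dl_Plin : forall a c, linear (P a c);
  dl_PB : forall a a' c (u : X), P (a - a') c u = P a c u - P a' c u;
  dl_Pn : forall a c (u : X), inJ a -> inJ c -> `|P a c u| <= M * `|a| * `|c| * `|u|;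
  dl_Qn : forall b c (u : X), inJ b -> inJ c -> `|Q b c u| <= M * `|b| * `|c| * `|u|
}.

Hypothesis hf : deriv_like.

Lemma dl_additive x y : f (x + y) = f x + f y.
Proof. by have := dl_linear hf 1 x y; rewrite !scale1r. Qed.

Lemma dl_0 : f 0 = 0.
Proof. by apply: (addIr (f 0)); rewrite -dl_additive !add0r. Qed.

Lemma dl_scale r x : f (r *: x) = r *: f x.
Proof. by have := dl_linear hf r x 0; rewrite dl_0 !addr0. Qed.

Lemma dl_opp x : f (- x) = - f x.
Proof. by rewrite -scaleN1r dl_scale scaleN1r. Qed.

Definition bddJ (U : B -> X) := exists C, forall z, inJ z -> `|U z| <= C * `|z|.

Lemma bddJD (U V : B -> X) :
  bddJ U -> bddJ V -> bddJ (fun z => U z + V z).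
Proof.
move=> [C hC] [D hD]; exists (C + D) => z zJ.
by rewrite (le_trans (ler_normD _ _))// mulrDl lerD ?hC ?hD.
Qed.

Lemma bddJZ r (U : B -> X) : bddJ U -> bddJ (fun z => r *: U z).
Proof.
move=> [C hC]; exists (`|r| * C) => z zJ.
by rewrite normrZ -mulrA ler_wpM2l// hC.
Qed.

Definition opJ (U : B -> B) := (forall z, inJ z -> inJ (U z)) /\
  exists k, forall z, inJ z -> `|U z| <= k * `|z|.

Lemma opJ_id : opJ id.
Proof. by split=> //; exists 1 => z _; rewrite mul1r. Qed.

Lemma opJ_tri U a c : inJ a -> inJ c -> opJ U -> opJ (fun z => tri a (U z) c).
Proof.
move=> aJ cJ [UJ [k hk]]; split=> [z zJ|]; first by apply: inJ_tri => //; exact: UJ.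
exists (2 * (`|a| * `|c|) * k) => z zJ; rewrite (le_trans (norm_tri _ _ _))//.
rewrite -!mulrA ler_wpM2l// ler_wpM2l// mulrC ler_wpM2l//; exact: hk.
Qed.

Lemma opJ_triR U b c : inJ b -> inJ c -> opJ U -> opJ (fun z => tri b c (U z)).
Proof.
move=> bJ cJ [UJ [k hk]]; split=> [z zJ|]; first by apply: inJ_tri => //; exact: UJ.
exists (2 * (`|b| * `|c|) * k) => z zJ; rewrite (le_trans (norm_tri _ _ _))//.
rewrite -!mulrA ler_wpM2l// ler_wpM2l// ler_wpM2l//; exact: hk.
Qed.

(** By [dl_P], f (tri a (U z) c) differs from P a c (f (U z)) by a bounded term, and P a c is
    bounded. *)
Lemma bddJ_tri U a c : inJ a -> inJ c -> opJ U ->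
  bddJ (fun z => f (U z)) -> bddJ (fun z => f (tri a (U z) c)).
Proof.
move=> aJ cJ [UJ [k Un]] [C hC]; have [l hl] := dl_P hf aJ cJ.
exists (`|l| * k + M * `|a| * `|c| * C) => z zJ.
rewrite -(subrK (P a c (f (U z))) (f (tri _ _ _))).
rewrite (le_trans (ler_normD _ _))// mulrDl; apply: lerD.
  rewrite (le_trans (hl _ (UJ _ zJ)))// -mulrA.
  by rewrite (le_trans (ler_wpM2r _ (ler_norm l)))// ler_wpM2l// Un.
rewrite (le_trans (dl_Pn hf _ aJ cJ))// -[leRHS]mulrA.
by apply: ler_wpM2l; [rewrite !mulr_ge0// (dl_M hf)|exact: hC].
Qed.

Lemma bddJ_triR U b c : inJ b -> inJ c -> opJ U ->
  bddJ (fun z => f (U z)) -> bddJ (fun z => f (tri b c (U z))).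
Proof.
move=> aJ cJ [UJ [k Un]] [C hC]; have [l hl] := dl_Q hf aJ cJ.
exists (`|l| * k + M * `|b| * `|c| * C) => z zJ.
rewrite -(subrK (Q b c (f (U z))) (f (tri _ _ _))).
rewrite (le_trans (ler_normD _ _))// mulrDl; apply: lerD.
  rewrite (le_trans (hl _ (UJ _ zJ)))// -mulrA.
  by rewrite (le_trans (ler_wpM2r _ (ler_norm l)))// ler_wpM2l// Un.
rewrite (le_trans (dl_Qn hf _ aJ cJ))// -[leRHS]mulrA.
by apply: ler_wpM2l; [rewrite !mulr_ge0// (dl_M hf)|exact: hC].
Qed.

Lemma bddJ_comp (V : B -> X) U : opJ U -> bddJ V -> bddJ (fun z => V (U z)).
Proof.
move=> [UJ [k Un]] [C hC]; exists (`|C| * k) => z zJ.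
rewrite (le_trans (hC _ (UJ _ zJ)))// -mulrA.
by rewrite (le_trans (ler_wpM2r _ (ler_norm C)))// ler_wpM2l// Un.
Qed.

Lemma bddJ_eq (U V : B -> X) : (forall z, inJ z -> U z = V z) -> bddJ V -> bddJ U.
Proof. by move=> e [C hC]; exists C => z zJ; rewrite e// hC. Qed.

Definition contJ a := inJ a /\ forall c, inJ c -> bddJ (fun z => f (tri a z c)).

Lemma contJ0 : contJ 0.
Proof.
split=> [|c cJ]; first exact: inJ0.
by exists 0 => z _; rewrite /tri mulr0 !mul0r addr0 dl_0 normr0.
Qed.

Lemma contJD a b : contJ a -> contJ b -> contJ (a + b).
Proof.
move=> [aJ ha] [bJ hb]; split=> [|c cJ]; first exact: inJD.
apply: (bddJ_eq _ (bddJD (ha c cJ) (hb c cJ))) => z _.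
by rewrite -dl_additive; congr f; rewrite /tri; nc_ring.
Qed.

Lemma contJZ r a : contJ a -> contJ (r *: a).
Proof.
move=> [aJ ha]; split=> [|c cJ]; first exact: inJZ.
apply: (bddJ_eq _ (bddJZ r (ha c cJ))) => z _.
rewrite -dl_scale; congr f.
by rewrite /tri scalerDr -(scalerAr r) -!(scalerAl r).
Qed.

Lemma contJN a : contJ a -> contJ (- a).
Proof. by rewrite -scaleN1r; exact: contJZ. Qed.

Lemma contJB a b : contJ a -> contJ b -> contJ (a - b).
Proof. by move=> ha hb; apply: contJD => //; exact: contJN. Qed.

Lemma contJZr r a : r != 0 -> contJ (r *: a) -> contJ a.
Proof. by move=> r0 /(contJZ r^-1); rewrite scalerA mulVf// scale1r. Qed.

(** The Jordan identity reads {{b,c,a},z,x} = {b,c,{a,z,x}} + {a,{c,b,z},x} - {a,z,{b,c,x}}, and a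
    occupies an outer place in each inner or outer product containing z on the right. *)
Lemma contJ_tri a b c : contJ a -> inJ b -> inJ c -> contJ (tri b c a).
Proof.
move=> [aJ ha] bJ cJ; split=> [|x xJ]; first exact: inJ_tri.
have opT : opJ (fun z => tri a z x) by exact: opJ_tri opJ_id.
have h1 := bddJ_triR bJ cJ opT (ha x xJ).
have h2 := bddJ_comp (opJ_triR cJ bJ opJ_id) (ha x xJ).
have h3 := bddJZ (-1) (ha _ (inJ_tri bJ cJ xJ)).
apply: (bddJ_eq _ (bddJD (bddJD h1 h2) h3)) => z _.
by rewrite scaleN1r -dl_opp -!dl_additive; congr f; rewrite /tri; nc_ring.
Qed.

End ContinuityIdeal.

(** * From the Jordan ideal to a closed two-sided ideal *)

Section ContinuityIdealTheory.
Context {R : realType} {A : cstarAlgType R}.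
Local Notation B := (unitization A).
Implicit Types (a b c x y z : B) (r : R).

Variables (X : normedModType R) (f : B -> X) (P Q : B -> B -> X -> X) (M : R).
Hypothesis hf : deriv_like f P Q M.

Local Notation contJ := (contJ f).

(** Each P (u n) c composed with [f] is bounded since [u n] belongs to the ideal, and pointwise they
    are bounded together since [u] is. Banach-Steinhaus makes the bound uniform, and it passes to
    the limit P a c composed with [f]. *)
Lemma contJ_closed (u : nat -> B) a :
  u @ \oo --> a -> (forall n, contJ (u n)) -> contJ a.
Proof.
move=> ua hu; have uJ n : inJ (u n) by have [] := hu n.
have aJ : inJ a by exact: inJ_closed ua uJ.
split=> // c cJ.
have [L hL] : exists L, forall n, `|u n| <= L.
  have [L [_ hL]] := cvg_seq_bounded (cvgP _ ua).
  by exists (L + 1) => n; apply: hL => //; rewrite ltrDl.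
pose T n z := P (u n) c (f z).
have Tlin n : linear (T n).
  by move=> r x y; rewrite /T (dl_linear hf) (dl_Plin hf).
have Tb n : bounded_fun_norm (T n).
  have [_ /(_ c cJ) [C hC]] := hu n; have [k hk] := dl_P hf (uJ n) cJ.
  move=> r; exists ((`|C| + `|k|) * (2 * r)) => x xr.
  rewrite /T (dl_proj hf); have xJ := inJ_proj x.
  rewrite -(subrK (f (tri (u n) (projJ x) c)) (P _ _ _)).
  rewrite (le_trans (ler_normD _ _))// distrC addrC.
  rewrite (le_trans (lerD (hC _ xJ) (hk _ xJ)))//.
  rewrite -mulrDl (@le_trans _ _ ((`|C| + `|k|) * `|projJ x|))//.
    by rewrite ler_wpM2r// lerD// ler_norm.
  apply: ler_wpM2l; first exact: addr_ge0.
  by rewrite (le_trans (norm_proj x))// ler_wpM2l.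
have ub : uniform_bounded [set T n | n in setT].
  apply: Banach_Steinhauss => [_ [n _ <-]|x]; first by split.
  exists (M * L * `|c| * `|f x|) => _ [n _ <-].
  rewrite (le_trans (dl_Pn hf _ (uJ n) cJ))//.
  apply: ler_wpM2r => //; apply: ler_wpM2r => //; apply: ler_wpM2l => //.
  exact: dl_M hf.
have [D hD] := ub 1.
have Ta z : `|z| <= 1 -> `|P a c (f z)| <= D.
  move=> z1; apply/ler_addgt0Pl => e e0.
  pose W := M * `|c| * `|f z| + 1.
  have W0 : 0 < W by rewrite ltr_wpDl// !mulr_ge0// (dl_M hf).
  move/cvgrPdist_le: ua => /(_ (e / W)); rewrite divr_gt0// => /(_ isT)[N _ hN].
  have := hN N (leqnn N) => /= aN.
  rewrite -(subrK (P (u N) c (f z)) (P a c (f z))) -(dl_PB hf).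
  rewrite (le_trans (ler_normD _ _))// lerD//; last first.
    by apply: (hD (T N)) => //; exists N.
  rewrite (le_trans (dl_Pn hf _ (inJB aJ (uJ N)) cJ))//.
  have := ler_wpM2l (ltW W0) aN; rewrite mulrCA divff ?gt_eqF// mulr1.
  have := normr_ge0 (a - u N); rewrite /W; set v := `|a - u N|.
  have -> : M * v * `|c| * `|f z| = M * `|c| * `|f z| * v by ring.
  by move=> h1 h2; lra.
have P0 : P a c 0 = 0.
  have := dl_Plin hf a c 1 0 0; rewrite !scale1r addr0 => h.
  by apply: (addIr (P a c 0)); rewrite add0r -h.
have [k hk] := dl_P hf aJ cJ.
exists (k + D) => z zJ; rewrite -(subrK (P a c (f z)) (f (tri _ _ _))).
rewrite (le_trans (ler_normD _ _))// mulrDl lerD ?hk//.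
have [->|z0] := eqVneq z 0.
  by rewrite (dl_0 hf) P0 !normr0 mulr0.
have nz : 0 < `|z| by rewrite normr_gt0.
have := Ta (`|z|^-1 *: z).
rewrite normrZ normfV normr_id mulVf ?gt_eqF// lexx => /(_ isT).
have -> : P a c (f (`|z|^-1 *: z)) = `|z|^-1 *: P a c (f z).
  have := dl_Plin hf a c (`|z|^-1) (f z) 0.
  by rewrite P0 !addr0 (dl_scale hf).
by rewrite normrZ normfV normr_id ler_pdivrMl// mulrC.
Qed.

Lemma contJ_approx a :
  (forall e : R, 0 < e -> exists2 b, contJ b & `|a - b| <= e) -> contJ a.
Proof.
move=> h; have /choice[u hu] n : exists b, contJ b /\ `|a - b| <= n.+1%:R^-1.
  by have [|b] := h n.+1%:R^-1; [rewrite invr_gt0|exists b].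
apply: (@contJ_closed u) => [|n]; last by have [] := hu n.
by apply: cvg_harm => n; have [] := hu n.
Qed.

Lemma contJ_inJ a : contJ a -> inJ a. Proof. by case. Qed.

Lemma contJ_half a : contJ (a + a) -> contJ a.
Proof.
rewrite -mulr2n -scaler_nat => h; apply: (contJZr hf _ h).
by rewrite pnatr_eq0.
Qed.

Lemma inJ_approx a (e : R) : inJ a -> 0 < e ->
  exists v, [/\ inJ v, v * a = a * v & `|a - v * a| <= e].
Proof.
move=> [a0 as_] e0; have [z [zs zC z1 za]] := approx_unit as_ e0.
have za' : a * z = z * a by exact: zC.
exists (a * a * z); split.
- split; first by rewrite !uscalM a0 !mul0r.
  by apply: usaM => //; [exact: usa_sq|rewrite -!mulrA za' mulrA za' -!mulrA].
- by rewrite -!mulrA za'.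
- by have -> : a - a * a * z * a = (1 - a * a * z) * a by nc_ring.
Qed.

(** The Jordan product would be {b, 1, a}, but 1 is not in the self-adjoint part of [A]; it is
    replaced by a local unit v of a, and closedness removes the error. *)
Lemma contJ_jordan0 a b : contJ a -> inJ b -> contJ (a * b + b * a).
Proof.
move=> ha bJ; apply: contJ_approx => e e0.
pose W := 2 * `|b| + 1; have W0 : 0 < W by rewrite ltr_wpDl// mulr_ge0.
have [|v [vJ va hv]] := @inJ_approx a (e / W) (contJ_inJ ha).
  exact: divr_gt0.
exists (tri b v a); first exact: (contJ_tri hf).
have -> : a * b + b * a - tri b v a = (a - v * a) * b + b * (a - v * a).
  by rewrite /tri {1}va; nc_ring.
rewrite (le_trans (ler_normD _ _))//.
rewrite (le_trans (lerD (norm_umul _ _) (norm_umul _ _)))//.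
have dW : e / W * (2 * `|b| + 1) = e by rewrite -/W divfK ?gt_eqF.
have d0 : 0 <= e / W by rewrite ltW// divr_gt0.
by have := ler_wpM2r (normr_ge0 b) hv; lra.
Qed.

Lemma contJ_jordan a b : contJ a -> usa b -> contJ (a * b + b * a).
Proof.
move=> ha /usa_scal[r [b0 [b0J ->]]].
have -> : a * (r *: 1 + b0) + (r *: 1 + b0) * a
    = (r *: a + r *: a) + (a * b0 + b0 * a).
  by rewrite mulrDl mulrDr -(scalerAl r) -(scalerAr r) mulr1 mul1r addrACA.
apply: (contJD hf); last exact: contJ_jordan0.
by apply: (contJD hf); exact: (contJZ hf).
Qed.

Lemma contJ_sq a : contJ a -> contJ (a * a).
Proof.
by move=> ha; apply: contJ_half; apply: contJ_jordan => //; case: ha => -[].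
Qed.

Lemma contJ_conj a b : contJ a -> usa b -> contJ (b * a * b).
Proof.
move=> ha bs; apply: contJ_half.
have -> : b * a * b + b * a * b = (a * b + b * a) * b + b * (a * b + b * a)
   - (a * (b * b) + b * b * a) by nc_ring.
apply: (contJB hf); apply: contJ_jordan => //; last exact: usa_sq.
exact: contJ_jordan.
Qed.

Lemma contJ_conjl a b : contJ a -> usa b -> contJ (a * b * a).
Proof.
move=> ha bs; have as_ : usa a by case: ha => -[].
apply: contJ_half.
have -> : a * b * a + a * b * a = (a * b + b * a) * a + a * (a * b + b * a)
   - (a * a * b + b * (a * a)) by nc_ring.
apply: (contJB hf); apply: contJ_jordan => //; first exact: contJ_jordan.
exact: contJ_sq.
Qed.

(** The elements k^2 z k approximate k, and twice k^2 z k is the Jordan product of k^2 with z k. *)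
Lemma contJ_sqrt k : inJ k -> contJ (k * k) -> contJ k.
Proof.
move=> [k0 ks] hk; apply: contJ_approx => e e0.
have [z [zs zC z1 zk]] := approx_unit ks e0; have kz : k * z = z * k by exact: zC.
exists (k * k * z * k); last first.
  by have -> : k - k * k * z * k = (1 - k * k * z) * k by nc_ring.
apply: contJ_half.
have -> : k * k * z * k + k * k * z * k = k * k * (z * k) + z * k * (k * k).
  congr (_ + _); first by rewrite !mulrA.
  by rewrite -(mulrA k k z) kz (mulrA k z k) kz -!mulrA.
by apply: contJ_jordan => //; exact: usaM.
Qed.

(* [(i [a, b])^2] is a Jordan polynomial. *)
Lemma contJ_lie a b : contJ a -> usa b -> contJ (uI * (a * b - b * a)).
Proof.
move=> ha bs; have aJ := contJ_inJ ha; have as_ : usa a by case: aJ.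
apply: contJ_sqrt; first exact: inJ_lie.
have -> : uI * (a * b - b * a) * (uI * (a * b - b * a))
    = - ((a * b - b * a) * (a * b - b * a)).
  by rewrite {2}uIC mulrA -(mulrA uI) -uIC !mulrA uI_sq !mulN1r mulNr.
have -> : - ((a * b - b * a) * (a * b - b * a))
    = a * (b * b) * a + b * (a * a) * b - (a * (b * a * b) + b * a * b * a).
  by nc_ring.
apply: (contJB hf); last first.
  by apply: contJ_jordan => //; have [] := inJ_conj aJ bs.
apply: (contJD hf); first by apply: contJ_conjl => //; exact: usa_sq.
by apply: contJ_conj => //; exact: contJ_sq.
Qed.

(** The complex span of the Jordan ideal: up to factors 2 and -2 these are the real and imaginary
    parts of x. *)
Definition contI x := contJ (x + ustar x) /\ contJ (uI * (x - ustar x)).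

Let IM x : uI * (uI * x) = - x. Proof. by rewrite mulrA uI_sq mulN1r. Qed.

Lemma contI_D x y : contI x -> contI y -> contI (x + y).
Proof.
move=> [x1 x2] [y1 y2]; split.
  by rewrite ustarD addrACA; exact: (contJD hf).
by rewrite ustarD opprD addrACA mulrDr; exact: (contJD hf).
Qed.

Lemma contI_Z r x : contI x -> contI (r *: x).
Proof.
move=> [x1 x2]; split; first by rewrite ustarZ -scalerDr; exact: (contJZ hf).
by rewrite ustarZ -scalerBr -(scalerAr r); exact: (contJZ hf).
Qed.

Lemma contI_I x : contI x -> contI (uI * x).
Proof.
have e : ustar (uI * x) = - (uI * ustar x).
  by rewrite ustarM ustarI mulrN -uIC.
move=> [x1 x2]; split; rewrite e.
  by rewrite -mulrBr.
by rewrite opprK -mulrDr IM; exact: (contJN hf).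
Qed.

Lemma contI_N x : contI x -> contI (- x).
Proof. by rewrite -scaleN1r; exact: contI_Z. Qed.

Lemma contI_J a : contJ a -> contI a.
Proof.
move=> ha; have as_ : usa a by case: ha => -[].
split; rewrite as_; first exact: (contJD hf).
by rewrite subrr mulr0; exact: (contJ0 hf).
Qed.

Lemma contI_usa x : usa x -> contI x -> contJ x.
Proof. by move=> xs [x1 _]; apply: contJ_half; rewrite -{2}xs. Qed.

Let split_ri x : x = 2^-1 *: ((x + ustar x) - uI * (uI * (x - ustar x))).
Proof.
rewrite IM opprK addrACA subrr addr0 -[x + x]mulr2n -[x *+ 2]scaler_nat.
by rewrite scalerA mulVf ?pnatr_eq0// scale1r.
Qed.

(** Twice y a is the Jordan product of a and y plus i times the self-adjoint commutator i [a, y],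
    and both belong to the ideal. *)
Lemma contI_Ml_usa y a : usa y -> contJ a -> contI (y * a).
Proof.
move=> ys ha.
have -> : y * a = 2^-1 *: ((a * y + y * a) + uI * (uI * (a * y - y * a))).
  rewrite IM (_ : _ + _ = y * a + y * a); last by nc_ring.
  rewrite -[y * a + _]mulr2n -[y * a *+ 2]scaler_nat.
  by rewrite scalerA mulVf ?pnatr_eq0// scale1r.
apply: contI_Z; apply: contI_D; first by apply: contI_J; exact: contJ_jordan.
by apply: contI_I; apply: contI_J; exact: contJ_lie.
Qed.

Lemma contI_Ml y x : contI x -> contI (y * x).
Proof.
have h z a : contJ a -> contI (z * a).
  move=> ha; rewrite (split_ri z) -(scalerAl 2^-1); apply: contI_Z.
  rewrite mulrBl; apply: contI_D.
    by apply: contI_Ml_usa => //; exact: usa_re.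
  apply: contI_N; rewrite -mulrA; apply: contI_I.
  by apply: contI_Ml_usa => //; exact: usa_im.
move=> [x1 x2]; rewrite [in y * x](split_ri x) -(scalerAr 2^-1).
apply: contI_Z; rewrite mulrBr (mulrA y uI).
apply: contI_D; first exact: h.
by apply: contI_N; exact: h.
Qed.

Lemma contI_star x : contI x -> contI (ustar x).
Proof.
move=> [x1 x2]; split; rewrite ustarK; first by rewrite addrC.
by rewrite -opprB mulrN; exact: (contJN hf).
Qed.

Lemma contI_ideal : uideal contI.
Proof.
split.
- by apply: contI_J; exact: (contJ0 hf).
- exact: contI_D.
- exact: contI_Ml.
- move=> x y hx; rewrite -[x * y]ustarK ustarM; apply: contI_star.
  by apply: contI_Ml; exact: contI_star.
- exact: contI_star.
- move=> u x ux hu; split.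
    apply: (@contJ_closed (fun n => u n + ustar (u n))) => [|n].
      by apply: cvgD => //; exact: cvg_ustar.
    by have [] := hu n.
  apply: (@contJ_closed (fun n => uI * (u n - ustar (u n)))) => [|n].
    apply: cvg_umul; first exact: cvg_cst.
    by apply: cvgB => //; exact: cvg_ustar.
  by have [] := hu n.
Qed.

End ContinuityIdealTheory.

(** * The gliding hump *)

Section GlidingHump.
Context {R : realType} {A : cstarAlgType R}.
Local Notation B := (unitization A).
Implicit Types (a x y z : B) (r : R).

Variables (X : normedModType R) (f : B -> X) (P Q : B -> B -> X -> X) (M : R).
Hypothesis hf : deriv_like f P Q M.

Lemma cvg_tri (u : nat -> B) x a c : u @ \oo --> x ->
  (fun n => tri a (u n) c) @ \oo --> tri a x c.
Proof.
by move=> ux; apply: cvgD; apply: cvg_umul; do ?apply: cvg_umul => //;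
  exact: cvg_cst.
Qed.

Lemma triZ a c r z : tri a (r *: z) c = r *: tri a z c.
Proof. by rewrite /tri scalerDr -!(scalerAr r) -!(scalerAl r). Qed.

Lemma triD a c x y : tri a (x + y) c = tri a x c + tri a y c.
Proof. by rewrite /tri; nc_ring. Qed.

Lemma tri0 a (c : B) : tri a 0 c = 0.
Proof. by rewrite /tri !mulr0 !mul0r addr0. Qed.

Lemma tri_sum a c (F : nat -> B) n m :
  tri a (\sum_(n <= k < m) F k) c = \sum_(n <= k < m) tri a (F k) c.
Proof. by apply: (big_morph (fun x => tri a x c) (triD a c) (tri0 a c)). Qed.

(** The term |f z| remains, so this is no bound in |z|; the hump argument applies it to a single
    fixed element. *)
Lemma tri_estimate a c : inJ a -> inJ c -> exists k : R, forall z, inJ z ->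
  `|f (tri a z c)| <= k * (`|f z| + `|z|).
Proof.
move=> aJ cJ; have [k hk] := dl_P hf aJ cJ.
exists (`|k| + M * `|a| * `|c|) => z zJ.
rewrite -(subrK (P a c (f z)) (f (tri _ _ _))).
rewrite (le_trans (ler_normD _ _))//.
rewrite (le_trans (lerD (hk _ zJ) (dl_Pn hf _ aJ cJ)))//.
have := ler_wpM2r (normr_ge0 z) (ler_norm k).
have M0 : 0 <= M * `|a| * `|c| by rewrite !mulr_ge0// (dl_M hf).
have := mulr_ge0 M0 (normr_ge0 z).
have := mulr_ge0 (normr_ge0 k) (normr_ge0 (f z)).
by move=> h1 h2 h3; lra.
Qed.

(** The base is 2 times 16, so that the weights stay summable after the factor 16^k of
    [tail_factor]. *)
Let w (n : nat) : R := 32^-1 ^+ n.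

Let w_gt0 n : 0 < w n. Proof. by rewrite exprn_gt0// invr_gt0. Qed.

(** If infinitely many indices were bad, one could sum y = S_0 z_0 + S_1 z_1 + ... with z_n making
    the value at the partial sum s_(n+1) huge. The fourth hypothesis bounds what the tail y -
    s_(n+1) adds, so the value at y is huge as well, against [tri_estimate] at y. *)
Lemma gliding_hump (v c : nat -> B) (S : nat -> B -> B) :
  (forall n, inJ (v n) /\ inJ (c n)) ->
  (forall n z, inJ z -> inJ (S n z) /\ `|S n z| <= `|z|) ->
  (forall n r z, S n (r *: z) = r *: S n z) ->
  (forall n, exists C : R, forall (z : nat -> B) t,
    (forall k, inJ (z k) /\ `|z k| <= w k) ->
    (fun m => \sum_(n.+1 <= k < m) S k (z k)) @ \oo --> t ->
    `|f (tri (v n) t (c n))| <= C) ->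
  exists N, forall n, (N <= n)%N ->
    bddJ (fun z => f (tri (v n) (S n z) (c n))).
Proof.
move=> vcJ SJ SZ /choice[C hC].
have /choice[kap hkap] n : exists k : R, forall z, inJ z ->
    `|f (tri (v n) z (c n))| <= k * (`|f z| + `|z|).
  by have [vJ cJ] := vcJ n; exact: tri_estimate.
apply: contrapT => /forallNP hN.
pose bad n := ~ bddJ (fun z => f (tri (v n) (S n z) (c n))).
have bad_ex N : exists2 n, (N <= n)%N & bad n.
  by have := hN N; move=> /existsNP[n /not_implyP[Nn nb]]; exists n.
(* [C n] covers the tail, and the first term beats kap_n (|f y| + |y|) once n exceeds |f y| + |y|, a
   number unknown while the z_n are chosen. *)
pose L n := `|kap n| * n%:R + C n + 1.
(* The choice depends on the partial sum [ns.2] built so far; at an index that is not bad, 0 is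
   harmless. *)
have /choice[pick pickP] (ns : nat * B) : exists z, [/\ inJ z, `|z| <= w ns.1 &
    bad ns.1 -> inJ ns.2 ->
      L ns.1 <= `|f (tri (v ns.1) (ns.2 + S ns.1 z) (c ns.1))|].
  case: ns => n s /=; have [bn|nbn] := pselect (bad n); last first.
    by exists 0; split=> //; [exact: inJ0|rewrite normr0 ltW].
  pose D := (`|L n| + `|f (tri (v n) s (c n))|) / w n.
  have [z [zJ hz]] : exists z, inJ z /\
      D * `|z| < `|f (tri (v n) (S n z) (c n))|.
    apply: contrapT => h; apply: bn; exists D => z zJ.
    by rewrite leNgt; apply/negP => ?; apply: h; exists z.
  have z0 : z != 0.
    apply: contraTneq hz => ->.
    have := SZ n 0 0; rewrite !scale0r => ->.
    by rewrite tri0 (dl_0 hf) !normr0 mulr0 ltxx.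
  have nz : 0 < `|z| by rewrite normr_gt0.
  pose r := w n / `|z|; have r0 : 0 < r by rewrite divr_gt0.
  exists (r *: z); split; first exact: inJZ.
    by rewrite normrZ gtr0_norm// divfK ?gt_eqF.
  move=> _ _; rewrite SZ triD (dl_additive hf) triZ (dl_scale hf).
  set y := f (tri _ s _) in D hz *; set u := f (tri _ _ _) in hz *.
  have h1 : `|r *: u| <= `|y + r *: u| + `|y|.
    by rewrite -{1}(addKr y (r *: u)) addrC (le_trans (ler_normB _ _)).
  have h2 : r * (D * `|z|) <= `|r *: u|.
    by rewrite normrZ gtr0_norm// ler_wpM2l ?ltW.
  have h3 : r * (D * `|z|) = `|L n| + `|y|.
    by rewrite /r /D; field; rewrite !gt_eqF.
  by have := ler_norm (L n); move: h1 h2; rewrite h3; lra.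
pose s := fix s n := if n is n'.+1 then s n' + S n' (pick (n', s n')) else 0.
pose z n := pick (n, s n).
have zP n : inJ (z n) /\ `|z n| <= w n by have [] := pickP (n, s n).
have sS n : s n.+1 = s n + S n (z n) by [].
have sJ n : inJ (s n).
  elim: n => [|n IH]; first exact: inJ0.
  by rewrite sS; apply: inJD => //; have [] := SJ n _ (zP n).1.
have [y [sy _]] : exists y : B, s @ \oo --> y /\
    forall n, `|y - s n| <= 0 - (- (2 * w n)).
  apply: cvg_majorant => n; last by rewrite oppr_le0 mulr_ge0// ltW.
  rewrite sS addrC addKr; have [zJ zn] := zP n.
  rewrite (le_trans (SJ n _ zJ).2)// (le_trans zn)//.
  have : w n.+1 = w n / 32 by rewrite /w exprSr.
  by move: (w_gt0 n) => h1 ->; lra.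
have yJ : inJ y by exact: inJ_closed sy sJ.
pose T := `|f y| + `|y|.
have [n nT bn] := bad_ex (Num.truncn T).+1.
have Tn : T <= n%:R.
  by rewrite ltW// (lt_le_trans (truncnS_gt T))// ler_nat.
have [_ _ /(_ bn (sJ n))] := pickP (n, s n); rewrite /= -/(z n) -sS => hL.
have tailn : (fun m => \sum_(n.+1 <= k < m) S k (z k)) @ \oo --> y - s n.+1.
  have e m : (n < m)%N -> \sum_(n.+1 <= k < m) S k (z k) = s m - s n.+1.
    by move=> nm; rewrite -telescope_sumr//; apply: eq_bigr => k _;
      rewrite sS addrC addKr.
  apply: cvg_trans (_ : (fun m => s m - s n.+1) @ \oo --> _); last first.
    by apply: cvgB => //; exact: cvg_cst.
  apply: near_eq_cvg; near=> m; rewrite e//.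
  by near: m; exists n.+1.
have h1 := hC n z _ zP tailn.
have h2 := hkap n y yJ.
have h3 : `|f (tri (v n) (s n.+1) (c n))| <=
    `|f (tri (v n) y (c n))| + `|f (tri (v n) (y - s n.+1) (c n))|.
  have -> : f (tri (v n) (s n.+1) (c n)) =
      f (tri (v n) y (c n)) - f (tri (v n) (y - s n.+1) (c n)).
    by rewrite -(dl_opp hf) -(dl_additive hf); congr f; rewrite /tri; nc_ring.
  exact: ler_normB.
have h4 : kap n * T <= `|kap n| * n%:R.
  rewrite (@le_trans _ _ (`|kap n| * T))//; last exact: ler_wpM2l.
  by rewrite ler_wpM2r ?addr_ge0// ler_norm.
by move: hL h1 h2 h3 h4; rewrite /L -/T; lra.
Unshelve. all: by end_near. Qed.

End GlidingHump.

(** * The first two humps along an orthogonal sequence *)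

Section OrthogonalSequence.
Context {R : realType} {A : cstarAlgType R}.
Local Notation B := (unitization A).
Implicit Types (x y z t : B) (r : R).

Variables (X : normedModType R) (f : B -> X) (P Q : B -> B -> X -> X) (M : R).
Hypothesis hf : deriv_like f P Q M.

Variable a : nat -> B.
Hypothesis aJ : forall n, inJ (a n).
Hypothesis an : forall n, `|a n| <= 2^-1.
Hypothesis aorth : forall i j, i != j -> a i * a j = 0.

Lemma tail_zero x y (F : nat -> B) n t :
  (forall k, (n < k)%N -> tri x (F k) y = 0) ->
  (fun m => \sum_(n.+1 <= k < m) F k) @ \oo --> t -> tri x t y = 0.
Proof.
move=> hF Ft.
apply: (@cvg_seq_unique _ _ (fun m => tri x (\sum_(n.+1 <= k < m) F k) y)).
  exact: cvg_tri.
have -> : (fun m => tri x (\sum_(n.+1 <= k < m) F k) y) = (fun=> 0).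
  apply/funext => m; rewrite tri_sum big_nat_cond big1// => k.
  by rewrite andbT => /andP[nk _]; exact: hF.
exact: cvg_cst.
Qed.

Lemma norm_tri_le x z y : `|x| <= 2^-1 -> `|y| <= 1 -> `|tri x z y| <= `|z|.
Proof.
move=> hx hy; rewrite (le_trans (norm_tri _ _ _))//.
have h := ler_pM (normr_ge0 _) (normr_ge0 _) hx hy.
have := ler_wpM2l (normr_ge0 z) h => h1.
have -> : 2 * (`|x| * `|z| * `|y|) = 2 * (`|z| * (`|x| * `|y|)) by ring.
by move: h1; set u := `|z| * (_ * _); lra.
Qed.

(** For S_n = {a_n, ., a_n} orthogonality annihilates the tail, and a second application of {a_n, .,
    a_n} yields 4 a_n^2 z a_n^2. *)
Lemma bddJ_corner : exists N, forall n, (N <= n)%N ->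
  bddJ (fun z => f (a n * a n * z * (a n * a n))).
Proof.
have [//||n r z|n|N hN] := @gliding_hump _ _ _ f P Q M hf a a
  (fun n z => tri (a n) z (a n)).
- move=> n z zJ; split; first exact: inJ_tri.
  by apply: norm_tri_le => //; apply: (le_trans (an n)); lra.
- exact: triZ.
- exists 0 => z t _ ht; rewrite (tail_zero _ ht) ?(dl_0 hf) ?normr0// => k nk.
  have h1 : a n * a k = 0 by apply: aorth; rewrite neq_ltn nk.
  have h2 : a k * a n = 0 by apply: aorth; rewrite neq_ltn nk orbT.
  rewrite /tri.
  have -> : a n * (a k * z k * a k + a k * z k * a k) * a n +
    a n * (a k * z k * a k + a k * z k * a k) * a n =
    (a n * a k * z k * a k * a n) *+ 4 by nc_ring.
  by rewrite h1 !mul0r mul0rn.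
exists N => n /hN h.
apply: (bddJ_eq _ (bddJZ 4^-1 h)) => z _; rewrite -(dl_scale hf); congr f.
have -> : tri (a n) (tri (a n) z (a n)) (a n)
    = (a n * a n * z * (a n * a n)) *+ 4 by rewrite /tri; nc_ring.
set y := a n * a n * z * _.
by rewrite -[y *+ 4]scaler_nat scalerA mulVf ?pnatr_eq0// scale1r.
Qed.

(** Here e_n is the sum of the a_k / 4^k over k >= n: orthogonal to the earlier a_j, yet still
    seeing each later one through its square. *)
Lemma weighted_tails : exists e : nat -> B, forall n, [/\ inJ (e n), `|e n| <= 1,
  forall j, (j < n)%N -> a j * e n = 0 &
  forall j, (n <= j)%N -> a j * e n = 4^-1 ^+ j *: (a j * a j)].
Proof.
pose u n m := \sum_(n <= k < m) 4^-1 ^+ k *: a k.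
have q0 k : 0 < 4^-1 ^+ k :> R by rewrite exprn_gt0// invr_gt0.
have uS n m : (n <= m)%N -> u n m.+1 = u n m + 4^-1 ^+ m *: a m.
  by move=> nm; rewrite /u big_nat_recr.
have u0 n m : (m <= n)%N -> u n m = 0 by move=> mn; rewrite /u big_geq.
have uJ n m : inJ (u n m).
  by rewrite /u; elim/big_ind: _ => *; [exact: inJ0|exact: inJD|exact: inJZ].
have /choice[e he] n : exists e : B, u n @ \oo --> e /\
    forall m, `|e - u n m| <= 0 - (- 4^-1 ^+ m).
  apply: cvg_majorant => m; last by rewrite oppr_le0 ltW.
  have qS : 4^-1 ^+ m.+1 = 4^-1 ^+ m / 4 :> R by rewrite exprSr.
  have [nm|mn] := leqP n m.
    rewrite uS// addrC addKr normrZ gtr0_norm//.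
    have := ler_wpM2l (ltW (q0 m)) (an m).
    by rewrite qS; move: (q0 m) => h1 h2; lra.
  rewrite !u0// ?subrr ?normr0 1?ltnW// qS.
  by move: (q0 m) => h1; lra.
have lim0 j n : (j < n)%N -> forall m, a j * u n m = 0.
  move=> jn m; rewrite /u mulr_sumr big_nat_cond big1// => k.
  rewrite andbT => /andP[nk _]; rewrite -(scalerAr (4^-1 ^+ k)) aorth ?scaler0//.
  by rewrite neq_ltn (leq_trans jn nk).
have lim1 j n : (n <= j)%N -> forall m, (j < m)%N ->
    a j * u n m = 4^-1 ^+ j *: (a j * a j).
  move=> nj m jm; rewrite /u (big_cat_nat (leqW nj) jm) /=.
  rewrite big_nat_recr//= !mulrDr -/(u j.+1 m) lim0// addr0.
  rewrite -(scalerAr (4^-1 ^+ j)) mulr_sumr big_nat_cond big1 ?add0r// => k.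
  rewrite andbT => /andP[_ kj]; rewrite -(scalerAr (4^-1 ^+ k)) aorth ?scaler0//.
  by rewrite neq_ltn kj orbT.
exists e => n; have [ue eb] := he n.
have aue j : (fun m => a j * u n m) @ \oo --> a j * e n.
  by apply: cvg_umul => //; exact: cvg_cst.
split.
- exact: inJ_closed ue (uJ n).
- by have := eb 0; rewrite u0// subr0 expr0 opprK add0r.
- move=> j jn; apply: (cvg_seq_unique (aue j)).
  have -> : (fun m => a j * u n m) = (fun=> 0) by apply/funext; exact: lim0.
  exact: cvg_cst.
- move=> j nj; apply: (cvg_seq_unique (aue j)).
  have cv : (fun _ : nat => 4^-1 ^+ j *: (a j * a j)) @ \oo -->
      4^-1 ^+ j *: (a j * a j) by exact: cvg_cst.
  apply: cvg_trans cv.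
  apply: near_eq_cvg; near=> m; rewrite lim1//.
  by near: m; exact: nbhs_infty_gt.
Unshelve. all: by end_near. Qed.

Variable e : nat -> B.
Hypothesis he : forall n, [/\ inJ (e n), `|e n| <= 1,
  forall j, (j < n)%N -> a j * e n = 0 &
  forall j, (n <= j)%N -> a j * e n = 4^-1 ^+ j *: (a j * a j)].

Let ea j n : (j < n)%N -> e n * a j = 0.
Proof.
move=> jn; have [[_ es] _ /(_ j jn) h _] := he n; have [_ as_] := aJ j.
exact: usaM0.
Qed.

Let ae j n : (j < n)%N -> a j * e n = 0.
Proof. by have [_ _ h _] := he n; exact: h. Qed.

(** The index n + 1 makes [e n.+1] orthogonal to a_n. This kills the tail and also the cross terms
    in {a_n, {a_n, z, e}, e}, leaving {a_n^2, z, e^2}. *)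
Lemma bddJ_offdiag : exists N, forall n, (N <= n)%N ->
  bddJ (fun z => f (tri (a n * a n) z (e n.+1 * e n.+1))).
Proof.
have [||n r z|n|N hN] := @gliding_hump _ _ _ f P Q M hf a (fun n => e n.+1)
  (fun n z => tri (a n) z (e n.+1)).
- by move=> n; have [] := he n.+1.
- move=> n z zJ; have [eJ e1 _ _] := he n.+1; split; first exact: inJ_tri.
  exact: norm_tri_le.
- exact: triZ.
- exists 0 => z t _ ht; rewrite (tail_zero _ ht) ?(dl_0 hf) ?normr0// => k nk.
  have h1 : a n * a k = 0 by apply: aorth; rewrite neq_ltn nk.
  have h2 : a k * a n = 0 by apply: aorth; rewrite neq_ltn nk orbT.
  have h3 := ae (ltnW nk : (n < k.+1)%N); have h4 := ea (ltnW nk : (n < k.+1)%N).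
  rewrite /tri.
  have -> : a n * (a k * z k * e k.+1 + e k.+1 * z k * a k) * e n.+1 +
    e n.+1 * (a k * z k * e k.+1 + e k.+1 * z k * a k) * a n =
    (a n * a k) * (z k * e k.+1 * e n.+1) + (a n * e k.+1) * (z k * a k * e n.+1)
    + e n.+1 * a k * z k * (e k.+1 * a n) + e n.+1 * e k.+1 * z k * (a k * a n).
    by nc_ring.
  by rewrite h1 h2 h3 h4 !mul0r !mulr0 !addr0.
exists N => n /hN; apply: bddJ_eq => z _; congr f; rewrite /tri.
have -> : a n * (a n * z * e n.+1 + e n.+1 * z * a n) * e n.+1 +
    e n.+1 * (a n * z * e n.+1 + e n.+1 * z * a n) * a n
  = a n * a n * z * (e n.+1 * e n.+1) + e n.+1 * e n.+1 * z * (a n * a n)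
   + (a n * e n.+1) * (z * a n * e n.+1) + e n.+1 * a n * z * (e n.+1 * a n).
  by nc_ring.
by rewrite ae// ea// mul0r mulr0 !addr0.
Qed.

(** Since v^2 g^2 = 16^-k v^4, the product with v^4 can be traded for one with g^2 at the price
    16^k. The right-hand side contains the operator {u^2, ., g^2} of [bddJ_offdiag], which does not
    depend on k, while c stays arbitrary. *)
Lemma tail_factor n k z c : (n < k)%N ->
  let u := a n in let v := a k in let g := e n.+1 in
  tri (u * u * u * u * u * u) (tri (v * v) (v * v) z) c =
  tri (u * u * u * u)
    (tri (u * u) (16 ^+ k *: (z * (v * v) + v * v * z)) (g * g)) c.
Proof.
move=> nk /=; have [_ _ _ /(_ k nk) ve] := he n.+1.
have [[_ gs] _ _ _] := he n.+1; have [_ vs] := aJ k.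
have h1 : a n * a k = 0 by apply: aorth; rewrite neq_ltn nk.
have h2 : a k * a n = 0 by apply: aorth; rewrite neq_ltn nk orbT.
have h3 := ae (ltnSn n); have h4 := ea (ltnSn n).
have ev : e n.+1 * a k = 4^-1 ^+ k *: (a k * a k).
  by rewrite -[e n.+1 * a k]ustarK ustarM vs gs ve ustarZ ustarM vs.
move: (a n) (a k) (e n.+1) h1 h2 h3 h4 ve ev => u v g h1 h2 h3 h4 vg gv.
have q1 : 4^-1 ^+ k * 4^-1 ^+ k * 16 ^+ k = 1 :> R.
  by rewrite -!exprMn (_ : _ * _ = 1) ?expr1n//; field.
have vvgg : v * v * (g * g) = (4^-1 ^+ k * 4^-1 ^+ k) *: (v * v * (v * v)).
  rewrite mulrA -(mulrA v v g) vg -(scalerAr (4^-1 ^+ k)) -(scalerAl (4^-1 ^+ k)).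
  rewrite -!(mulrA v) vg -!(scalerAr (4^-1 ^+ k)) scalerA.
  by rewrite !mulrA.
have ggvv : g * g * (v * v) = (4^-1 ^+ k * 4^-1 ^+ k) *: (v * v * (v * v)).
  rewrite mulrA -(mulrA g g v) gv -(scalerAr (4^-1 ^+ k)) -(scalerAl (4^-1 ^+ k)).
  rewrite (mulrA g v v) gv -!(scalerAl (4^-1 ^+ k)) scalerA.
  by rewrite !mulrA.
rewrite !triZ.
have -> : tri (u * u) (z * (v * v) + v * v * z) (g * g)
    = u * u * z * (v * v * (g * g)) + (g * g * (v * v)) * z * (u * u)
     + u * (u * v) * (v * z * (g * g)) + (g * g * z * v) * (v * u) * u.
  by rewrite /tri; nc_ring.
rewrite h1 h2 vvgg ggvv mulr0 !mul0r !addr0 mulr0 mul0r addr0.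
rewrite -(scalerAr (4^-1 ^+ k * 4^-1 ^+ k)) -!(scalerAl (4^-1 ^+ k * 4^-1 ^+ k)).
rewrite -scalerDr triZ scalerA mulrC q1 scale1r.
have -> : tri (u * u * u * u * u * u) (tri (v * v) (v * v) z) c =
    u * u * u * u * u * (u * v) * (v * v * v * z * c)
    + u * u * u * u * u * u * z * (v * v * v * v) * c
    + c * (v * v * v * v) * z * (u * u * u * u * u * u)
    + (c * z * v * v * v) * (v * u) * (u * u * u * u * u).
  by rewrite /tri; nc_ring.
rewrite h1 h2 !mulr0 !mul0r !addr0 add0r.
have -> : tri (u * u * u * u)
   (u * u * z * (v * v * (v * v)) + v * v * (v * v) * z * (u * u)) c =
    u * u * u * (u * v) * (v * v * v * z * (u * u) * c)
    + u * u * u * u * u * u * z * (v * v * v * v) * c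
    + c * (v * v * v * v) * z * (u * u * u * u * u * u)
    + c * (u * u * z * v * v * v) * (v * u) * (u * u * u).
  by rewrite /tri; nc_ring.
by rewrite h1 h2 !mulr0 !mul0r !addr0 add0r.
Qed.

End OrthogonalSequence.

(** * The third hump and the boundedness of the derivation *)

Section DerivationBounded.
Context {R : realType} {A : cstarAlgType R}.
Local Notation B := (unitization A).
Implicit Types (x y z t u : B) (r : R).

Variables (X : normedModType R) (f : B -> X) (P Q : B -> B -> X -> X) (M : R).
Hypothesis hf : deriv_like f P Q M.

Lemma inJ_exp u n : inJ u -> inJ (u ^+ n.+1).
Proof.
move=> [u0 us]; elim: n => [|n [IH1 IH2]]; first by rewrite expr1.
rewrite exprS; split; first by rewrite uscalM u0 mul0r.
by apply: usaM => //; rewrite -exprS -exprSr.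
Qed.

Lemma orth_contJ (a : nat -> B) : (forall n, inJ (a n)) ->
  (forall n, `|a n| <= 2^-1) -> (forall i j, i != j -> a i * a j = 0) ->
  exists n, contJ f (a n ^+ 10).
Proof.
move=> aJ an aorth; have [e he] := weighted_tails aJ an aorth.
have [N1 hN1] := bddJ_corner hf aJ an aorth.
have [N2 hN2] := bddJ_offdiag hf aJ an aorth he.
pose N0 := maxn N1 N2.
pose v n := if (N0 <= n)%N then a n ^+ 6 else 0.
pose S n z := tri (a n * a n) (a n * a n) z.
(* The hump lemma treats one c per index, so [c n] is a counterexample whenever there is one:
   boundedness for it gives boundedness for all. *)
have /choice[c cP] n : exists c : B, inJ c /\
    (bddJ (fun z => f (tri (v n) (S n z) c)) -> forall c', inJ c' ->
     bddJ (fun z => f (tri (v n) (S n z) c'))).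
  have [h|/existsNP[c /not_implyP[cJ nc]]] := pselect (forall c', inJ c' ->
     bddJ (fun z => f (tri (v n) (S n z) c'))).
    by exists 0; split=> //; exact: inJ0.
  by exists c; split=> // /nc.
have aaJ n : inJ (a n * a n) by exact: inJ_sq.
have aan n : `|a n * a n| <= 4^-1.
  rewrite (le_trans (norm_umul _ _))//.
  have := ler_pM (normr_ge0 _) (normr_ge0 _) (an n) (an n).
  by have -> : 2^-1 * 2^-1 = 4^-1 :> R by field.
have Sn n z : `|S n z| <= `|z|.
  rewrite /S (le_trans (norm_tri _ _ _))//.
  have := ler_pM (normr_ge0 _) (normr_ge0 _) (aan n) (aan n) => h.
  have := ler_wpM2r (normr_ge0 z) h => h1.
  by have := normr_ge0 z; lra.
have [||n r z|n|N3 hN3] := @gliding_hump _ _ _ f P Q M hf v c S.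
- move=> n; have [cJ _] := cP n; split=> //; rewrite /v; case: ifP => _.
    exact: inJ_exp.
  exact: inJ0.
- by move=> n z zJ; split; [exact: inJ_tri|exact: Sn].
- by rewrite /S /tri -!(scalerAr r) -!(scalerAl r) scalerDr.
- rewrite /v; case: ifP => [nN0|_]; last first.
    by exists 0 => z t _ _; rewrite /tri !mul0r !mulr0 addr0 (dl_0 hf) normr0.
  have [cJ _] := cP n.
  have [gJ g1 _ _] := he n.+1; have ggJ := inJ_sq gJ.
  have off := hN2 n (leq_trans (leq_maxr _ _) nN0).
  have opU : opJ (fun z => tri (a n * a n) z (e n.+1 * e n.+1)).
    by apply: (opJ_tri (U := id)) => //; exact: opJ_id.
  have [C hC] := bddJ_tri hf (inJ_exp 3 (aJ n)) cJ opU off.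
  exists `|C| => z t hz ht.
  (* By [tail_factor] the tail becomes a value at the sum w of the [F k]; these are of size 2^-k /
     2, so |w| <= 1 whatever the z_k, and the bound depends on n alone. *)
  pose F k := 16 ^+ k *: (z k * (a k * a k) + a k * a k * z k).
  have FJ k : inJ (F k).
    by apply/inJZ/inJ_comm; [exact: (hz k).1|exact: (aaJ k).2].
  have Fn k : `|F k| <= 2^-1 * 2^-1 ^+ k.
    have [_ zk] := hz k; rewrite normrZ gtr0_norm ?exprn_gt0//.
    have h1 : `|z k * (a k * a k) + a k * a k * z k| <= 2^-1 * 32^-1 ^+ k.
      rewrite (le_trans (ler_normD _ _))//.
      rewrite (le_trans (lerD (norm_umul _ _) (norm_umul _ _)))//.
      have := ler_pM (normr_ge0 _) (normr_ge0 _) zk (aan k).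
      by set s := 32^-1 ^+ k; lra.
    rewrite (le_trans (ler_wpM2l _ h1)) ?exprn_ge0//.
    have -> : 2^-1 = 16 * 32^-1 :> R by field.
    by rewrite exprMn mulrCA.
  pose W m := \sum_(n.+1 <= k < m) F k.
  have WJ m : inJ (W m).
    by rewrite /W; elim/big_ind: _ => *; [exact: inJ0|exact: inJD|].
  have W0 m : (m <= n.+1)%N -> W m = 0 by move=> mn; rewrite /W big_geq.
  have [w [Ww wb]] : exists w : B, W @ \oo --> w /\
      forall m, `|w - W m| <= 0 - (- 2^-1 ^+ m).
    apply: cvg_majorant => m; last by rewrite oppr_le0 exprn_ge0// invr_ge0.
    have -> : - 2^-1 ^+ m.+1 - - 2^-1 ^+ m = 2^-1 * 2^-1 ^+ m :> R.
      by rewrite exprS; field.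
    have [nm|mn] := leqP n.+1 m.
      have -> : W m.+1 = W m + F m by rewrite /W big_nat_recr.
      by rewrite [W m + F m]addrC addrK.
    by rewrite !W0// 1?ltnW// subrr normr0 mulr_ge0 ?exprn_ge0// invr_ge0.
  have wJ : inJ w by exact: inJ_closed Ww WJ.
  have w1 : `|w| <= 1.
    by have := wb 0; rewrite W0// subr0 expr0 sub0r opprK.
  have -> : tri (a n ^+ 6) t (c n) = tri (a n ^+ 4)
      (tri (a n * a n) w (e n.+1 * e n.+1)) (c n).
    apply: (@cvg_seq_unique _ _ (fun m => tri (a n ^+ 6)
      (\sum_(n.+1 <= k < m) S k (z k)) (c n))); first exact: cvg_tri.
    have -> : (fun m => tri (a n ^+ 6) (\sum_(n.+1 <= k < m) S k (z k)) (c n))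
      = (fun m => tri (a n ^+ 4) (tri (a n * a n) (W m) (e n.+1 * e n.+1)) (c n)).
      apply/funext => m; rewrite /W !tri_sum big_nat_cond [RHS]big_nat_cond.
      apply: eq_bigr => k; rewrite andbT => /andP[nk _].
      have := tail_factor aJ aorth he (z k) (c n) nk; rewrite /= -/(F k).
      have -> : a n * a n * a n * a n * a n * a n = a n ^+ 6 by nc_ring.
      by have -> : a n * a n * a n * a n = a n ^+ 4 by nc_ring.
    by apply: cvg_tri; exact: cvg_tri.
  rewrite (le_trans (hC w wJ))// (le_trans (ler_wpM2r _ (ler_norm C)))//.
  by rewrite -[leRHS]mulr1 ler_wpM2l.
pose n := maxn N0 N3; exists n.
have nN1 : (N1 <= n)%N by rewrite !leq_max leqnn.
have nN0 : (N0 <= n)%N by rewrite leq_max leqnn.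
have nN3 : (N3 <= n)%N by rewrite leq_max leqnn orbT.
split=> [|c' c'J]; first exact: inJ_exp.
have h1 := (cP n).2 (hN3 n nN3) c' c'J; rewrite /v nN0 in h1.
set u := a n in h1 *; have uJ : inJ u by exact: aJ.
pose V z := u * u * z * (u * u).
have opV : opJ V.
  split=> [z zJ|]; first by apply: inJ_conj => //; exact: (aaJ n).2.
  exists 1 => z _; rewrite mul1r /V (le_trans (norm_umul _ _))//.
  have hu := aan n; rewrite -/u in hu.
  have h := ler_pM (normr_ge0 _) (normr_ge0 _) (norm_umul (u * u) z) hu.
  rewrite (le_trans h)//.
  have := ler_wpM2r (normr_ge0 z) hu.
  by move: (normr_ge0 z) => h2 h3; lra.
have opVV : opJ (fun z => V (V z)).
  have [VJ [k hk]] := opV; split=> [z zJ|]; first by apply/VJ/VJ.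
  exists (`|k| * `|k|) => z zJ; rewrite (le_trans (hk _ (VJ _ zJ)))//.
  rewrite (le_trans (ler_wpM2r _ (ler_norm k)))// -mulrA ler_wpM2l//.
  by rewrite (le_trans (hk _ zJ))// ler_wpM2r// ler_norm.
have bVV : bddJ (fun z => f (V (V z))).
  exact: (bddJ_comp opV (hN1 n nN1)).
(* Expanding {a^6, {a^2, a^2, z}, c'} gives {a^10, z, c'} plus {a^2, a^4 z a^4, c'}; the latter is
   bounded by the first hump, which explains the exponent 10. *)
have h2 := bddJ_tri hf (aaJ n) c'J opVV bVV.
apply: (bddJ_eq _ (bddJD h1 (bddJZ (-1) h2))) => z _.
rewrite scaleN1r -(dl_opp hf) -(dl_additive hf); congr f.
by rewrite /S /V -/u /tri; nc_ring.
Qed.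

Let cI := contI_ideal hf.

Lemma noorth_contI (a : nat -> B) : (forall n, usa (a n)) ->
  (forall i j, i != j -> a i * a j = 0) -> exists n, contI f (a n).
Proof.
move=> as_ aorth.
(* Scalar parts are multiplicative, so at most one of the orthogonal elements has a nonzero one; the
   shift skips it. *)
have [s hs] : exists s, forall n, uscal (a (n + s)%N) = 0.
  have [h|/existsNP[i /eqP hi]] := pselect (forall n, uscal (a n) = 0).
    by exists 0.
  exists i.+1 => n; have /aorth h : i != (n + i.+1)%N.
    by rewrite neq_ltn addnS ltnS leq_addl.
  have /eqP := congr1 uscal h; rewrite uscalM mulf_eq0 => /orP[|/eqP//].
  by move/eqP => h0; case/eqP: hi.
pose rho n : R := (2 * (1 + `|a (n + s)%N|))^-1.
have rho0 n : 0 < rho n by rewrite invr_gt0 mulr_gt0// ltr_pwDl.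
pose b n := rho n *: a (n + s)%N.
have bJ n : inJ (b n) by apply: inJZ.
have bn n : `|b n| <= 2^-1.
  rewrite normrZ gtr0_norm// /rho invfM -mulrA ler_piMr ?invr_ge0//.
  by rewrite mulrC ler_pdivrMr ?ltr_pwDl// mul1r lerDr.
have borth i j : i != j -> b i * b j = 0.
  by move=> ij; rewrite uscaleM aorth ?scaler0// eqn_add2r.
have [n hn] := orth_contJ bJ bn borth; exists (n + s)%N.
have bs : usa (b n) by case: (bJ n).
have bsX k : usa (b n ^+ k.+1) by case: (inJ_exp k (bJ n)).
apply: (@uidealZr _ _ _ cI (rho n)); first by rewrite gt_eqF.
(* The exponent descends by extracting square roots, multiplying once by [b n] when it is odd: 10,
   5, 6, 3, 4, 2, 1. *)
rewrite -/(b n); have h10 := contI_J hf hn.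
have h5 : contI f (b n ^+ 5) by apply: (uideal_sq cI) => //; rewrite -exprD.
have h3 : contI f (b n ^+ 3).
  apply: (uideal_sq cI) => //; rewrite -exprD.
  have -> : b n ^+ (3 + 3) = b n * b n ^+ 5 by rewrite -exprS.
  exact: (uidealMl cI).
apply: (uideal_sq cI) => //; apply: (uideal_sq cI); first exact: usa_sq.
have -> : b n * b n * (b n * b n) = b n * b n ^+ 3 by nc_ring.
exact: (uidealMl cI).
Qed.

Lemma contJ_bounded : exists C, forall y, contJ f y -> `|f y| <= C * `|y|.
Proof.
apply: contrapT => /forallNP h.
pose t n : R := 2^-1 ^+ n.
have t0 n : 0 < t n by rewrite exprn_gt0// invr_gt0.
have /choice[y hy] n : exists y, [/\ contJ f y, `|y| <= t n ^+ 4 &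
    n%:R <= `|f y|].
  pose D := n%:R / t n ^+ 4.
  have /existsNP[y /not_implyP[yJ /negP]] := h D; rewrite -ltNge => hy.
  have y0 : y != 0.
    by apply: contraTneq hy => ->; rewrite (dl_0 hf) !normr0 mulr0 ltxx.
  have ny : 0 < `|y| by rewrite normr_gt0.
  have r0 : 0 < t n ^+ 4 / `|y| by rewrite divr_gt0// exprn_gt0.
  exists ((t n ^+ 4 / `|y|) *: y); split; first exact: (contJZ hf).
    by rewrite normrZ gtr0_norm// divfK ?gt_eqF.
  rewrite (dl_scale hf) normrZ gtr0_norm//.
  have := ler_wpM2l (ltW r0) (ltW hy); congr (_ <= _).
  by rewrite /D; field; rewrite !gt_eqF.
have [n|g [c [gs Kg hc yE]]] := factorization cI (y := y).
  have [yJ yn _] := hy n; split=> //; first by case: yJ => -[].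
  exact: (contI_J hf).
have gJ : contJ f g by exact: (contI_usa hf).
have [C hC] := gJ.2 g gJ.1.
have ub n : n%:R <= `|C| * 5.
  have [_ _ hn] := hy n; apply: (le_trans hn); have [cs Kc c5] := hc n.
  have cJ : inJ (c n) by case: (contI_usa hf cs Kc).
  have := hC _ cJ.
  have -> : tri g (c n) g = 2%:R *: y n.
    by rewrite scaler_nat mulr2n {1 2}yE.
  rewrite (dl_scale hf) normrZ ger0_norm// => h1.
  have h2 : C * `|c n| <= `|C| * 5.
    by rewrite (le_trans (ler_wpM2r _ (ler_norm C)))// ler_wpM2l.
  by have := normr_ge0 (f (y n)); lra.
have := ub (Num.truncn (`|C| * 5)).+1.
by rewrite leNgt truncnS_gt.
Qed.

Theorem deriv_like_bounded : exists C, forall x, `|f x| <= C * `|x|.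
Proof.
apply: (finite_codim_bounded cI (dl_linear hf)); last exact: noorth_contI.
have [C hC] := contJ_bounded; exists (`|C| * 2) => x Kx; have [x1 x2] := Kx.
have x0 : uscal x = 0.
  have [h1 _] := contJ_inJ x1; have [h2 _] := contJ_inJ x2.
  move: h1 h2; rewrite uscalM !uscalD /= => h1 /eqP.
  have /negPf i0 : 'i%C != 0 :> R[i] by rewrite eq_complex /= oner_eq0 andbF.
  rewrite mulf_eq0 i0 /= subr_eq0 => /eqP h2; move: h1; rewrite -h2.
  by move/eqP; rewrite -mulr2n mulrn_eq0 => /eqP.
have pE : projJ x = 2^-1 *: (x + ustar x).
  by rewrite /projJ; congr (_ *: (_ + _)); [|congr ustar]; apply: unitization_eqP.
rewrite (dl_proj hf) (le_trans (hC _ _))//; first by rewrite pE; exact: (contJZ hf).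
rewrite (le_trans (ler_wpM2r _ (ler_norm C)))// -mulrA ler_wpM2l//.
exact: norm_proj.
Qed.

End DerivationBounded.

(** * Triple derivations *)

(** Homogeneity is asked only of norms, so that linear and conjugate linear variables are treated
    alike. *)
Lemma trilinear_bound (K : numFieldType) (E F G X : normedModType K)
    (m : E -> F -> G -> X) :
  (forall r x y z, `|m (r *: x) y z| = `|r| * `|m x y z|) ->
  (forall r x y z, `|m x (r *: y) z| = `|r| * `|m x y z|) ->
  (forall r x y z, `|m x y (r *: z)| = `|r| * `|m x y z|) ->
  continuous3 m ->
  exists2 M : K, 0 <= M & forall x y z, `|m x y z| <= M * `|x| * `|y| * `|z|.
Proof.
move=> m1 m2 m3 mc.
have m10 y z : m 0 y z = 0.
  apply/normr0_eq0; have := m1 0 0 y z.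
  by rewrite scale0r normr0 mul0r.
have m20 x z : m x 0 z = 0.
  apply/normr0_eq0; have := m2 0 x 0 z.
  by rewrite scale0r normr0 mul0r.
have m30 x y : m x y 0 = 0.
  apply/normr0_eq0; have := m3 0 x y 0.
  by rewrite scale0r normr0 mul0r.
have := mc ((0, 0), 0); rewrite /= => /cvgrPdist_lt/(_ 1 ltr01).
rewrite m10 => /nbhs_ballP[e /= e0 he].
have small x y z : `|x| < e -> `|y| < e -> `|z| < e -> `|m x y z| <= 1.
  move=> hx hy hz; apply: ltW; have := he ((x, y), z).
  rewrite /= sub0r normrN; apply; split => /=; last first.
    by rewrite -ball_normE /ball_ /= sub0r normrN.
  by split; rewrite -ball_normE /ball_ /= sub0r normrN.
have d0 : 0 < e / 2 by rewrite divr_gt0.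
have de : e / 2 < e by rewrite ltr_pdivrMr// ltr_pMr// ltr1n.
exists ((e / 2)^-1 ^+ 3) => [|x y z]; first by rewrite exprn_ge0// invr_ge0 ltW.
have [->|x0] := eqVneq x 0; first by rewrite m10 !normr0 mulr0 !mul0r.
have [->|y0] := eqVneq y 0; first by rewrite m20 !normr0 mulr0 !mul0r.
have [->|z0] := eqVneq z 0; first by rewrite m30 !normr0 mulr0.
have nx : 0 < `|x| by rewrite normr_gt0.
have ny : 0 < `|y| by rewrite normr_gt0.
have nz : 0 < `|z| by rewrite normr_gt0.
have sc (V : normedModType K) (v : V) : 0 < `|v| -> `|(e / 2 / `|v|) *: v| < e.
  move=> v0; rewrite normrZ gtr0_norm ?divr_gt0// divfK ?gt_eqF//.
have := small _ _ _ (sc _ x nx) (sc _ y ny) (sc _ z nz).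
rewrite m1 m2 m3 !gtr0_norm ?divr_gt0//.
move=> h; have c0 : 0 < (e / 2)^-1 ^+ 3 * `|x| * `|y| * `|z|.
  do 3!(apply: mulr_gt0 => //).
  by rewrite exprn_gt0// invr_gt0.
have := ler_wpM2l (ltW c0) h; rewrite mulr1; congr (_ <= _).
by field; rewrite !gt_eqF.
Qed.

Lemma bounded_additive_continuous (K : numFieldType) (E X : normedModType K)
    (g : E -> X) (C : K) : (forall x y, g (x - y) = g x - g y) ->
  (forall x, `|g x| <= C * `|x|) -> continuous g.
Proof.
move=> gB gC x; apply/cvgrPdist_lt => e e0.
pose D := `|C| + 1; have D0 : 0 < D by rewrite ltr_wpDl.
have hC z : `|g z| <= D * `|z|.
  have h0 := le_trans (normr_ge0 (g z)) (gC z).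
  rewrite (le_trans (gC z))// -(ger0_norm h0) normrM normr_id ler_wpM2r//.
  by rewrite lerDl.
near=> y; rewrite -gB (le_lt_trans (hC _))// mulrC -ltr_pdivlMr//.
near: y; apply: cvgr_dist_lt; [exact: cvg_id|exact: divr_gt0].
Unshelve. all: by end_near. Qed.

(** * Derivations on the self-adjoint part *)

Section SelfAdjointDerivation.
Context {R : realType} {A : cstarAlgType R}.
Local Notation B := (unitization A).
Local Notation E := (selfAdjoint A).
Implicit Types (a b c : E) (x y z : B) (r : R).

Lemma norm_sa a : `|a| = rnorm (sa_val a).
Proof. by []. Qed.

Lemma proj_sa_subproof x : uelt (projJ x) \in sa_pred.
Proof.
have [_ xs] := inJ_proj x; rewrite inE; apply/eqP.
exact: (congr1 uelt xs).
Qed.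

Definition proj_sa x : E := SelfAdjoint (proj_sa_subproof x).

Lemma projJ_linear : linear (@projJ R A).
Proof.
move=> r x y; rewrite /projJ.
have -> : Unitization 0 (uelt (r *: x + y))
    = r *: Unitization 0 (uelt x) + Unitization 0 (uelt y).
  by apply: unitization_eqP; rewrite /= ?mulr0 ?addr0.
rewrite ustarD ustarZ addrACA -scalerDr [LHS]scalerDr; congr (_ + _).
by rewrite !scalerA [2^-1 * r]mulrC.
Qed.

Lemma proj_sa_linear : linear proj_sa.
Proof.
move=> r x y; apply: sa_val_inj; rewrite sa_valD sa_valZ.
by rewrite [LHS](congr1 uelt (projJ_linear r x y)).
Qed.

Lemma proj_sa_inJ x : inJ x -> sa_val (proj_sa x) = uelt x.
Proof. by move=> xJ; rewrite /= -/(projJ x) -[in RHS](projJ_id xJ). Qed.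

Lemma norm_proj_sa x : inJ x -> `|proj_sa x| <= 2 * `|x|.
Proof. by move=> xJ; rewrite norm_sa proj_sa_inJ// rnorm_uelt. Qed.

Lemma proj_sa_tri x y z : inJ x -> inJ y -> inJ z ->
  proj_sa (tri x y z) = 2%:R *: sa_triple (proj_sa x) (proj_sa y) (proj_sa z).
Proof.
move=> xJ yJ zJ; apply: sa_val_inj; rewrite sa_valZ sa_tripleE /cstar_triple.
rewrite proj_sa_inJ; last exact: inJ_tri.
rewrite sa_cstar !proj_sa_inJ// scalerA rmorph_nat divff ?pnatr_eq0// scale1r.
case: xJ yJ zJ => [x0 _] [y0 _] [z0 _].
by rewrite /= x0 y0 z0 !mul0r !scale0r !add0r.
Qed.

Variables (X : normedModType R) (delta : E -> X)
  (m1 : X -> E -> E -> X) (m2 : E -> X -> E -> X) (m3 : E -> E -> X -> X)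
  (M : R).
Hypotheses (M0 : 0 <= M) (dlin : linear delta)
  (leibniz : forall a b c, delta (sa_triple a b c) =
     m1 (delta a) b c + m2 a (delta b) c + m3 a b (delta c))
  (m1n : forall u a b, `|m1 u a b| <= M * `|u| * `|a| * `|b|)
  (m2n : forall a u b, `|m2 a u b| <= M * `|a| * `|u| * `|b|)
  (m3n : forall a b u, `|m3 a b u| <= M * `|a| * `|b| * `|u|)
  (m2lin : forall a c, linear (fun u => m2 a u c))
  (m2B : forall a a' u c, m2 (a - a') u c = m2 a u c - m2 a' u c).

Lemma sa_derivation_bounded : exists C : R, forall a, `|delta a| <= C * `|a|.
Proof.
pose f x := delta (proj_sa x).
pose P x y u := 2%:R *: m2 (proj_sa x) u (proj_sa y).
pose Q x y u := 2%:R *: m3 (proj_sa x) (proj_sa y) u.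
have dZ r a : delta (r *: a) = r *: delta a.
  have d0 : delta 0 = 0.
    have := dlin 1 0 0; rewrite !scale1r addr0 => h.
    by apply: (addIr (delta 0)); rewrite add0r -h.
  by have := dlin r a 0; rewrite d0 !addr0.
have n2 (u : X) : `|2%:R *: u| = 2 * `|u| by rewrite normrZ ger0_norm.
(* In 8, one factor 2 comes from [tri] being twice the triple product, the other two from
   [norm_proj_sa] in both arguments. *)
have hd : deriv_like f P Q (8 * M).
  split.
  - by rewrite mulr_ge0.
  - by move=> r x y; rewrite /f proj_sa_linear dlin.
  - move=> x; congr delta; apply: sa_val_inj.
    by rewrite [in RHS]proj_sa_inJ//; exact: inJ_proj.
  - move=> x y xJ yJ; set a := proj_sa x; set c := proj_sa y.
    exists (2 * (M * `|delta a| * 2 * `|c| + M * `|a| * 2 * `|delta c|)) => z zJ.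
    rewrite /f /P proj_sa_tri// dZ leibniz -/a -/c -scalerBr n2 -mulrA.
    apply: ler_wpM2l => //; set d := proj_sa z.
    have -> : m1 (delta a) d c + m2 a (delta d) c + m3 a d (delta c)
      - m2 a (delta d) c = m1 (delta a) d c + m3 a d (delta c).
      by rewrite addrAC addrK.
    rewrite (le_trans (ler_normD _ _))//.
    rewrite (le_trans (lerD (m1n _ _ _) (m3n _ _ _)))//.
    have dn := norm_proj_sa zJ; rewrite -/d in dn.
    have k1 : 0 <= M * `|delta a| * `|c| by rewrite !mulr_ge0.
    have k2 : 0 <= M * `|a| * `|delta c| by rewrite !mulr_ge0.
    have := ler_wpM2l k1 dn; have := ler_wpM2l k2 dn; lra.
  - move=> x y xJ yJ; set a := proj_sa x; set c := proj_sa y.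
    exists (2 * (M * `|delta a| * 2 * `|c| + M * `|a| * 2 * `|delta c|)) => z zJ.
    rewrite /f /Q proj_sa_tri// dZ leibniz -/a -/c -scalerBr n2 -mulrA.
    apply: ler_wpM2l => //; set d := proj_sa z; rewrite addrK.
    rewrite (le_trans (ler_normD _ _))//.
    rewrite (le_trans (lerD (m1n _ _ _) (m2n _ _ _)))//.
    have dn := norm_proj_sa zJ; rewrite -/d in dn.
    have k1 : 0 <= M * `|delta a| * `|c| by rewrite !mulr_ge0.
    have k2 : 0 <= M * `|a| * `|delta c| by rewrite !mulr_ge0.
    have := ler_wpM2l k1 dn; have := ler_wpM2l k2 dn; lra.
  - move=> x y r u v; rewrite /P m2lin scalerDr !scalerA.
    by rewrite [_ * r]mulrC.
  - move=> x y z u; rewrite /P -scalerBr -m2B; congr (_ *: m2 _ _ _).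
    have := proj_sa_linear (-1) y x; rewrite !scaleN1r => h.
    by rewrite [x - y]addrC [RHS]addrC -h.
  - move=> x y u xJ yJ; rewrite /P n2.
    have h := ler_pM (normr_ge0 _) (normr_ge0 _) (norm_proj_sa xJ)
      (norm_proj_sa yJ).
    have k : 0 <= 2 * M * `|u| by rewrite !mulr_ge0.
    have := ler_wpM2l k h; have := m2n (proj_sa x) u (proj_sa y); lra.
  - move=> x y u xJ yJ; rewrite /Q n2.
    have h := ler_pM (normr_ge0 _) (normr_ge0 _) (norm_proj_sa xJ)
      (norm_proj_sa yJ).
    have k : 0 <= 2 * M * `|u| by rewrite !mulr_ge0.
    have := ler_wpM2l k h; have := m3n (proj_sa x) (proj_sa y) u; lra.
have [C hC] := deriv_like_bounded hd.
exists `|C| => a; pose x : B := Unitization 0 (sa_val a).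
have xJ : inJ x.
  by split=> //; apply: unitization_eqP; rewrite /= ?rmorph0// sa_cstar.
have -> : a = proj_sa x by apply: sa_val_inj; rewrite proj_sa_inJ.
rewrite (le_trans (hC x))// (le_trans (ler_wpM2r _ (ler_norm C)))//.
apply: ler_wpM2l => //; rewrite norm_sa proj_sa_inJ//=.
by have := unorm_le (ubound_ex x); rewrite /= rnorm0 add0r.
Qed.

End SelfAdjointDerivation.

(* Restriction of scalars, forgetting completeness. *)
Section Realified.
Context {R : realType} {X : normedModType R[i]}.

Record realified := Realified { unreal : X }.

Lemma unrealK : cancel unreal Realified. Proof. by case. Qed.
Lemma unreal_inj : injective unreal. Proof. exact: can_inj unrealK. Qed.

HB.instance Definition _ := Choice.copy realified (can_type unrealK).

Let radd u v := Realified (unreal u + unreal v).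
Let ropp u := Realified (- unreal u).

Fact raddA : associative radd.
Proof. by move=> u v w; apply: unreal_inj; rewrite /= addrA. Qed.
Fact raddC : commutative radd.
Proof. by move=> u v; apply: unreal_inj; rewrite /= addrC. Qed.
Fact radd0 : left_id (Realified 0) radd.
Proof. by move=> u; apply: unreal_inj; rewrite /= add0r. Qed.
Fact raddN : left_inverse (Realified 0) ropp radd.
Proof. by move=> u; apply: unreal_inj; rewrite /= addNr. Qed.
HB.instance Definition _ := GRing.isZmodule.Build realified
  raddA raddC radd0 raddN.

Let rscale (r : R) u := Realified (r%:C%C *: unreal u).

Fact rscaleA r t u : rscale r (rscale t u) = rscale (r * t) u.
Proof. by apply: unreal_inj; rewrite /= scalerA rmorphM. Qed.
Fact rscale1 : left_id 1 rscale.
Proof. by move=> u; apply: unreal_inj; rewrite /= rmorph1 scale1r. Qed.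
Fact rscaleDr : right_distributive rscale +%R.
Proof. by move=> r u v; apply: unreal_inj; rewrite /= scalerDr. Qed.
Fact rscaleDl u : {morph rscale^~ u : r t / r + t}.
Proof. by move=> r t; apply: unreal_inj; rewrite /= rmorphD scalerDl. Qed.
HB.instance Definition _ := GRing.Zmodule_isLmodule.Build R realified
  rscaleA rscale1 rscaleDr rscaleDl.

Let rn (u : realified) : R := rnorm (unreal u).

Fact rnD u v : rn (u + v) <= rn u + rn v. Proof. exact: rnormD. Qed.
Fact rnZ r u : rn (r *: u) = `|r| * rn u.
Proof. by rewrite /rn /= rnormZ rnorm_real. Qed.
Fact rn0_eq0 u : rn u = 0 -> u = 0.
Proof. by move=> /rnorm0_eq0 h; exact: unreal_inj. Qed.
HB.instance Definition _ := Lmodule_isNormed.Build R realified rnD rnZ rn0_eq0.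

End Realified.
Arguments realified {R} X.

(** * Norm bounds for the module products *)

Section ModuleBounds.
Context {K : numFieldType} (s : K -> K).
Hypothesis s_norm : forall r, `|s r| = `|r|.

Lemma semilinear_additive (U V : lmodType K) (g : U -> V) :
  s 1 = 1 -> Defs.semilinear s g -> forall x y, g (x + y) = g x + g y.
Proof. by move=> s1 gs x y; have := gs 1 x y; rewrite /= s1 !scale1r. Qed.

Lemma semilinear_norm (U : lmodType K) (V : normedModType K) (g : U -> V) :
  s 1 = 1 -> Defs.semilinear s g -> forall r x, `|g (r *: x)| = `|r| * `|g x|.
Proof.
move=> s1 gs r x; have g0 : g 0 = 0.
  by apply: (addIr (g 0)); rewrite -(semilinear_additive s1 gs) !add0r.
by have := gs r x 0; rewrite /= g0 !addr0 => ->; rewrite normrZ s_norm.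
Qed.

End ModuleBounds.

Lemma linear_norm (K : numFieldType) (U : lmodType K) (V : normedModType K)
    (g : U -> V) : linear g -> forall r x, `|g (r *: x)| = `|r| * `|g x|.
Proof. by move=> gl; apply: (@semilinear_norm K id). Qed.

Lemma module_bounds (K : numFieldType) (s : K -> K)
    (E : completeNormedModType K) (tp : E -> E -> E -> E)
    (X : completeNormedModType K) m1 m2 m3 :
  (forall r, `|s r| = `|r|) -> s 1 = 1 ->
  @is_banach_triple_module K s E tp X m1 m2 m3 ->
  exists2 M : K, 0 <= M &
    [/\ forall u a b, `|m1 u a b| <= M * `|u| * `|a| * `|b|,
        forall a u b, `|m2 a u b| <= M * `|a| * `|u| * `|b| &
        forall a b u, `|m3 a b u| <= M * `|a| * `|b| * `|u|].
Proof.
move=> sn s1 [_ hm c1 c2 c3].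
have [M1 M10 h1] := trilinear_bound
  (fun r x y z => linear_norm (jtm1_1x hm y z) r x)
  (fun r x y z => linear_norm (jtm1_1a hm x z) r y)
  (fun r x y z => semilinear_norm sn s1 (jtm1_1b hm x y) r z) c1.
have [M2 M20 h2] := trilinear_bound
  (fun r x y z => semilinear_norm sn s1 (jtm1_2a hm y z) r x)
  (fun r x y z => semilinear_norm sn s1 (jtm1_2x hm x z) r y)
  (fun r x y z => semilinear_norm sn s1 (jtm1_2b hm x y) r z) c2.
have [M3 M30 h3] := trilinear_bound
  (fun r x y z => semilinear_norm sn s1 (jtm1_3a hm y z) r x)
  (fun r x y z => linear_norm (jtm1_3b hm x z) r y)
  (fun r x y z => linear_norm (jtm1_3x hm x y) r z) c3.
exists (M1 + M2 + M3); first by rewrite !addr_ge0.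
have le (N L a b c : K) : 0 <= a -> 0 <= b -> 0 <= c -> N <= L ->
    N * a * b * c <= L * a * b * c.
  by move=> a0 b0 c0 NL; do 3!(apply: ler_wpM2r => //).
split=> x y z.
- by rewrite (le_trans (h1 _ _ _))// le// -addrA lerDl addr_ge0.
- by rewrite (le_trans (h2 _ _ _))// le// addrAC lerDr addr_ge0.
- by rewrite (le_trans (h3 _ _ _))// le// lerDr addr_ge0.
Qed.

(** * Reduction of the complex case to the self-adjoint part *)

Section ComplexCase.
Context {R : realType} {A : cstarAlgType R}.

Lemma rnorm_bound (V : normedModType R[i]) (x : V) (M a b c : R[i])
   (a' b' c' : R) : 0 <= M -> `|x| <= M * a * b * c ->
  a'%:C%C = a -> b'%:C%C = b -> c'%:C%C = c ->
  rnorm x <= complex.Re M * a' * b' * c'.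
Proof.
move=> M0 h ha hb hc; rewrite -lecR rnormE !rmorphM /= ha hb hc RRe_real//.
exact: ger0_real.
Qed.

Lemma complex_derivation_bounded (X : completeNormedModType R[i])
    m1 m2 m3 (delta : A -> X) :
  is_banach_triple_module Num.conj (@cstar_triple R A) m1 m2 m3 ->
  is_triple_derivation Num.conj (@cstar_triple R A) m1 m2 m3 delta ->
  exists C, forall a, `|delta a| <= C * `|a|.
Proof.
move=> hb [ds dl]; have hm := btm_module hb.
have [M M0 [n1 n2 n3]] := module_bounds (@norm_conjC _) (rmorph1 _) hb.
have conjR (r : R) : (r%:C%C)^* = r%:C%C by exact: conjc_real.
have dD x y : delta (x + y) = delta x + delta y.
  by apply: (semilinear_additive _ ds); exact: rmorph1.
pose dR (a : selfAdjoint A) : realified X := Realified (delta (sa_val a)).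
pose m1R (u : realified X) (a b : selfAdjoint A) : realified X :=
  Realified (m1 (unreal u) (sa_val a) (sa_val b)).
pose m2R (a : selfAdjoint A) (u : realified X) (b : selfAdjoint A)
  : realified X := Realified (m2 (sa_val a) (unreal u) (sa_val b)).
pose m3R (a b : selfAdjoint A) (u : realified X) : realified X :=
  Realified (m3 (sa_val a) (sa_val b) (unreal u)).
have [C hC] : exists C : R, forall a, `|dR a| <= C * `|a|.
  apply: (@sa_derivation_bounded R A _ dR m1R m2R m3R (complex.Re M)).
  - by rewrite -lecR rmorph0 RRe_real// ger0_real.
  - move=> r a b; apply: unreal_inj => /=.
    by have := ds (r%:C%C) (sa_val a) (sa_val b); rewrite /= conjR.
  - move=> a b c; apply: unreal_inj.
    by have := dl (sa_val a) (sa_val b) (sa_val c); rewrite -sa_tripleE.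
  - by move=> u a b; apply: rnorm_bound M0 (n1 _ _ _) _ _ _; exact: rnormE.
  - by move=> a u b; apply: rnorm_bound M0 (n2 _ _ _) _ _ _; exact: rnormE.
  - by move=> a b u; apply: rnorm_bound M0 (n3 _ _ _) _ _ _; exact: rnormE.
  - move=> a c r u v; apply: unreal_inj => /=.
    have := jtm1_2x hm (sa_val a) (sa_val c) (r%:C%C) (unreal u) (unreal v).
    by rewrite /= conjR.
  - move=> a a' u c; apply: unreal_inj.
    have h := jtm1_2a hm (unreal u) (sa_val c) (-1) (sa_val a') (sa_val a).
    rewrite /= rmorphN1 !scaleN1r in h.
    by rewrite /m2R sa_valD sa_valN [sa_val a - _]addrC [RHS]addrC.
have hsa a : rnorm (delta (sa_val a)) <= C * `|a| by exact: hC.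
(* Writing a = s1 + i s2 with s1 and s2 self-adjoint, the projection estimates give each norm at
   most 4 |a|. *)
exists (8 * `|C|)%:C%C => a.
pose s1 := proj_sa (Unitization 0 a).
pose s2 := proj_sa (Unitization 0 (- 'i%C *: a)).
have aE : a = 'i%C *: sa_val s2 + sa_val s1.
  have e1 : sa_val s1 = (2^-1)%:C%C *: (a + cstar a) by [].
  have e2 : sa_val s2 = (2^-1)%:C%C *: (- 'i%C *: a + 'i%C *: cstar a).
    rewrite /= cstarZ; congr (_ *: (_ + _ *: _)).
    by apply/eqP; rewrite eq_complex /= oppr0 opprK !eqxx.
  have ii : 'i%C * 'i%C = -1 :> R[i] by rewrite -expr2 sqr_i.
  have hh : (2^-1 : R)%:C%C + (2^-1 : R)%:C%C = 1.
    by rewrite -rmorphD (_ : 2^-1 + 2^-1 = 1) ?rmorph1//; field.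
  rewrite e1 e2; move: hh; set h := _%:C%C => hh.
  have -> : 'i%C *: (h *: (- 'i%C *: a + 'i%C *: cstar a)) = h *: (a - cstar a).
    rewrite scalerA ['i%C * h]mulrC -scalerA scalerDr !scalerA mulrN ii.
    by rewrite opprK scale1r scaleN1r.
  rewrite -scalerDr addrACA addNr addr0 scalerDr -scalerDl hh scale1r.
  by [].
have sn (b : A) : `|proj_sa (Unitization 0 b)| <= 4 * rnorm b.
  pose x : unitization A := Unitization 0 b.
  have h0 : `|proj_sa x| <= 2 * `|projJ x| by exact: rnorm_uelt.
  have h1 := norm_proj x.
  have h2 : `|x| <= rnorm b.
    by have := unorm_le (ubound_ex x); rewrite /= rnorm0 add0r.
  by lra.
have h1 := sn a; have h2 := sn (- 'i%C *: a).
rewrite rnormZ rnormN rnormi mul1r in h2.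
rewrite -!rnormE -rmorphM lecR [in delta a]aE dD.
have -> : delta ('i%C *: sa_val s2) = - 'i%C *: delta (sa_val s2).
  have d0 : delta 0 = 0 by apply: (addIr (delta 0)); rewrite -dD !add0r.
  have := ds 'i%C (sa_val s2) 0; rewrite /= d0 !addr0 => ->; congr (_ *: _).
  by apply/eqP; rewrite eq_complex /= oppr0 !eqxx.
rewrite (le_trans (rnormD _ _))// rnormZ rnormN rnormi mul1r.
have h3 (s : selfAdjoint A) : `|s| <= 4 * rnorm a ->
    rnorm (delta (sa_val s)) <= `|C| * (4 * rnorm a).
  move=> h; rewrite (le_trans (hsa s))// (le_trans (ler_wpM2r _ (ler_norm C)))//.
  exact: ler_wpM2l.
by have := h3 _ h1; have := h3 _ h2; lra.
Qed.

End ComplexCase.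

Theorem theorem20 (R : realType) (A : cstarAlgType R) :
  (forall (X : completeNormedModType R[i])
      (m1 : X -> A -> A -> X) (m2 : A -> X -> A -> X) (m3 : A -> A -> X -> X)
      (delta : A -> X),
    is_banach_triple_module Num.conj (@cstar_triple R A) m1 m2 m3 ->
    is_triple_derivation Num.conj (@cstar_triple R A) m1 m2 m3 delta ->
    continuous delta) /\
  (forall (X : completeNormedModType R)
      (m1 : X -> selfAdjoint A -> selfAdjoint A -> X)
      (m2 : selfAdjoint A -> X -> selfAdjoint A -> X)
      (m3 : selfAdjoint A -> selfAdjoint A -> X -> X)
      (delta : selfAdjoint A -> X),
    is_banach_triple_module id (@sa_triple R A) m1 m2 m3 ->
    is_triple_derivation id (@sa_triple R A) m1 m2 m3 delta ->
    continuous delta).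
Proof.
split=> X m1 m2 m3 delta hb hd.
  have [C hC] := complex_derivation_bounded hb hd.
  apply: bounded_additive_continuous hC => x y.
  have := td_semilinear hd (-1) y x.
  by rewrite /= rmorphN1 !scaleN1r => h; rewrite [x - y]addrC [RHS]addrC.
have hm := btm_module hb; have [dl leib] := hd.
have [M M0 [n1 n2 n3]] := module_bounds (fun=> erefl) erefl hb.
have m2B a a' u c : m2 (a - a') u c = m2 a u c - m2 a' u c.
  have := jtm1_2a hm u c (-1) a' a; rewrite /= !scaleN1r => h.
  by rewrite [a - a']addrC [RHS]addrC.
have [C hC] := sa_derivation_bounded M0 dl leib n1 n2 n3 (jtm1_2x hm) m2B.
apply: bounded_additive_continuous hC => x y.
have := dl (-1) y x; rewrite /= !scaleN1r => h.
by rewrite [x - y]addrC [RHS]addrC.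
Qed.
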